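(* Assume $( * )$, i.e. work in ZF + DC + ''every subset of $2^{\omega}$ has the Baire property''. Then the following hold. (1) Suppose $G$ is a Hausdorff topological group, $(g_n)_{n\in\omega}$ is a sequence in $G$ with $g_n\searrow 1_G$, and $\phi: G\rightarrow H$ is a homomorphism to a group $H$. If it is not the case that $g_n\in\ker(\phi)$ for all sufficiently large $n$, then $|2^{\omega}|\leq |H|$. (2) Suppose $X$ is a topological space, $x\in X$, $(l_n)_{n\in\omega}$ is a sequence of loops at $x$ that is deeply concatenable for a subgroup $K\leq \pi_1(X,x)$, and $\phi: K\rightarrow H$ is a homomorphism to a group $H$. If it is not the case that $[l_n]\in\ker(\phi)$ for all sufficiently large $n$, then $|2^{\omega}|\leq |H|$.
   Context: $( * )$ denotes the theory ZF + DC + ''every subset of the Cantor space $2^{\omega}=\{0,1\}^{\omega}$ (product topology) has the Baire property''; the full axiom of choice is not assumed. DC is the axiom of dependent choice: if $R$ is a binary relation on a nonempty set $X$ with $(\forall x)(\exists y)(xRy)$, then there is a sequence $(z_n)_{n\in\omega}$ with $z_nRz_{n+1}$ for all $n$. A subset $Y$ of a space $X$ has the Baire property if there is an open $U\subseteq X$ such that $Y\Delta U$ is meager in $X$. For sets $X,Y$, $|X|\leq |Y|$ means that there is an injection from $X$ to $Y$. For a sequence $(g_n)_{n\in\omega}$ in a Hausdorff topological group $G$, $g_n\searrow 1_G$ means that for each $\sigma\in 2^{\omega}$ the sequence $(g_0^{\sigma(0)}\cdots g_{n-1}^{\sigma(n-1)})_{n\in\omega}$ converges in $G$. For loops $(l_n)_{n\in\omega}$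 based at $x\in X$, $l_n\searrow x$ means that for every open neighborhood $U$ of $x$ there is $N\in\omega$ such that $l_n([0,1])\subseteq U$ for all $n\geq N$. For a loop $l$ at $x$, $l^0$ is the constant loop at $x$ and $l^1=l$. If $l_n\searrow x$ and $\sigma\in 2^{\omega}$, the loop $l^{\sigma}$ is defined by $l^{\sigma}(t)=l_n^{\sigma(n)}(2^{n+1}(t-1)+2)$ for $t\in[1-\frac{1}{2^n},1-\frac{1}{2^{n+1}}]$, $n\in\omega$, and $l^{\sigma}(1)=x$. The sequence $(l_n)_{n\in\omega}$ is deeply concatenable for $K\leq\pi_1(X,x)$ if $l_n\searrow x$ and $[l^{\sigma}]\in K$ for all $\sigma\in 2^{\omega}$. *)

(* Defs.v *)
(* "Work in ZF + DC + every subset of 2^omega has the Baire property" is read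
   semantically: the theorem is asserted inside an arbitrary model (dom, mem) of
   that first-order theory.  Assuming the Baire property outright for subsets of
   the Rocq type nat -> bool would be a hypothesis refutable by the choice axioms
   commonly added to Rocq, whereas the axiom of choice of the metatheory says
   nothing about a model of ZF.

   All mathematical objects below (functions, groups, topologies, omega, reals,
   loops, homotopies, ...) are elements of the model, and all quantifiers over
   mathematical objects range over elements of the model. *)

From Stdlib Require Import ClassicalEpsilon.

Set Implicit Arguments.
Unset Strict Implicit.
Unset Printing Implicit Defensive.

(** * Structures for the language of set theory, and ZF *)

Record structure := Structure {
  dom :> Type;
  mem : dom -> dom -> Prop;
  dom_inhabited : inhabited dom
}.

Notation "x ∈ A" := (mem x A) (at level 70, no associativity).
Notation "∀ x ∈ A , P" := (forall x, mem x A -> P)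
  (at level 200, x name, A at level 69, P at level 200, right associativity).
Notation "∃ x ∈ A , P" := (exists x, mem x A /\ P)
  (at level 200, x name, A at level 69, P at level 200, right associativity).

(* First-order formulas with de Bruijn variables; [f_all] binds variable 0. *)
Inductive formula :=
  | f_mem (i j : nat)
  | f_eq (i j : nat)
  | f_bot
  | f_imp (f g : formula)
  | f_all (f : formula).

Definition scons {T : Type} (x : T) (e : nat -> T) (n : nat) : T :=
  match n with 0 => x | S k => e k end.

Fixpoint sat {M : structure} (e : nat -> M) (f : formula) : Prop :=
  match f with
  | f_mem i j => e i ∈ e j
  | f_eq i j => e i = e j
  | f_bot => False
  | f_imp f g => sat e f -> sat e g
  | f_all f => forall x : M, sat (scons x e) f
  end.

Record ZF (M : structure) : Prop := {
  ZF_extensionality : forall a b : M, (forall x, x ∈ a <-> x ∈ b) -> a = b;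
  ZF_foundation : forall a : M,
    (exists x, x ∈ a) -> ∃ x ∈ a, ~ (∃ y ∈ x, y ∈ a);
  ZF_pairing : forall a b : M, exists c, forall x, x ∈ c <-> x = a \/ x = b;
  ZF_union : forall a : M, exists u, forall x, x ∈ u <-> ∃ b ∈ a, x ∈ b;
  ZF_powerset : forall a : M, exists p, forall b, b ∈ p <-> (∀ x ∈ b, x ∈ a);
  ZF_infinity : exists w : M,
    (∃ z ∈ w, forall x, ~ x ∈ z) /\
    (∀ n ∈ w, ∃ s ∈ w, forall x, x ∈ s <-> x ∈ n \/ x = n);
  ZF_separation : forall (f : formula) (e : nat -> M) (a : M),
    exists b, forall x, x ∈ b <-> x ∈ a /\ sat (scons x e) f;
  ZF_replacement : forall (f : formula) (e : nat -> M) (a : M),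
    (∀ x ∈ a, exists! y, sat (scons x (scons y e)) f) ->
    exists b, forall y, y ∈ b <-> ∃ x ∈ a, sat (scons x (scons y e)) f
}.

(** * Set-theoretic vocabulary in a structure *)

(* Definite description, in the metatheory: meaningful only where P has a
   unique witness in the model.  In a model of ZF every term below built from
   [the] (or [setof]) is first-order definable from its arguments and takes its
   intended value on its intended domain (as ap f x for x in the domain of f);
   the definitions and the hypotheses only use it there. *)
Definition the {M : structure} (P : M -> Prop) : M := epsilon (dom_inhabited M) P.

(* The set of all x with P x, if the class P is a set of the model. *)
Definition setof {M : structure} (P : M -> Prop) : M :=
  the (fun s => forall x, x ∈ s <-> P x).

Definition subset {M : structure} (A B : M) : Prop := ∀ x ∈ A, x ∈ B.
Definition empty {M : structure} : M := setof (fun _ => False).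
Definition upair {M : structure} (a b : M) : M := setof (fun x => x = a \/ x = b).
Definition opair {M : structure} (a b : M) : M := upair (upair a a) (upair a b).
Definition inter {M : structure} (A B : M) : M := setof (fun x => x ∈ A /\ x ∈ B).
Definition symdiff {M : structure} (A B : M) : M :=
  setof (fun x => (x ∈ A /\ ~ x ∈ B) \/ (x ∈ B /\ ~ x ∈ A)).
Definition bigcup {M : structure} (S : M) : M := setof (fun x => ∃ A ∈ S, x ∈ A).
Definition prod {M : structure} (A B : M) : M :=
  setof (fun p => ∃ a ∈ A, ∃ b ∈ B, p = opair a b).

Definition succ {M : structure} (n : M) : M := setof (fun x => x ∈ n \/ x = n).
Definition omega {M : structure} : M :=
  setof (fun n => forall w, empty ∈ w -> (∀ k ∈ w, succ k ∈ w) -> n ∈ w).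
Definition zero {M : structure} : M := empty.
Definition one {M : structure} : M := succ zero.
Definition two {M : structure} : M := succ one.
Definition nle {M : structure} (m n : M) : Prop := m ∈ n \/ m = n.

Definition is_fun {M : structure} (f A B : M) : Prop :=
  subset f (prod A B) /\ ∀ x ∈ A, exists! y, opair x y ∈ f.
Definition ap {M : structure} (f x : M) : M := the (fun y => opair x y ∈ f).
Definition ap2 {M : structure} (f x y : M) : M := ap f (opair x y).
Definition lam {M : structure} (A : M) (t : M -> M) : M :=
  setof (fun p => ∃ x ∈ A, p = opair x (t x)).
Definition funs {M : structure} (A B : M) : M := setof (fun f => is_fun f A B).

Definition card_le {M : structure} (A B : M) : Prop :=
  exists f, is_fun f A B /\ ∀ x ∈ A, ∀ y ∈ A, ap f x = ap f y -> x = y.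

Definition cantor {M : structure} : M := funs omega two.

(* "P n for all sufficiently large n". *)
Definition eventually {M : structure} (P : M -> Prop) : Prop :=
  ∃ N ∈ omega, ∀ n ∈ omega, nle N n -> P n.

Definition DC (M : structure) : Prop :=
  forall X R : M,
    (exists x, x ∈ X) -> subset R (prod X X) ->
    (∀ x ∈ X, ∃ y ∈ X, opair x y ∈ R) ->
    exists z, is_fun z omega X /\
      ∀ n ∈ omega, opair (ap z n) (ap z (succ n)) ∈ R.

(** * Topology *)

Record is_topology {M : structure} (X T : M) : Prop := {
  top_subset : ∀ U ∈ T, subset U X;
  top_empty : empty ∈ T;
  top_full : X ∈ T;
  top_inter : ∀ U ∈ T, ∀ V ∈ T, inter U V ∈ T;
  top_bigcup : forall S, subset S T -> bigcup S ∈ T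
}.

(* A topology is used below through its predicate "being open". *)
Definition open_in {M : structure} (T : M) : M -> Prop := fun U => U ∈ T.

Definition hausdorff {M : structure} (X : M) (O : M -> Prop) : Prop :=
  ∀ x ∈ X, ∀ y ∈ X, x <> y ->
    exists U V, O U /\ O V /\ x ∈ U /\ y ∈ V /\ inter U V = empty.

Definition continuous {M : structure} (X : M) (OX OY : M -> Prop) (f : M -> M) : Prop :=
  forall V, OY V -> OX (setof (fun x => x ∈ X /\ f x ∈ V)).

Definition prod_open {M : structure} (X : M) (OX : M -> Prop) (Y : M) (OY : M -> Prop)
    (W : M) : Prop :=
  subset W (prod X Y) /\
  ∀ p ∈ W, exists U V, OX U /\ OY V /\ p ∈ prod U V /\ subset (prod U V) W.

Definition subspace_open {M : structure} (A : M) (O : M -> Prop) (W : M) : Prop :=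
  exists U, O U /\ W = inter U A.

Definition converges {M : structure} (O : M -> Prop) (s y : M) : Prop :=
  forall U, O U -> y ∈ U -> eventually (fun n => ap s n ∈ U).

(* Product topology on 2^omega, {0,1} being discrete: the sets
   { tau | tau k = sigma k for all k < n } form a basis (and k < n is k ∈ n). *)
Definition cantor_open {M : structure} (W : M) : Prop :=
  subset W cantor /\
  ∀ sigma ∈ W, ∃ n ∈ omega,
    ∀ tau ∈ cantor, (∀ k ∈ n, ap tau k = ap sigma k) -> tau ∈ W.

Definition closure {M : structure} (X : M) (O : M -> Prop) (A : M) : M :=
  setof (fun x => x ∈ X /\ forall U, O U -> x ∈ U -> ∃ y ∈ U, y ∈ A).

Definition interior {M : structure} (O : M -> Prop) (A : M) : M :=
  setof (fun x => exists U, O U /\ x ∈ U /\ subset U A).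

Definition nowhere_dense {M : structure} (X : M) (O : M -> Prop) (A : M) : Prop :=
  subset A X /\ interior O (closure X O A) = empty.

Definition meager {M : structure} (X : M) (O : M -> Prop) (A : M) : Prop :=
  exists F Z, is_fun F omega Z /\
    (∀ n ∈ omega, nowhere_dense X O (ap F n)) /\
    forall x, x ∈ A <-> ∃ n ∈ omega, x ∈ ap F n.

Definition baire_property {M : structure} (X : M) (O : M -> Prop) (A : M) : Prop :=
  exists U, O U /\ meager X O (symdiff A U).

Definition all_cantor_subsets_baire (M : structure) : Prop :=
  forall A : M, subset A cantor -> baire_property cantor cantor_open A.

(** * Groups *)

(* [C] is the underlying set and [m] the operation, restricted to [C]. *)
Definition unit_of {M : structure} (C : M) (m : M -> M -> M) : M :=
  the (fun e => e ∈ C /\ ∀ x ∈ C, m e x = x /\ m x e = x).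

Definition inv_of {M : structure} (C : M) (m : M -> M -> M) (x : M) : M :=
  the (fun y => y ∈ C /\ m x y = unit_of C m /\ m y x = unit_of C m).

Definition group_laws {M : structure} (C : M) (m : M -> M -> M) : Prop :=
  (∀ x ∈ C, ∀ y ∈ C, m x y ∈ C) /\
  (∀ x ∈ C, ∀ y ∈ C, ∀ z ∈ C, m x (m y z) = m (m x y) z) /\
  ∃ e ∈ C, (∀ x ∈ C, m e x = x /\ m x e = x) /\
           (∀ x ∈ C, ∃ y ∈ C, m x y = e /\ m y x = e).

(* Groups of the model: the operation is itself a set. *)
Definition is_group {M : structure} (G mG : M) : Prop :=
  is_fun mG (prod G G) G /\ group_laws G (ap2 mG).

Definition is_subgroup {M : structure} (K C : M) (m : M -> M -> M) : Prop :=
  subset K C /\ unit_of C m ∈ K /\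
  (∀ x ∈ K, ∀ y ∈ K, m x y ∈ K) /\ (∀ x ∈ K, inv_of C m x ∈ K).

Definition is_hom {M : structure} (phi K : M) (mK : M -> M -> M) (H : M)
    (mH : M -> M -> M) : Prop :=
  is_fun phi K H /\
  ∀ x ∈ K, ∀ y ∈ K, ap phi (mK x y) = mH (ap phi x) (ap phi y).

Definition in_ker {M : structure} (phi K H : M) (mH : M -> M -> M) (x : M) : Prop :=
  x ∈ K /\ ap phi x = unit_of H mH.

Record hausdorff_topological_group {M : structure} (G mG T : M) : Prop := {
  htg_group : is_group G mG;
  htg_topology : is_topology G T;
  htg_mul : continuous (prod G G) (prod_open G (open_in T) G (open_in T))
              (open_in T) (ap mG);
  htg_inv : continuous G (open_in T) (open_in T) (inv_of G (ap2 mG));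
  htg_hausdorff : hausdorff G (open_in T)
}.

(* g^i for i in {0,1}, where g^0 is the given e. *)
Definition pow01 {M : structure} (e g i : M) : M :=
  the (fun y => (i = zero /\ y = e) \/ (i = one /\ y = g)).

(* s is the sequence of products g_0^sigma(0) ... g_{n-1}^sigma(n-1). *)
Definition partial_products {M : structure} (G mG g sigma s : M) : Prop :=
  let e := unit_of G (ap2 mG) in
  is_fun s omega G /\ ap s zero = e /\
  ∀ n ∈ omega, ap s (succ n) = ap2 mG (ap s n) (pow01 e (ap g n) (ap sigma n)).

Definition descends_to_unit {M : structure} (G mG T g : M) : Prop :=
  ∀ sigma ∈ cantor, exists s, partial_products G mG g sigma s /\
    ∃ y ∈ G, converges (open_in T) s y.

(** * The real numbers of the model *)

Record real_data (M : structure) := RealData {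
  rset : M;
  radd_set : M;
  rmul_set : M;
  rlt_set : M
}.

Definition radd {M : structure} (R : real_data M) : M -> M -> M := ap2 (radd_set R).
Definition rmul {M : structure} (R : real_data M) : M -> M -> M := ap2 (rmul_set R).
Definition rlt {M : structure} (R : real_data M) (x y : M) : Prop :=
  opair x y ∈ rlt_set R.
Definition rle {M : structure} (R : real_data M) (x y : M) : Prop :=
  rlt R x y \/ x = y.
Definition r0 {M : structure} (R : real_data M) : M := unit_of (rset R) (radd R).
Definition r1 {M : structure} (R : real_data M) : M := unit_of (rset R) (rmul R).
Definition rsub {M : structure} (R : real_data M) (x y : M) : M :=
  radd R x (inv_of (rset R) (radd R) y).
Definition rdiv {M : structure} (R : real_data M) (x y : M) : M :=
  rmul R x (inv_of (rset R) (rmul R) y).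
Definition r2 {M : structure} (R : real_data M) : M := radd R (r1 R) (r1 R).

(* Dedekind-complete ordered fields: the real numbers, up to isomorphism. *)
Record is_reals {M : structure} (R : real_data M) : Prop := {
  re_add : is_group (rset R) (radd_set R);
  re_addC : ∀ x ∈ rset R, ∀ y ∈ rset R, radd R x y = radd R y x;
  re_mul : is_fun (rmul_set R) (prod (rset R) (rset R)) (rset R);
  re_mulA : ∀ x ∈ rset R, ∀ y ∈ rset R, ∀ z ∈ rset R,
    rmul R x (rmul R y z) = rmul R (rmul R x y) z;
  re_mulC : ∀ x ∈ rset R, ∀ y ∈ rset R, rmul R x y = rmul R y x;
  re_mulD : ∀ x ∈ rset R, ∀ y ∈ rset R, ∀ z ∈ rset R,
    rmul R x (radd R y z) = radd R (rmul R x y) (rmul R x z);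
  re_1 : r1 R ∈ rset R /\ ∀ x ∈ rset R, rmul R (r1 R) x = x;
  re_10 : r1 R <> r0 R;
  re_inv : ∀ x ∈ rset R, x <> r0 R -> ∃ y ∈ rset R, rmul R x y = r1 R;
  re_lt : subset (rlt_set R) (prod (rset R) (rset R));
  re_lt_irrefl : ∀ x ∈ rset R, ~ rlt R x x;
  re_lt_trans : ∀ x ∈ rset R, ∀ y ∈ rset R, ∀ z ∈ rset R,
    rlt R x y -> rlt R y z -> rlt R x z;
  re_lt_total : ∀ x ∈ rset R, ∀ y ∈ rset R, rlt R x y \/ x = y \/ rlt R y x;
  re_lt_add : ∀ x ∈ rset R, ∀ y ∈ rset R, ∀ z ∈ rset R,
    rlt R x y -> rlt R (radd R x z) (radd R y z);
  re_lt_mul : ∀ x ∈ rset R, ∀ y ∈ rset R,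
    rlt R (r0 R) x -> rlt R (r0 R) y -> rlt R (r0 R) (rmul R x y);
  re_complete : forall S, subset S (rset R) -> (exists x, x ∈ S) ->
    (∃ b ∈ rset R, ∀ x ∈ S, rle R x b) ->
    ∃ b ∈ rset R, (∀ x ∈ S, rle R x b) /\
      (∀ c ∈ rset R, (∀ x ∈ S, rle R x c) -> rle R b c)
}.

Definition real_open {M : structure} (R : real_data M) (W : M) : Prop :=
  subset W (rset R) /\
  ∀ x ∈ W, ∃ a ∈ rset R, ∃ b ∈ rset R, rlt R a x /\ rlt R x b /\
    ∀ y ∈ rset R, rlt R a y -> rlt R y b -> y ∈ W.

(* The closed unit interval [0,1] and its subspace topology. *)
Definition unitI {M : structure} (R : real_data M) : M :=
  setof (fun t => t ∈ rset R /\ rle R (r0 R) t /\ rle R t (r1 R)).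
Definition unitI_open {M : structure} (R : real_data M) : M -> Prop :=
  subspace_open (unitI R) (real_open R).

(* 2^n, by recursion along the omega of the model. *)
Definition pow2 {M : structure} (R : real_data M) (n : M) : M :=
  the (fun y => exists p, is_fun p omega (rset R) /\ ap p zero = r1 R /\
    (∀ k ∈ omega, ap p (succ k) = rmul R (r2 R) (ap p k)) /\ y = ap p n).

(** * Loops and the fundamental group *)

Definition is_loop {M : structure} (R : real_data M) (X T x l : M) : Prop :=
  is_fun l (unitI R) X /\
  continuous (unitI R) (unitI_open R) (open_in T) (ap l) /\
  ap l (r0 R) = x /\ ap l (r1 R) = x.

(* Homotopy of loops at x relative to the endpoints. *)
Definition homotopic {M : structure} (R : real_data M) (X T x l l' : M) : Prop :=
  exists h, is_fun h (prod (unitI R) (unitI R)) X /\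
    continuous (prod (unitI R) (unitI R))
      (prod_open (unitI R) (unitI_open R) (unitI R) (unitI_open R))
      (open_in T) (ap h) /\
    ∀ t ∈ unitI R,
      ap2 h t (r0 R) = ap l t /\ ap2 h t (r1 R) = ap l' t /\
      ap2 h (r0 R) t = x /\ ap2 h (r1 R) t = x.

Definition loop_class {M : structure} (R : real_data M) (X T x l : M) : M :=
  setof (fun l' => is_loop R X T x l' /\ homotopic R X T x l l').

Definition pi1 {M : structure} (R : real_data M) (X T x : M) : M :=
  setof (fun c => exists l, is_loop R X T x l /\ c = loop_class R X T x l).

Definition const_loop {M : structure} (R : real_data M) (x : M) : M :=
  lam (unitI R) (fun _ => x).

Definition concat {M : structure} (R : real_data M) (l l' : M) : M :=
  lam (unitI R) (fun t => the (fun y =>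
    let d := rmul R (r2 R) t in
    (rle R d (r1 R) /\ y = ap l d) \/
    (rle R (r1 R) d /\ y = ap l' (rsub R d (r1 R))))).

Definition pi1_mul {M : structure} (R : real_data M) (X T x c d : M) : M :=
  the (fun e => ∃ l ∈ c, ∃ l' ∈ d, e = loop_class R X T x (concat R l l')).

Definition loop_sequence {M : structure} (R : real_data M) (X T x l : M) : Prop :=
  is_fun l omega (funs (unitI R) X) /\ ∀ n ∈ omega, is_loop R X T x (ap l n).

Definition loops_descend {M : structure} (R : real_data M) (T x l : M) : Prop :=
  ∀ U ∈ T, x ∈ U -> eventually (fun n => ∀ t ∈ unitI R, ap (ap l n) t ∈ U).

(* The infinite concatenation l^sigma. *)
Definition loop_power {M : structure} (R : real_data M) (x l sigma : M) : M :=
  lam (unitI R) (fun t => the (fun y =>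
    (t = r1 R /\ y = x) \/
    ∃ n ∈ omega,
      rle R (rsub R (r1 R) (rdiv R (r1 R) (pow2 R n))) t /\
      rle R t (rsub R (r1 R) (rdiv R (r1 R) (pow2 R (succ n)))) /\
      y = ap (pow01 (const_loop R x) (ap l n) (ap sigma n))
             (radd R (rmul R (pow2 R (succ n)) (rsub R t (r1 R))) (r2 R)))).

Definition deeply_concatenable {M : structure} (R : real_data M) (X T x l K : M) : Prop :=
  loops_descend R T x l /\
  ∀ sigma ∈ cantor, loop_class R X T x (loop_power R x l sigma) ∈ K.

(* Main.v *)
(* For sigma in 2^omega let h(sigma) be phi of the limit of g_0^sigma(0) g_1^sigma(1) ...
   (resp. of the class of l^sigma).  Changing sigma(n) from 0 to 1 multiplies this limit
   on the left by a conjugate of g_n (resp. inserts the factor [l_n]), so it changes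
   h(sigma) whenever the n-th term is not in the kernel.  Let E be the set of pairs
   (sigma, tau) with h(sigma) = h(tau), coded as a subset of 2^omega by interleaving.
   If the open set equal to E up to a meager set were nonempty, E would contain two
   pairs that differ in just one such coordinate of tau, which is absurd; hence E is
   meager.  For a meager E there are a point x and consecutive intervals of omega such
   that no point agreeing with x on infinitely many of them is in E.  From x one reads
   off a map y of 2^omega into itself such that for r <> s the pair (y_r, y_s) or the
   pair (y_s, y_r) agrees with x on infinitely many intervals; so h o y is injective.

   All this takes place inside the model, so that every set that is formed and every
   induction along omega needs a first-order definition with parameters. *)

From HB Require Import structures.
From mathcomp Require Import all_boot all_order all_algebra.
From mathcomp Require Import boolp ring lra.
From Stdlib Require Import ClassicalEpsilon.
Require Import Defs.

Set Implicit Arguments.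
Unset Strict Implicit.
Unset Printing Implicit Defensive.

(** * First-order definability with parameters *)

(** Two obstacles shape the proof. The first is definability: a class of the model is a set only if
    a first-order formula cuts it out, while [ap] and [the] take arbitrary values off their domain.
    Hence definability is made a predicate on metatheoretic propositions, closed under the
    connectives, and the notions that enter sets or inductions get a twin built from total definable
    terms.

    The second is category without a product theorem. A meager set comes with a point x and a
    cutting of omega into blocks such that agreeing with x on one late block already keeps a point
    out of any given nowhere dense piece. This is used twice. Altering x at finitely many
    coordinates keeps it outside the meager error of an open set, which gives the two pairs
    differing at one coordinate. And since infinitely many blocks suffice, all other blocks are
    free: each coordinate i of r owns infinitely many blocks, on which r(i) decides which half of x
    is copied. Blocks end at even places, so that they are compatible with interleaving. *)

Definition up (r : nat -> nat) (n : nat) : nat :=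
  match n with 0 => 0 | S k => S (r k) end.

Fixpoint rename (r : nat -> nat) (f : formula) : formula :=
  match f with
  | f_mem i j => f_mem (r i) (r j)
  | f_eq i j => f_eq (r i) (r j)
  | f_bot => f_bot
  | f_imp f g => f_imp (rename r f) (rename r g)
  | f_all f => f_all (rename (up r) f)
  end.

Lemma sat_rename (M : structure) f :
  forall (r : nat -> nat) (e : nat -> M),
  sat e (rename r f) <-> sat (fun n => e (r n)) f.
Proof.
elim: f => [i j|i j||f IHf g IHg|f IHf] r e //=.
- by rewrite IHf IHg.
- split=> H x; have := H x; rewrite IHf.
  all: suff -> : (fun n => scons x e (up r n)) = scons x (fun n => e (r n)) by [].
  all: by apply/funext; case.
Qed.

Section Definable.
Variable M : structure.
Implicit Types (P Q : (nat -> M) -> Prop) (t u : (nat -> M) -> M).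

(* A slot of the environment of a formula holds a variable or a parameter. *)
Definition slot (e : nat -> M) (s : nat + M) : M :=
  match s with inl k => e k | inr c => c end.

(* [e k] is the value of the variable of de Bruijn index [k]. *)
Definition definable P : Prop :=
  exists f (s : nat -> nat + M), forall e, P e <-> sat (fun i => slot e (s i)) f.

Definition tail (e : nat -> M) : nat -> M := fun k => e (S k).

(** The language has no function symbols, so a term is handled through its graph; variable 0 holds
    the value. *)
Definition dterm t : Prop := definable (fun e => e 0 = t (tail e)).

Lemma definable_iff P Q : (forall e, P e <-> Q e) -> definable P -> definable Q.
Proof. by move=> PQ [f [s fs]]; exists f, s => e; rewrite -PQ. Qed.

(** By excluded middle [p] is equivalent to truth or to falsehood, so a proposition that ignores the
    environment may involve notions that are not first order. *)
Lemma definable_const (p : Prop) : definable (fun _ => p).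
Proof.
case: (EM p) => hp; [exists (f_imp f_bot f_bot) | exists f_bot];
  by exists (fun i => inl i) => e /=; tauto.
Qed.

(** The two formulas have their own assignments of slots. These are merged by moving the slots of
    [f] to the even indices and those of [g] to the odd ones. *)
Lemma definable_imp P Q :
  definable P -> definable Q -> definable (fun e => P e -> Q e).
Proof.
move=> [f [s fs]] [g [t gt]].
exists (f_imp (rename (fun i => i.*2) f) (rename (fun i => i.*2.+1) g)).
exists (fun i => if odd i then t i./2 else s i./2) => e /=.
rewrite !sat_rename fs gt.
have -> : (fun n => slot e (if odd n.*2 then t (n.*2)./2 else s (n.*2)./2))
          = (fun i => slot e (s i)).
  by apply/funext => n; rewrite odd_double doubleK.
have -> : (fun n => slot e (if odd n.*2.+1 then t (n.*2.+1)./2 else s (n.*2.+1)./2))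
          = (fun i => slot e (t i)).
  by apply/funext => n; rewrite /= odd_double /= uphalf_double.
by [].
Qed.

(** Variable 0 may occupy many slots of [f]. All of them are renamed to index 0, the one that
    [f_all] binds, and every other slot is shifted under the binder. *)
Lemma definable_all (P : (nat -> M) -> M -> Prop) :
  definable (fun e => P (tail e) (e 0)) -> definable (fun e => forall x, P e x).
Proof.
move=> [f [s fs]].
exists (f_all (rename (fun i => match s i with inl 0 => 0 | _ => i.+1 end) f)).
exists (fun i => match s i with inl k => inl k.-1 | inr c => inr c end) => e /=.
split=> H x.
- rewrite sat_rename; move/(fs (scons x e)): (H x).
  congr (sat _ f); apply/funext => i /=.
  by case E : (s i) => [[|k]|c] //=; rewrite E.
- apply/(fs (scons x e)); move: (H x); rewrite sat_rename.
  congr (sat _ f); apply/funext => i /=.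
  by case E : (s i) => [[|k]|c] //=; rewrite E.
Qed.

Lemma definable_not P : definable P -> definable (fun e => ~ P e).
Proof. by move=> dP; apply: definable_imp dP (definable_const False). Qed.

Lemma definable_and P Q :
  definable P -> definable Q -> definable (fun e => P e /\ Q e).
Proof.
move=> dP dQ; apply: (@definable_iff (fun e => ~ (P e -> ~ Q e))) => [e|].
  by split=> [|[? ?]]; last tauto; case: (EM (P e)) (EM (Q e)) => ? [] ?; tauto.
by apply: definable_not (definable_imp dP (definable_not dQ)).
Qed.

Lemma definable_or P Q :
  definable P -> definable Q -> definable (fun e => P e \/ Q e).
Proof.
move=> dP dQ; apply: (@definable_iff (fun e => ~ P e -> Q e)) => [e|].
  by case: (EM (P e)) => ?; tauto.
by apply: definable_imp dQ; apply: definable_not.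
Qed.

Lemma definable_equiv P Q :
  definable P -> definable Q -> definable (fun e => P e <-> Q e).
Proof. by move=> *; apply: definable_and; apply: definable_imp. Qed.

Lemma definable_ex (P : (nat -> M) -> M -> Prop) :
  definable (fun e => P (tail e) (e 0)) -> definable (fun e => exists x, P e x).
Proof.
move=> dP; apply: (@definable_iff (fun e => ~ forall x, ~ P e x)) => [e|].
  split=> [H|[x Px] H]; last by apply: H Px.
  by apply: contrapT => nE; apply: H => x Px; apply: nE; exists x.
by apply/definable_not/(definable_all (P := fun e x => ~ P e x))/definable_not.
Qed.

Lemma definable_rename (r : nat -> nat) P :
  definable P -> definable (fun e => P (fun k => e (r k))).
Proof.
move=> [f [s fs]].
exists f, (fun i => match s i with inl k => inl (r k) | inr c => inr c end) => e.
rewrite fs; suff -> : (fun i => slot (fun k => e (r k)) (s i)) =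
  (fun i => slot e (match s i with inl k => inl (r k) | inr c => inr c end)) by [].
by apply/funext => i; case: (s i).
Qed.

Lemma definable_skip (P : (nat -> M) -> M -> Prop) :
  definable (fun e => P (tail e) (e 0)) ->
  definable (fun e => P (tail (tail e)) (e 0)).
Proof. exact: (@definable_rename (fun k => match k with 0 => 0 | k => k.+1 end)). Qed.

Lemma dterm_rename (r : nat -> nat) t : dterm t -> dterm (fun e => t (fun k => e (r k))).
Proof. exact: (@definable_rename (up r)). Qed.

Lemma definable_subst (P : (nat -> M) -> M -> Prop) t :
  dterm t -> definable (fun e => P (tail e) (e 0)) -> definable (fun e => P e (t e)).
Proof.
move=> dt dP.
apply: (@definable_iff (fun e => exists x, x = t e /\ P e x)) => [e|].
  by split=> [[x [-> //]]|H]; exists (t e).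
by apply: (definable_ex (P := fun e x => x = t e /\ P e x)); apply: definable_and.
Qed.

Lemma definable_eq_var (i j : nat) : definable (fun e => e i = e j).
Proof. by exists (f_eq i j), inl. Qed.

Lemma definable_mem_var (i j : nat) : definable (fun e => e i ∈ e j).
Proof. by exists (f_mem i j), inl. Qed.

Lemma dterm_var (i : nat) : dterm (fun e => e i).
Proof. exact: (definable_eq_var 0 i.+1). Qed.

Lemma dterm_const (c : M) : dterm (fun _ => c).
Proof.
exists (f_eq 0 1), (fun i => match i with 0 => inl 0 | _ => inr c end) => e.
by [].
Qed.

Lemma definable_mem t u : dterm t -> dterm u -> definable (fun e => t e ∈ u e).
Proof.
move=> dt du.
apply: (definable_subst (P := fun e x => x ∈ u e) dt).
apply: (@definable_iff (fun e => exists y, y = u (tail e) /\ e 0 ∈ y)) => [e|].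
  by split=> [[x [-> //]]|H]; exists (u (tail e)).
apply: (definable_ex (P := fun e y => y = u (tail e) /\ e 0 ∈ y)).
apply: definable_and (definable_mem_var 1 0).
exact: (definable_skip (P := fun e y => y = u e)).
Qed.

Lemma definable_eq t u : dterm t -> dterm u -> definable (fun e => t e = u e).
Proof. by move=> dt du; apply: (definable_subst (P := fun e x => x = u e) dt). Qed.

Lemma dterm_comp (w : M -> M) t :
  dterm (fun e => w (e 0)) -> dterm t -> dterm (fun e => w (t e)).
Proof.
move=> dw dt.
apply: (definable_subst (P := fun e x => e 0 = w x) (dterm_rename S dt)).
exact: (definable_rename (fun k => match k with 0 => 1 | _ => 0 end) dw).
Qed.

Lemma definable_unique (P : (nat -> M) -> M -> Prop) :
  definable (fun e => P (tail e) (e 0)) -> definable (fun e => exists! x, P e x).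
Proof.
move=> dP; apply: (definable_ex (P := fun e => unique (P e))).
apply: definable_and (dP) _.
apply: (definable_all (P := fun e y => P (tail e) y -> e 0 = y)).
apply: definable_imp (definable_eq_var 1 0).
exact: definable_skip.
Qed.

End Definable.

Ltac dterm_hook := fail.
Ltac definable_hook := fail.

(** Propositions and terms that ignore the environment are settled before any decomposition, so
    their inner structure is never inspected. *)
Ltac definable_step :=
  cbv beta delta [tail subset nle];
  lazymatch goal with
  | |- dterm _ =>
    first
    [ assumption
    | lazymatch goal with |- dterm (fun _ => ?c) => exact (dterm_const c) end
    | apply dterm_var
    | dterm_hook
    | match goal with H : dterm _ |- _ => apply (fun r => dterm_rename r H) end ]
  | |- definable _ =>
    first
    [ assumption
    | lazymatch goal with |- definable (fun _ => ?p) => exact (definable_const _ p) end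
    | definable_hook
    | apply definable_mem
    | apply definable_eq
    | apply definable_and
    | apply definable_or
    | apply definable_not
    | apply definable_equiv
    | apply definable_imp
    | refine (@definable_all _ (fun e x => _) _)
    | refine (@definable_ex _ (fun e x => _) _)
    | refine (@definable_unique _ (fun e x => _) _)
    | match goal with H : definable _ |- _ => apply (fun r => definable_rename r H) end ]
  | |- ZF _ => assumption
  end.

Ltac definability := repeat definable_step.

(** * Set theory inside a model *)

Lemma theE (M : structure) (P : M -> Prop) y :
  P y -> (forall z, P z -> z = y) -> the P = y.
Proof. by move=> Py uy; apply: uy; apply: epsilon_spec; exists y. Qed.

Lemma the_spec (M : structure) (P : M -> Prop) : (exists y, P y) -> P (the P).
Proof. exact: epsilon_spec. Qed.

Lemma setofE (M : structure) (P : M -> Prop) :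
  (exists s, forall x, x ∈ s <-> P x) -> forall x, x ∈ setof P <-> P x.
Proof. exact: the_spec. Qed.

Section SetTheory.
Variable M : structure.
Hypothesis hZF : ZF M.
Implicit Types (A B C X Y Z a b c d x y z : M) (P : M -> Prop).

Lemma set_ext A B : (forall x, x ∈ A <-> x ∈ B) -> A = B.
Proof. exact: (ZF_extensionality hZF). Qed.

(** The formula may mention further variables, but its truth depends on variable 0 alone. It is
    therefore read in the environment constantly equal to [x], which sends every variable to index 0
    and leaves the other indices to the parameters. *)
Lemma separation P A :
  definable (fun e => P (e 0)) -> exists s, forall x, x ∈ s <-> x ∈ A /\ P x.
Proof.
move=> [f [s fs]].
have [b hb] := ZF_separation hZF
  (rename (fun i => match s i with inl _ => 0 | inr _ => i.+1 end) f)
  (fun i => match s i with inl _ => A | inr c => c end) A.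
exists b => x; rewrite hb sat_rename (fs (fun _ => x)).
suff -> : (fun n => scons x (fun i => match s i with inl _ => A | inr c => c end)
   (match s n with inl _ => 0 | inr _ => n.+1 end)) = (fun i => slot (fun=> x) (s i)) by [].
by apply/funext => n /=; case E : (s n) => [k|c] //=; rewrite E.
Qed.

Lemma sub_set_ex P A : (forall x, P x -> x ∈ A) -> definable (fun e => P (e 0)) ->
  exists s, forall x, x ∈ s <-> P x.
Proof.
move=> PA dP; have [s hs] := separation A dP; exists s => x; rewrite hs.
by split=> [[]|Px] //; split=> //; apply: PA.
Qed.

Lemma image_ex (t : M -> M) A :
  dterm (fun e => t (e 0)) -> exists s, forall y, y ∈ s <-> ∃ x ∈ A, y = t x.
Proof.
move=> [f [s fs]].
pose r i := match s i with inl 0 => 1 | inl _ => 0 | inr _ => i.+2 end.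
pose p i := match s i with inl _ => A | inr c => c end.
have key x y : sat (scons x (scons y p)) (rename r f) <-> y = t x.
  rewrite sat_rename (fs (scons y (fun _ => x))).
  suff -> : (fun n => scons x (scons y p) (r n)) =
    (fun i => slot (scons y (fun=> x)) (s i)) by [].
  by apply/funext => n; rewrite /r; case E : (s n) => [[|k]|c] //=; rewrite /p E.
have [|b hb] := ZF_replacement hZF (f := rename r f) (e := p) (a := A).
  by move=> x _; exists (t x); split=> [|y]; rewrite key.
by exists b => y; rewrite hb; split=> -[x [xA H]]; exists x; split=> //; apply/key.
Qed.

Lemma in_empty x : ~ x ∈ (empty : M).
Proof.
have [w _] := ZF_infinity hZF.
have H : exists s : M, forall x : M, x ∈ s <-> False.
  by apply: (@sub_set_ex (fun _ => False) w) => //; definability.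
by move=> /(setofE H).
Qed.

Lemma in_upair a b x : x ∈ upair a b <-> x = a \/ x = b.
Proof. exact: (@setofE M _ (ZF_pairing hZF a b)). Qed.

Lemma in_bigcup A x : x ∈ bigcup A <-> ∃ B ∈ A, x ∈ B.
Proof. exact: (@setofE M _ (ZF_union hZF A)). Qed.

Definition pow A : M := setof (fun b => subset b A).
Lemma in_pow A b : b ∈ pow A <-> subset b A.
Proof. exact: (@setofE M _ (ZF_powerset hZF A)). Qed.

Lemma in_inter A B x : x ∈ inter A B <-> x ∈ A /\ x ∈ B.
Proof.
apply: setofE; apply: (sub_set_ex (A := A)); first by move=> y [].
by definability.
Qed.

Definition cup A B : M := bigcup (upair A B).
Lemma in_cup A B x : x ∈ cup A B <-> x ∈ A \/ x ∈ B.
Proof.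
rewrite in_bigcup; split=> [[C [/in_upair [] ->]]|]; [by left|by right|].
by case=> H; [exists A|exists B]; rewrite in_upair; auto.
Qed.

Lemma in_symdiff A B x :
  x ∈ symdiff A B <-> (x ∈ A /\ ~ x ∈ B) \/ (x ∈ B /\ ~ x ∈ A).
Proof.
apply: (@setofE M (fun x => (x ∈ A /\ ~ x ∈ B) \/ (x ∈ B /\ ~ x ∈ A))).
apply: (sub_set_ex (A := cup A B)); last by definability.
by move=> y; rewrite in_cup; tauto.
Qed.

Lemma in_succ a x : x ∈ succ a <-> x ∈ a \/ x = a.
Proof.
apply: (@setofE M (fun x => x ∈ a \/ x = a)).
apply: (sub_set_ex (A := cup a (upair a a))); last by definability.
by move=> y; rewrite in_cup in_upair; tauto.
Qed.

Lemma upair1_inj a b c : upair a a = upair b c -> a = b /\ a = c.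
Proof.
move=> E; have [Hb Hc] : b ∈ upair a a /\ c ∈ upair a a.
  by rewrite E !in_upair; auto.
by move/in_upair: Hb; move/in_upair: Hc => [] -> [] ->.
Qed.

Lemma opair_inj a b c d : opair a b = opair c d -> a = c /\ b = d.
Proof.
move=> E.
have H x : x ∈ opair a b <-> x ∈ opair c d by rewrite E.
have ac : a = c.
  have /H : upair a a ∈ opair a b by rewrite in_upair; left.
  by move/in_upair => [] /upair1_inj [].
subst c; split=> //.
have /H : upair a b ∈ opair a b by rewrite in_upair; right.
move/in_upair => [/esym/upair1_inj [_ ab]|Eb]; last first.
  have /in_upair [ba|//] : b ∈ upair a d by rewrite -Eb in_upair; right.
  have : d ∈ upair a b by rewrite Eb in_upair; right.
  by rewrite ba => /in_upair [] ->.
subst b.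
have : upair a d ∈ opair a d by rewrite in_upair; right.
by rewrite -H in_upair => -[] /esym /upair1_inj [].
Qed.

(** By extensionality the graph says that variable 0 has the right elements. Existence is required
    for every environment, because [setof] of a proper class is an arbitrary value. *)
Lemma dterm_setof (P : (nat -> M) -> M -> Prop) :
  (forall e, exists s, forall x, x ∈ s <-> P e x) ->
  definable (fun e => P (tail e) (e 0)) -> dterm (fun e => setof (P e)).
Proof.
move=> exP dP.
apply: (@definable_iff _ (fun e => forall x, x ∈ e 0 <-> P (tail e) x)) => [e|].
  split=> [H|->]; last exact: setofE.
  by apply: set_ext => x; rewrite H (setofE (exP (tail e))).
apply: (definable_all (P := fun e x => x ∈ e 0 <-> P (tail e) x)).
apply: definable_equiv; first exact: definable_mem_var.
exact: (definable_skip (P := P)).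
Qed.

Lemma dterm_upair t u : dterm t -> dterm u -> dterm (fun e => upair (t e) (u e) : M).
Proof.
move=> dt du; apply: (dterm_setof (P := fun e x => x = t e \/ x = u e)).
  by move=> e; apply: ZF_pairing.
by definability.
Qed.

Lemma dterm_opair t u : dterm t -> dterm u -> dterm (fun e => opair (t e) (u e) : M).
Proof. by move=> dt du; apply: dterm_upair; apply: dterm_upair. Qed.

Lemma dterm_bigcup t : dterm t -> dterm (fun e => bigcup (t e) : M).
Proof.
move=> dt; apply: (dterm_setof (P := fun e x => ∃ B ∈ t e, x ∈ B)).
  by move=> e; apply: ZF_union.
by definability.
Qed.

Lemma dterm_inter t u : dterm t -> dterm u -> dterm (fun e => inter (t e) (u e) : M).
Proof.
move=> dt du; apply: (dterm_setof (P := fun e x => x ∈ t e /\ x ∈ u e)).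
  move=> e; apply: (sub_set_ex (A := t e)); first by move=> y [].
  by definability.
by definability.
Qed.

Lemma dterm_cup t u : dterm t -> dterm u -> dterm (fun e => cup (t e) (u e) : M).
Proof. by move=> dt du; apply: dterm_bigcup; apply: dterm_upair. Qed.

Lemma dterm_succ t : dterm t -> dterm (fun e => succ (t e) : M).
Proof.
move=> dt; apply: (dterm_setof (P := fun e x => x ∈ t e \/ x = t e)).
  move=> e; exists (succ (t e)); exact: in_succ.
by definability.
Qed.

Lemma in_prod A B p : p ∈ prod A B <-> ∃ a ∈ A, ∃ b ∈ B, p = opair a b.
Proof.
apply: (@setofE M (fun p => ∃ a ∈ A, ∃ b ∈ B, p = opair a b)).
apply: (sub_set_ex (A := pow (pow (cup A B)))); last first.
  by definability; apply: dterm_opair; definability.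
move=> _ [a [aA [b [bB ->]]]]; rewrite in_pow => c.
rewrite in_upair in_pow => -[] -> d; rewrite in_upair in_cup => -[] ->; auto.
Qed.

Lemma opair_in_prod A B a b : opair a b ∈ prod A B <-> a ∈ A /\ b ∈ B.
Proof.
rewrite in_prod; split=> [[a' [aA [b' [bB /opair_inj [-> ->]]]]] //|[aA bB]].
by exists a; split=> //; exists b.
Qed.

Lemma dterm_prod t u : dterm t -> dterm u -> dterm (fun e => prod (t e) (u e) : M).
Proof.
move=> dt du.
apply: (dterm_setof (P := fun e p => ∃ a ∈ t e, ∃ b ∈ u e, p = opair a b)).
  by move=> e; exists (prod (t e) (u e)); apply: in_prod.
by definability; apply: dterm_opair; definability.
Qed.

(** Given by the elements of the coordinate and not by a description, so that the projections are
    definable for every argument; a set that is no pair is sent to the empty set. *)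
Definition pfst p : M := setof (fun z => exists a b, p = opair a b /\ z ∈ a).
Definition psnd p : M := setof (fun z => exists a b, p = opair a b /\ z ∈ b).

Lemma opair_sub a b : subset (cup a b) (bigcup (bigcup (opair a b))).
Proof.
move=> z; rewrite in_cup => H; apply/in_bigcup.
case: H => H; [exists a | exists b]; split=> //; apply/in_bigcup;
  exists (upair a b); rewrite !in_upair; auto.
Qed.

Lemma pfst_ex p : exists s, forall z : M, z ∈ s <-> exists a b, p = opair a b /\ z ∈ a.
Proof.
apply: (sub_set_ex (A := bigcup (bigcup p))) => [z [a [b [-> za]]]|].
  by apply: opair_sub; rewrite in_cup; left.
by definability; apply: dterm_opair; definability.
Qed.

Lemma psnd_ex p : exists s, forall z : M, z ∈ s <-> exists a b, p = opair a b /\ z ∈ b.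
Proof.
apply: (sub_set_ex (A := bigcup (bigcup p))) => [z [a [b [-> za]]]|].
  by apply: opair_sub; rewrite in_cup; right.
by definability; apply: dterm_opair; definability.
Qed.

Lemma dterm_pfst t : dterm t -> dterm (fun e => pfst (t e)).
Proof.
move=> dt.
apply: (dterm_setof (P := fun e z => exists a b, t e = opair a b /\ z ∈ a)).
  by move=> e; apply: pfst_ex.
by definability; apply: dterm_opair; definability.
Qed.

Lemma dterm_psnd t : dterm t -> dterm (fun e => psnd (t e)).
Proof.
move=> dt.
apply: (dterm_setof (P := fun e z => exists a b, t e = opair a b /\ z ∈ b)).
  by move=> e; apply: psnd_ex.
by definability; apply: dterm_opair; definability.
Qed.

Lemma pfstE a b : pfst (opair a b) = a.
Proof.
apply: set_ext => z; rewrite (setofE (pfst_ex _)).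
by split=> [[a' [b' [/opair_inj [-> _]]]]|za] //; exists a, b.
Qed.

Lemma psndE a b : psnd (opair a b) = b.
Proof.
apply: set_ext => z; rewrite (setofE (psnd_ex _)).
by split=> [[a' [b' [/opair_inj [_ ->]]]]|za] //; exists a, b.
Qed.

Definition ite (p : Prop) a b : M := setof (fun z => (p /\ z ∈ a) \/ (~ p /\ z ∈ b)).

Lemma ite_ex (p : Prop) a b :
  exists s, forall z : M, z ∈ s <-> (p /\ z ∈ a) \/ (~ p /\ z ∈ b).
Proof.
apply: (sub_set_ex (A := cup a b)); last by definability.
by move=> z; rewrite in_cup; tauto.
Qed.

Lemma ite_true (p : Prop) a b : p -> ite p a b = a.
Proof. by move=> hp; apply: set_ext => z; rewrite (setofE (ite_ex _ _ _)); tauto. Qed.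

Lemma ite_false (p : Prop) a b : ~ p -> ite p a b = b.
Proof. by move=> hp; apply: set_ext => z; rewrite (setofE (ite_ex _ _ _)); tauto. Qed.

Lemma ite_bool (q : bool) (p : Prop) a b : p <-> q -> ite p a b = if q then a else b.
Proof. by case: q => pq; [rewrite ite_true //; apply/pq|rewrite ite_false // => /pq]. Qed.

Lemma dterm_ite (Q : (nat -> M) -> Prop) t u :
  definable Q -> dterm t -> dterm u -> dterm (fun e => ite (Q e) (t e) (u e)).
Proof.
move=> dQ dt du.
apply: (dterm_setof (P := fun e z => (Q e /\ z ∈ t e) \/ (~ Q e /\ z ∈ u e))).
  by move=> e; apply: ite_ex.
by definability.
Qed.

(* Unlike [ap], whose junk values come from a choice operator, [app] is
   first-order definable for all values of its arguments. *)
Definition app f x : M := setof (fun z => exists y, opair x y ∈ f /\ z ∈ y).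

Lemma app_ex f x : exists s, forall z : M, z ∈ s <-> exists y, opair x y ∈ f /\ z ∈ y.
Proof.
apply: (sub_set_ex (A := bigcup (bigcup (bigcup f)))) => [z [y [xyf zy]]|].
  have : z ∈ cup x y by rewrite in_cup; right.
  move/opair_sub/in_bigcup => [b [/in_bigcup [c [cp bc]] zb]].
  apply/in_bigcup; exists b; split=> //; apply/in_bigcup; exists c; split=> //.
  by apply/in_bigcup; exists (opair x y).
by definability; apply: dterm_opair; definability.
Qed.

Lemma dterm_app t u : dterm t -> dterm u -> dterm (fun e => app (t e) (u e)).
Proof.
move=> dt du.
apply: (dterm_setof (P := fun e z => exists y, opair (u e) y ∈ t e /\ z ∈ y)).
  by move=> e; apply: app_ex.
by definability; apply: dterm_opair; definability.
Qed.

Lemma is_fun_ap f A B x : is_fun f A B -> x ∈ A ->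
  [/\ opair x (ap f x) ∈ f, ap f x ∈ B & forall y, opair x y ∈ f -> y = ap f x].
Proof.
move=> [fAB fun_f] xA; have [y [xy uy]] := fun_f x xA.
have E : ap f x = y by apply: theE => // z /uy.
by rewrite E; split=> // [|z /uy //]; have /opair_in_prod [] := fAB _ xy.
Qed.

Lemma ap_in f A B x : is_fun f A B -> x ∈ A -> ap f x ∈ B.
Proof. by move=> hf xA; case: (is_fun_ap hf xA). Qed.

Lemma in_fun f A B x y : is_fun f A B -> opair x y ∈ f <-> x ∈ A /\ y = ap f x.
Proof.
move=> hf; split=> [xy|[xA ->]]; last by case: (is_fun_ap hf xA).
by have /opair_in_prod [xA _] := hf.1 _ xy; case: (is_fun_ap hf xA) => _ _ /(_ _ xy).
Qed.

Lemma ap_app f A B x : is_fun f A B -> x ∈ A -> ap f x = app f x.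
Proof.
move=> hf xA; apply: set_ext => z; rewrite (setofE (app_ex _ _)).
split=> [zy|[y []]]; first by exists (ap f x); split=> //; apply/(in_fun _ _ hf).
by rewrite (in_fun _ _ hf) => -[_ ->].
Qed.

Lemma fun_ext f g A B B' : is_fun f A B -> is_fun g A B' ->
  (∀ x ∈ A, ap f x = ap g x) -> f = g.
Proof.
move=> hf hg fg; apply: set_ext => p; split=> pf.
  have /in_prod [x [xA [y [_ E]]]] := hf.1 _ pf; subst p; move: pf.
  by rewrite (in_fun _ _ hf) (in_fun _ _ hg) => -[_ ->]; rewrite fg.
have /in_prod [x [xA [y [_ E]]]] := hg.1 _ pf; subst p; move: pf.
by rewrite (in_fun _ _ hf) (in_fun _ _ hg) => -[_ ->]; rewrite fg.
Qed.

Lemma in_funs f A B : f ∈ funs A B <-> is_fun f A B.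
Proof.
apply: (@setofE M (fun f => is_fun f A B)).
apply: (sub_set_ex (A := pow (prod A B))) => [g [] gAB _|]; first by rewrite in_pow.
by rewrite /is_fun; definability; apply: dterm_opair; definability.
Qed.

Lemma in_lam A (t : M -> M) p : dterm (fun e => t (e 0)) ->
  p ∈ lam A t <-> ∃ x ∈ A, p = opair x (t x).
Proof.
move=> dt; apply: (@setofE M (fun p => ∃ x ∈ A, p = opair x (t x))).
by apply: (image_ex (t := fun x => opair x (t x))); apply: dterm_opair; definability.
Qed.

Lemma opair_in_lam A (t : M -> M) x y : dterm (fun e => t (e 0)) ->
  opair x y ∈ lam A t <-> x ∈ A /\ y = t x.
Proof.
move=> dt; rewrite in_lam //; split=> [[x' [xA /opair_inj [-> ->]]] //|[xA ->]].
by exists x.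
Qed.

Lemma lam_fun A B (t : M -> M) : dterm (fun e => t (e 0)) -> (∀ x ∈ A, t x ∈ B) ->
  is_fun (lam A t) A B.
Proof.
move=> dt tB; split=> [p|x xA].
  by rewrite in_lam // => -[x [xA ->]]; rewrite opair_in_prod; split=> //; apply: tB.
by exists (t x); split=> [|y]; rewrite opair_in_lam // => -[].
Qed.

Lemma ap_lam A (t : M -> M) x : dterm (fun e => t (e 0)) -> x ∈ A ->
  ap (lam A t) x = t x.
Proof.
move=> dt xA; apply: theE => [|y]; first exact/opair_in_lam.
by rewrite opair_in_lam // => -[].
Qed.

End SetTheory.

Ltac dterm_ops :=
  lazymatch goal with
  | |- dterm (fun e => upair (@?a e) (@?b e)) => apply dterm_upair
  | |- dterm (fun e => opair (@?a e) (@?b e)) => apply dterm_opair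
  | |- dterm (fun e => bigcup (@?a e)) => apply dterm_bigcup
  | |- dterm (fun e => inter (@?a e) (@?b e)) => apply dterm_inter
  | |- dterm (fun e => cup (@?a e) (@?b e)) => apply dterm_cup
  | |- dterm (fun e => succ (@?a e)) => apply dterm_succ
  | |- dterm (fun e => prod (@?a e) (@?b e)) => apply dterm_prod
  | |- dterm (fun e => pfst (@?a e)) => apply dterm_pfst
  | |- dterm (fun e => psnd (@?a e)) => apply dterm_psnd
  | |- dterm (fun e => ite (@?a e) (@?b e) (@?c e)) => apply dterm_ite
  | |- dterm (fun e => app (@?a e) (@?b e)) => apply dterm_app
  end.
Ltac dterm_hook ::= dterm_ops.

(** * The natural numbers of a model *)

Section Omega.
Variable M : structure.
Hypothesis hZF : ZF M.
Implicit Types (A B C X Y Z a b c d x y z : M) (P : M -> Prop).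

Lemma in_omega a :
  a ∈ omega <-> forall w, zero ∈ w -> (∀ k ∈ w, succ k ∈ w) -> a ∈ w.
Proof.
apply: (@setofE M (fun n => forall w, empty ∈ w -> (∀ k ∈ w, succ k ∈ w) -> n ∈ w)).
have [w [[z [zw z0]] ws]] := ZF_infinity hZF.
apply: (sub_set_ex hZF (A := w)) => [x|]; last by definability.
apply=> [|k kw].
  suff -> : empty = z by [].
  by apply: (set_ext hZF) => y; split=> [/(in_empty hZF)|/z0].
have [s [sw hs]] := ws _ kw; suff -> : succ k = s by [].
by apply: (set_ext hZF) => y; rewrite hs (in_succ hZF).
Qed.

Lemma zero_omega : zero ∈ (omega : M).
Proof. by apply/in_omega => w. Qed.

Lemma succ_omega a : a ∈ omega -> succ a ∈ omega.
Proof. by move/in_omega => ao; apply/in_omega => w w0 ws; apply/ws/ao. Qed.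

Lemma omega_ind P : definable (fun e => P (e 0)) ->
  P zero -> (∀ k ∈ omega, P k -> P (succ k)) -> ∀ k ∈ omega, P k.
Proof.
move=> dP P0 PS k ko; have [s hs] := separation hZF omega dP.
have : k ∈ s; last by rewrite hs => -[].
move/in_omega: ko; apply=> [|n]; rewrite !hs; first by split; first exact: zero_omega.
by case=> no Pn; split; [apply: succ_omega|apply: PS].
Qed.

Lemma omega_cases a : a ∈ omega -> a = zero \/ ∃ b ∈ omega, a = succ b.
Proof.
move: a; apply: omega_ind; [by definability | by left | by move=> k ko _; right; exists k].
Qed.

Lemma omega_mem a b : a ∈ omega -> b ∈ a -> b ∈ omega.
Proof.
suff H : ∀ n ∈ omega, subset n (omega : M) by move=> ao; apply: H.
apply: omega_ind => [|x|k ko kb x]; [by definability | by move/(in_empty hZF) |].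
by rewrite in_succ // => -[/kb|->].
Qed.

Lemma mem_trans a b c : c ∈ omega -> a ∈ b -> b ∈ c -> a ∈ c.
Proof.
move=> co ab; move: c co; apply: omega_ind => [|/(in_empty hZF)|k ko kb] //.
  by definability.
by rewrite !(in_succ hZF) => -[/kb|<-]; auto.
Qed.

Lemma mem_irrefl a : ~ a ∈ a.
Proof.
move=> aa; have [|x] := ZF_foundation hZF (a := upair a a).
  by exists a; rewrite in_upair //; left.
by rewrite in_upair // => -[[] -> []]; exists a; rewrite in_upair; auto.
Qed.

Lemma mem_asym a b : a ∈ omega -> b ∈ a -> ~ a ∈ b.
Proof. by move=> ao ba ab; apply: (@mem_irrefl a); apply: mem_trans ab ba. Qed.

Lemma mem_succ a : a ∈ succ a.
Proof. by rewrite in_succ; auto. Qed.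

Lemma succ_mem a b : b ∈ omega -> a ∈ b -> succ a ∈ succ b.
Proof.
move=> bo; move: b bo a.
apply: omega_ind => [|a /(in_empty hZF) //|k ko H a]; first by definability.
rewrite in_succ // => -[/H|->]; last exact: mem_succ.
by rewrite !(in_succ hZF); tauto.
Qed.

Lemma zero_nle a : a ∈ omega -> nle zero a.
Proof.
move: a; apply: omega_ind => [||k ko [H|->]]; [by definability | by right | |].
  by left; rewrite in_succ; auto.
by left; apply: mem_succ.
Qed.

Lemma omega_lt_or_le a b : a ∈ omega -> b ∈ omega -> a ∈ b \/ nle b a.
Proof.
move=> ao; move: b; apply: omega_ind => [||k ko]; first by definability.
  by right; apply: zero_nle.
case=> [ak|[ka|->]].
- by left; rewrite in_succ; auto.
- have /(in_succ hZF) [] := succ_mem ao ka; first by right; left.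
  by move=> ->; right; right.
- by left; apply: mem_succ.
Qed.

Lemma nle_trans a b c : c ∈ omega -> nle a b -> nle b c -> nle a c.
Proof.
move=> co [ab|->] // [bc|<-]; last by left.
by left; apply: mem_trans bc.
Qed.

Lemma mem_nle_trans a b c : c ∈ omega -> a ∈ b -> nle b c -> a ∈ c.
Proof. by move=> co ab [bc|<-] //; apply: mem_trans bc. Qed.

Lemma nle_mem_trans a b c : c ∈ omega -> nle a b -> b ∈ c -> a ∈ c.
Proof. by move=> co [ab|->] // bc; apply: mem_trans bc. Qed.

Lemma succ_nle a b : b ∈ omega -> a ∈ b -> nle (succ a) b.
Proof. by move=> bo ab; apply/(in_succ hZF)/succ_mem. Qed.

Lemma succ_inj a b : b ∈ omega -> succ a = succ b -> a = b.
Proof.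
move=> bo E; have : a ∈ succ b by rewrite -E; apply: mem_succ.
rewrite in_succ // => -[ab|] //.
have : b ∈ succ a by rewrite E; apply: mem_succ.
by rewrite in_succ // => -[ba|] //; case: (mem_asym bo ab).
Qed.

Lemma succ_neq_zero a : succ a <> zero.
Proof. by move=> E; apply: (@in_empty _ hZF a); rewrite -[empty]E; apply: mem_succ. Qed.

Lemma omega_least P : definable (fun e => P (e 0)) -> (∃ k ∈ omega, P k) ->
  ∃ k ∈ omega, P k /\ ∀ j ∈ k, ~ P j.
Proof.
move=> dP [k [ko Pk]]; have [s hs] := separation hZF omega dP.
have [|m [ms Hm]] := ZF_foundation hZF (a := s).
  by exists k; rewrite hs.
move: ms; rewrite hs => -[mo Pm]; exists m; split=> //; split=> // j jm Pj.
by apply: Hm; exists j; split=> //; rewrite hs; split=> //; apply: omega_mem jm.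
Qed.

Lemma in_two x : x ∈ two <-> x = zero \/ x = one.
Proof.
rewrite /two /one !(in_succ hZF); split; last tauto.
by case=> [[/(in_empty hZF)|]|]; auto.
Qed.

Lemma one_neq_zero : one <> zero :> M.
Proof. exact: succ_neq_zero. Qed.

(** The sequence is the least set of pairs that contains (0, a) and with (n, x) also (n + 1, F x).
    Minimality makes it single-valued. *)
Theorem recursion A a F : a ∈ A -> is_fun F A A ->
  exists z, is_fun z omega A /\ ap z zero = a /\
    ∀ n ∈ omega, ap z (succ n) = ap F (ap z n).
Proof.
move=> aA hF.
pose closed S := opair zero a ∈ S /\
  ∀ n ∈ omega, ∀ x ∈ A, opair n x ∈ S -> opair (succ n) (app F x) ∈ S.
have [z hz] := @separation _ hZF (fun p => forall S, closed S -> p ∈ S) (prod omega A)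
  ltac:(by definability).
have clA : closed (prod omega A).
  rewrite /closed !(opair_in_prod hZF); split; first by split=> //; apply: zero_omega.
  move=> n no x xA; rewrite !(opair_in_prod hZF) => _.
  by split; [apply: succ_omega|rewrite -(ap_app hZF hF) //; apply: (ap_in hZF hF)].
have clz : closed z.
  split; first by rewrite hz; split=> [|S []] //; apply clA.
  move=> n no x xA; rewrite !hz => -[nx H]; split; first by apply clA.
  by move=> S clS; have := H S clS; apply clS.
have inz n x : opair n x ∈ z -> n ∈ omega /\ x ∈ A.
  by rewrite hz => -[/(opair_in_prod hZF)].
(* removing a pair other than (0, a) and (n + 1, F x) with (n, x) in z keeps z closed *)
have remove n y : opair n y ∈ z -> (n = zero -> y <> a) ->
    (forall m x, opair m x ∈ z -> n = succ m -> y <> app F x) -> False.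
  move=> ny n0 nS.
  have [s hs] := @separation _ hZF (fun p => p <> opair n y) z ltac:(by definability).
  have : closed s.
    split; first by rewrite hs; split; [apply clz|move/(opair_inj hZF) => [/esym/n0 + /esym]].
    move=> m mo x xA; rewrite !hs => -[mx _]; split; first exact: clz.2.
    by move/(opair_inj hZF) => [/esym /(nS _ _ mx) + /esym].
  by move: ny; rewrite hz => -[_ H] /H; rewrite hs => -[].
have fz : is_fun z omega A.
  split=> [p|]; first by rewrite hz => -[].
  apply: omega_ind; first by definability.
    exists a; split=> [|y ay]; first exact: clz.1.
    apply: contrapT => ya; apply: (remove _ _ ay) => [_ /esym //|m x _ /esym].
    by move/succ_neq_zero.
  move=> n no [x [nx ux]]; exists (app F x); have [_ xA] := inz _ _ nx.
  split=> [|y ny]; first by apply clz.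
  apply: contrapT => xy; apply: (remove _ _ ny) => [/succ_neq_zero //|m x' mx'].
  move/succ_inj => E; have [mo _] := inz _ _ mx'.
  by move: mx'; rewrite -(E mo) => /ux <- /esym.
have zE n y : opair n y ∈ z -> ap z n = y by move/(in_fun hZF _ _ fz) => [].
exists z; split=> //; split=> [|n no]; first exact: zE clz.1.
have zA := ap_in hZF fz no.
by apply: zE; rewrite (ap_app hZF hF) //; apply clz => //; apply/(in_fun hZF _ _ fz).
Qed.

End Omega.

(** * The Cantor space *)

Section SetOps.
Variable M : structure.
Hypothesis hZF : ZF M.
Implicit Types (A B C D F X Y Z a b c d i j k m n s t u x y z : M) (P : M -> Prop).

Lemma dterm_symdiff (t u : (nat -> M) -> M) :
  dterm t -> dterm u -> dterm (fun e => symdiff (t e) (u e)).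
Proof.
move=> dt du.
apply: (@dterm_setof _ hZF
  (fun e x => (x ∈ t e /\ ~ x ∈ u e) \/ (x ∈ u e /\ ~ x ∈ t e))); last by definability.
by move=> e; exists (symdiff (t e) (u e)) => x; apply: in_symdiff.
Qed.

Lemma dterm_pow (t : (nat -> M) -> M) : dterm t -> dterm (fun e => pow (t e)).
Proof.
move=> dt; apply: (@dterm_setof _ hZF (fun e b => subset b (t e))).
  by move=> e; apply: ZF_powerset.
by definability.
Qed.

End SetOps.

Ltac dterm_set_ops :=
  lazymatch goal with
  | |- dterm (fun e => symdiff (@?a e) (@?b e)) => apply dterm_symdiff
  | |- dterm (fun e => pow (@?a e)) => apply dterm_pow
  end.
Ltac dterm_hook ::= first [ dterm_ops | dterm_set_ops ].

Section Coding.
Variable M : structure.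
Hypothesis hZF : ZF M.
Implicit Types (A B C D F X Y Z a b c d i j k m n s t u x y z : M) (P : M -> Prop).

(* Points of the Cantor space are handled as subsets of omega. *)
Definition chi s : M := lam omega (fun n => ite (n ∈ s) one zero).
Definition supp a : M := setof (fun n => n ∈ omega /\ opair n one ∈ a).
Definition flip n s : M := symdiff s (upair n n).
(* agreement on the integer interval [m, n) *)
Definition agree m n s t : Prop := ∀ i ∈ n, ~ i ∈ m -> (i ∈ s <-> i ∈ t).

Lemma dterm_chi (t : (nat -> M) -> M) : dterm t -> dterm (fun e => chi (t e)).
Proof.
move=> dt; rewrite /chi /lam.
apply: (@dterm_setof _ hZF (fun e p => ∃ x ∈ omega, p = opair x (ite (x ∈ t e) one zero)));
  last by definability.
by move=> e; apply: (image_ex hZF); definability.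
Qed.

Lemma in_supp a n : n ∈ supp a <-> n ∈ omega /\ opair n one ∈ a.
Proof.
apply: (@setofE M (fun n => n ∈ omega /\ opair n one ∈ a)).
by apply: (sub_set_ex hZF (A := omega)) => [x []|] //; definability.
Qed.

Lemma dterm_supp (t : (nat -> M) -> M) : dterm t -> dterm (fun e => supp (t e)).
Proof.
move=> dt.
apply: (@dterm_setof _ hZF (fun e n => n ∈ omega /\ opair n one ∈ t e)); last by definability.
by move=> e; exists (supp (t e)) => n; apply: in_supp.
Qed.

Lemma dterm_flip (t u : (nat -> M) -> M) :
  dterm t -> dterm u -> dterm (fun e => flip (t e) (u e)).
Proof. by move=> dt du; rewrite /flip; definability. Qed.

Lemma definable_agree (m n s t : (nat -> M) -> M) : dterm m -> dterm n -> dterm s ->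
  dterm t -> definable (fun e => agree (m e) (n e) (s e) (t e)).
Proof. by move=> *; rewrite /agree; definability. Qed.

End Coding.

Ltac dterm_codes :=
  lazymatch goal with
  | |- dterm (fun e => chi (@?a e)) => apply dterm_chi
  | |- dterm (fun e => supp (@?a e)) => apply dterm_supp
  | |- dterm (fun e => flip (@?a e) (@?b e)) => apply dterm_flip
  end.
Ltac dterm_hook ::= first [ dterm_ops | dterm_set_ops | dterm_codes ].
Ltac definable_hook ::= apply definable_agree.

Section Cantor.
Variable M : structure.
Hypothesis hZF : ZF M.
Implicit Types (A B C D F X Y Z a b c d i j k m n s t u x y z : M) (P : M -> Prop).

Lemma in_flip n s i : i ∈ flip n s <-> (i <> n /\ i ∈ s) \/ (i = n /\ ~ i ∈ s).
Proof. by rewrite in_symdiff // in_upair //; case: (EM (i = n)) => ?; tauto. Qed.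

Lemma flip_sub n s : n ∈ omega -> subset s omega -> subset (flip n s) omega.
Proof. by move=> no so i; rewrite in_flip => -[[_ /so]|[-> _]]. Qed.

Lemma in_cantor a : a ∈ cantor <-> is_fun a omega two.
Proof. exact: in_funs. Qed.

Lemma chi_term s : dterm (fun e => ite (e 0 ∈ s) one zero : M).
Proof. by definability. Qed.

Lemma chi_cantor s : chi s ∈ cantor.
Proof.
rewrite in_cantor; apply: (lam_fun hZF (chi_term s)) => n _; rewrite in_two //.
by case: (EM (n ∈ s)) => H; [right; rewrite ite_true|left; rewrite ite_false].
Qed.

Lemma ap_chi_in s n : n ∈ omega -> n ∈ s -> ap (chi s) n = one.
Proof. by move=> no ns; rewrite /chi (ap_lam hZF (chi_term s)) // ite_true. Qed.

Lemma ap_chi_notin s n : n ∈ omega -> ~ n ∈ s -> ap (chi s) n = zero.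
Proof. by move=> no ns; rewrite /chi (ap_lam hZF (chi_term s)) // ite_false. Qed.

Lemma supp_sub a : subset (supp a) omega.
Proof. by move=> n; rewrite (in_supp hZF) => -[]. Qed.

Lemma supp_chi s : subset s omega -> supp (chi s) = s.
Proof.
move=> so; apply: (set_ext hZF) => n.
rewrite (in_supp hZF) /chi (opair_in_lam hZF _ _ _ (chi_term s)).
split=> [[no [_]]|ns]; last by have no := so _ ns; rewrite ite_true.
case: (EM (n ∈ s)) => // ns; rewrite ite_false // => E.
by case: (one_neq_zero hZF E).
Qed.

Lemma in_suppE a n : a ∈ cantor -> n ∈ omega -> n ∈ supp a <-> ap a n = one.
Proof.
rewrite in_cantor => ha no; rewrite (in_supp hZF) (in_fun hZF _ _ ha).
by split=> [[_ []]|].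
Qed.

Lemma chi_supp a : a ∈ cantor -> chi (supp a) = a.
Proof.
move=> ac; have ha := ac; rewrite in_cantor in ha.
apply: (fun_ext hZF ((in_cantor _).1 (chi_cantor _)) ha).
move=> n no; case: (EM (n ∈ supp a)) => H.
  by rewrite ap_chi_in //; apply/esym/in_suppE.
rewrite ap_chi_notin //; have := ap_in hZF ha no; rewrite in_two // => -[] // E.
by case: H; apply/in_suppE.
Qed.

Lemma agree_ap a b n : a ∈ cantor -> b ∈ cantor -> n ∈ omega ->
  (∀ k ∈ n, ap b k = ap a k) <-> agree zero n (supp a) (supp b).
Proof.
move=> ac bc no; split=> [H i in_ _|H k kn].
  have io := omega_mem hZF no in_.
  by rewrite !in_suppE // H.
have ko := omega_mem hZF no kn.
have := H k kn (@in_empty _ hZF k); rewrite !in_suppE //.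
have := ap_in hZF ((in_cantor _).1 ac) ko; have := ap_in hZF ((in_cantor _).1 bc) ko.
rewrite !in_two // => -[] -> [] -> //; first by case=> /(_ erefl).
by case=> _ /(_ erefl).
Qed.

Lemma cantor_openE Y : cantor_open Y <-> subset Y cantor /\
  ∀ a ∈ Y, ∃ n ∈ omega, ∀ b ∈ cantor, agree zero n (supp a) (supp b) -> b ∈ Y.
Proof.
split=> -[Yc H]; split=> // a aY; have [n [no Hn]] := H a aY; exists n; split=> // b bc ab.
  by apply: Hn => //; apply/agree_ap => //; apply: Yc.
by apply: Hn => //; apply/agree_ap => //; apply: Yc.
Qed.

Lemma definable_cantor_open (t : (nat -> M) -> M) :
  dterm t -> definable (fun e => cantor_open (t e)).
Proof.
move=> dt; apply: (definable_iff (fun e => iff_sym (cantor_openE (t e)))).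
by definability.
Qed.

End Cantor.

Ltac definable_hook ::= first [ apply definable_agree | apply definable_cantor_open ].

(** * Nowhere dense subsets of the Cantor space *)

Section Rare.
Variable M : structure.
Hypothesis hZF : ZF M.
Implicit Types (A B C D F X Y Z a b c d i j k m n s t u x y z : M) (P : M -> Prop).

(* [F] is nowhere dense, the Cantor space being identified with the powerset of omega *)
Definition rare F : Prop := ∀ s ∈ pow omega, ∀ n ∈ omega,
  ∃ s' ∈ pow omega, ∃ m ∈ omega, nle n m /\ agree zero n s s' /\
    ∀ t ∈ pow omega, agree zero m s' t -> ~ chi t ∈ F.

Lemma agree_sub m n m' n' s t : n' ∈ omega -> nle m' m -> nle n n' -> m ∈ omega ->
  agree m' n' s t -> agree m n s t.
Proof.
move=> n'o mm nn mo H i in_ im; apply: H.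
  exact: (mem_nle_trans hZF n'o in_ nn).
by move=> im'; apply: im; apply: (mem_nle_trans hZF mo im' mm).
Qed.

Lemma agree_trans m n s t u : agree m n s t -> agree m n t u -> agree m n s u.
Proof. by move=> H K i in_ im; rewrite (H i in_ im); apply: K. Qed.

Lemma agree_sym m n s t : agree m n s t -> agree m n t s.
Proof. by move=> H i in_ im; rewrite (H i in_ im). Qed.

(** If no longer initial segment of any extension avoided [F], every open set meeting the basic open
    set of s below n would meet [F]; that basic set would lie in the closure of [F], against its
    empty interior. *)
Lemma nowhere_dense_rare F : nowhere_dense cantor cantor_open F -> rare F.
Proof.
move=> [Fc int0] s; rewrite in_pow // => so n no; apply: contrapT => H.
have cl b : b ∈ closure cantor cantor_open F <->
    b ∈ cantor /\ forall U, cantor_open U -> b ∈ U -> ∃ y ∈ U, y ∈ F.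
  apply: (@setofE M (fun b => b ∈ cantor /\ forall U, cantor_open U -> b ∈ U -> ∃ y ∈ U, y ∈ F)).
  by apply: (sub_set_ex hZF (A := cantor)) => [x []|] //; definability.
have int : exists v, forall b : M, b ∈ v <->
    exists U, cantor_open U /\ b ∈ U /\ subset U (closure cantor cantor_open F).
  apply: (sub_set_ex hZF (A := cantor)).
    by move=> b [U [_ [bU /(_ _ bU)]]]; rewrite cl => -[].
  by definability.
apply: (@in_empty _ hZF (chi s)); rewrite -int0; apply/(setofE int).
have [U hU] := @separation _ hZF (fun b => agree zero n s (supp b)) cantor 
  ltac:(by definability).
exists U; split.
  apply/(cantor_openE hZF); split=> [b|b]; first by rewrite hU => -[].
  rewrite hU => -[bc sb]; exists n; split=> // b' b'c bb'; rewrite hU; split=> //.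
  exact: agree_trans bb'.
split; first by rewrite hU supp_chi //; split=> //; apply: chi_cantor.
move=> b; rewrite hU => -[bc sb]; rewrite cl; split=> // V Vo bV.
have [Vc Vn] := (cantor_openE hZF V).1 Vo.
have [m [mo Vm]] := Vn _ bV; apply: contrapT => nV; apply: H.
exists (supp b); rewrite in_pow //; split; first exact: supp_sub.
have [k [ko [nk mk]]] : ∃ k ∈ omega, nle n k /\ nle m k.
  case: (omega_lt_or_le hZF no mo) => [nm|mn].
    by exists m; split=> //; split; [left|right].
  by exists n; split=> //; split=> //; right.
exists k; split=> //; split=> //; split=> // t; rewrite in_pow // => to_ bt tF.
apply: nV; exists (chi t); split=> //; apply: Vm; first exact: chi_cantor.
rewrite supp_chi //; apply: agree_sub bt => //; first by right.
exact: zero_omega.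
Qed.

End Rare.

(** * Doubling, and a sequence that takes every value infinitely often *)

Section Enumerations.
Variable M : structure.
Hypothesis hZF : ZF M.
Implicit Types (A B C D F X Y Z a b c d i j k m n s t u x y z : M) (P : M -> Prop).

(** [app D i] stands for 2i. Recording its order properties and the even-odd dichotomy replaces a
    development of addition on the omega of the model. *)
Definition is_doubling D : Prop :=
  [/\ is_fun D omega omega,
      ∀ i ∈ omega, ∀ k ∈ omega, i ∈ k -> succ (app D i) ∈ app D k,
      ∀ k ∈ omega, nle k (app D k)
    & ∀ n ∈ omega, ∃ i ∈ omega, n = app D i \/ n = succ (app D i)].

Lemma doubling_exists : exists D, is_doubling D.
Proof.
have dS : dterm (fun e : nat -> M => succ (succ (e 0))) by definability.
have hF : is_fun (lam omega (fun n => succ (succ n))) omega (omega : M).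
  by apply: (lam_fun hZF dS) => n no; do 2 apply: (succ_omega hZF).
have [D [hD [D0 DS]]] := recursion hZF (zero_omega hZF) hF.
have {}DS : ∀ n ∈ omega, app D (succ n) = succ (succ (app D n)).
  move=> n no; rewrite -!(ap_app hZF hD) //; last exact: succ_omega.
  by rewrite DS // (ap_lam hZF dS) //; apply: (ap_in hZF hD).
have {}D0 : app D zero = zero by rewrite -(ap_app hZF hD) //; apply: zero_omega.
have Do n : n ∈ omega -> app D n ∈ omega.
  by move=> no; rewrite -(ap_app hZF hD) //; apply: (ap_in hZF hD).
exists D; split=> //.
- move=> i io; apply: (omega_ind hZF); first by definability.
    by move/(in_empty hZF).
  move=> k ko ik; have kDo := Do k ko.
  rewrite in_succ // DS // => -[/ik H|->].
    by do 2 (rewrite in_succ //; left).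
  by apply: (succ_mem hZF); [exact: succ_omega|apply: mem_succ].
- apply: (omega_ind hZF); first by definability.
    by right; rewrite D0.
  move=> k ko kD; rewrite DS //; left; have kDo := Do k ko.
  by apply: (succ_mem hZF); [exact: succ_omega|rewrite in_succ].
- apply: (omega_ind hZF); first by definability.
    by exists zero; rewrite D0; split; [apply: zero_omega|left].
  move=> n no [i [io [->|->]]]; first by exists i; split=> //; right.
  by exists (succ i); split; [apply: succ_omega|left; rewrite DS].
Qed.

Lemma infinite_to_one_exists : exists J : M, is_fun J omega omega /\
  ∀ i ∈ omega, ∀ n ∈ omega, ∃ k ∈ omega, nle n k /\ app J k = i.
Proof.
(* run through the pairs (i, b) with i <= b, b being increasing *)
pose next p : M := ite (pfst p = psnd p) (opair zero (succ (psnd p)))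
                       (opair (succ (pfst p)) (psnd p)).
have dn : dterm (fun e => next (e 0)) by rewrite /next; definability.
have hF : is_fun (lam (prod omega omega) next) (prod omega omega) (prod omega omega).
  apply: (lam_fun hZF dn) => _ /(in_prod hZF) [a [ao [b [bo ->]]]].
  rewrite /next (pfstE hZF) (psndE hZF); case: (EM (a = b)) => ab.
    by rewrite ite_true // opair_in_prod //; split; [apply: zero_omega|apply: succ_omega].
  by rewrite ite_false // opair_in_prod //; split=> //; apply: succ_omega.
have z0 : opair zero zero ∈ prod omega (omega : M).
  by rewrite opair_in_prod //; split; apply: zero_omega.
have [z [hz [zz zS]]] := recursion hZF z0 hF.
have {}zS : ∀ n ∈ omega, app z (succ n) = next (app z n).
  move=> n no; rewrite -!(ap_app hZF hz) //; last exact: succ_omega.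
  by rewrite zS // (ap_lam hZF dn) //; apply: (ap_in hZF hz).
have {}zz : app z zero = opair zero zero by rewrite -(ap_app hZF hz) //; apply: zero_omega.
have zo : ∀ n ∈ omega, pfst (app z n) ∈ omega /\ psnd (app z n) ∈ omega.
  move=> n no; have := ap_in hZF hz no; rewrite (ap_app hZF hz) //.
  by move/(in_prod hZF) => [a [ao [b [bo ->]]]]; rewrite (pfstE hZF) (psndE hZF).
(* The second component grows by at most one per step, so a pair whose second component is at least
   n can only occur at an index k >= n. *)
have bk : ∀ k ∈ omega, nle (psnd (app z k)) k.
  apply: (omega_ind hZF); first by definability.
    by rewrite zz (psndE hZF); right.
  move=> k ko H; have [ao bo] := zo k ko; rewrite zS // /next.
  case: (EM (pfst (app z k) = psnd (app z k))) => E.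
    rewrite ite_true // psndE //; case: H => [H|->]; last by right.
    by left; apply: succ_mem.
  rewrite ite_false // psndE //; left; rewrite in_succ //.
(* Outer induction on b reaches (0, b) from (b - 1, b - 1); [inner] then climbs from (0, b) to (b,
   b). *)
have reach : ∀ b ∈ omega, ∀ a ∈ omega, nle a b -> ∃ k ∈ omega, app z k = opair a b.
  have inner b : b ∈ omega -> (∃ k ∈ omega, app z k = opair zero b) ->
      ∀ a ∈ omega, nle a b -> ∃ k ∈ omega, app z k = opair a b.
    move=> bo H; apply: (omega_ind hZF) => [|_ //|a ao IH ab]; first by definability.
    have {}ab : a ∈ b by apply: (mem_nle_trans hZF bo _ ab); apply: mem_succ.
    have [|k [ko E]] := IH; first by left.
    exists (succ k); split; first exact: succ_omega.
    rewrite zS // /next E (pfstE hZF) (psndE hZF) ite_false // => eab.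
    by subst b; case: (mem_irrefl hZF ab).
  apply: (omega_ind hZF); first by definability.
    by apply: inner; [exact: zero_omega|exists zero; split; [exact: zero_omega|]].
  move=> b bo IH; apply: inner; first exact: succ_omega.
  have [|k [ko E]] := IH b bo; first by right.
  exists (succ k); split; first exact: succ_omega.
  by rewrite zS // /next E (pfstE hZF) (psndE hZF) ite_true.
have dJ : dterm (fun e => pfst (app z (e 0))) by definability.
have hJ : is_fun (lam omega (fun k => pfst (app z k))) omega omega.
  by apply: (lam_fun hZF dJ) => k /zo [].
exists (lam omega (fun k => pfst (app z k))); split=> // i io n no.
have [b [bo [ib nb]]] : ∃ b ∈ omega, nle i b /\ nle n b.
  case: (omega_lt_or_le hZF io no) => [H|H].
    by exists n; split=> //; split; [left|right].
  by exists i; split=> //; split=> //; right.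
have [k [ko E]] := reach b bo i io ib; exists k; split=> //; split.
  by apply: (nle_trans hZF ko nb); move: (bk k ko); rewrite E (psndE hZF).
by rewrite -(ap_app hZF hJ) // (ap_lam hZF dJ) // E pfstE.
Qed.

End Enumerations.

(** * Blocks of coordinates that decide a sequence of nowhere dense sets *)

Section Category.
Variable M : structure.
Hypothesis hZF : ZF M.
Hypothesis hDC : DC M.
Implicit Types (A B C D F X Y Z a b c d i j k m n s t u x y z : M) (P : M -> Prop).

(* Induction on [n]: both values of a further free coordinate are handled one after
   the other, the second after flipping that coordinate. *)
Lemma rare_avoid_tail F : rare F -> ∀ n ∈ omega, ∀ s ∈ pow omega, ∀ m ∈ omega, nle n m ->
  ∃ s' ∈ pow omega, ∃ m' ∈ omega, nle m m' /\ agree zero m s s' /\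
    ∀ t ∈ pow omega, agree n m' s' t -> ~ chi t ∈ F.
Proof.
move=> rF; apply: (omega_ind hZF); first by definability.
  by move=> s so m mo _; apply: rF.
move=> n no IH s so m mo nm.
have {}nm : n ∈ m by apply: (mem_nle_trans hZF mo _ nm); apply: mem_succ.
have [s1 [s1o [m1 [m1o [mm1 [ss1 H1]]]]]] := IH s so m mo (or_introl nm).
have nm1 : n ∈ m1 by apply: (mem_nle_trans hZF m1o nm mm1).
have fs1 : flip n s1 ∈ pow omega.
  by move: s1o; rewrite !in_pow //; apply: flip_sub.
have [s2 [s2o [m2 [m2o [m12 [ss2 H2]]]]]] := IH _ fs1 m1 m1o (or_introl nm1).
(* [s2] continues [flip n s1], so flipping back yields a continuation of [s1]. A point t that agrees
   with it above n continues [s1] or [s2] from n on, according to its value at n. *)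
exists (flip n s2); split; first by move: s2o; rewrite !in_pow //; apply: flip_sub.
exists m2; split=> //; split; first exact: (nle_trans hZF m2o mm1).
have s2E i : i ∈ m1 -> (i ∈ s2 <-> i ∈ flip n s1).
  by move=> im; rewrite (ss2 i im) //; apply: in_empty.
have nm2 : n ∈ m2 by apply: (mem_nle_trans hZF m2o nm1 m12).
split=> [i im i0|t to_ st].
  have /s2E : i ∈ m1 by apply: (mem_nle_trans hZF m1o im mm1).
  rewrite (ss1 i im i0) !(in_flip hZF).
  by case: (EM (i = n)) (EM (i ∈ s1)) (EM (i ∈ s2)) => [->|?] [?|?] [?|?]; tauto.
case: (EM (n ∈ t <-> n ∈ s1)) => tn.
  apply: H1 => // i im ni; case: (EM (i = n)) => [->|in_]; first by tauto.
  have /st : i ∈ m2 by apply: (mem_nle_trans hZF m2o im m12).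
  have {}ni : ~ i ∈ succ n by rewrite in_succ // => -[].
  move/(_ ni); rewrite (in_flip hZF); have := s2E i im; rewrite in_flip //; tauto.
apply: H2 => // i im ni; case: (EM (i = n)) => [->|in_].
  by rewrite (s2E n nm1) (in_flip hZF); case: (EM (n ∈ t)) (EM (n ∈ s1)) => ? [] ?; tauto.
have {}ni : ~ i ∈ succ n by rewrite in_succ // => -[].
by have := st i im ni; rewrite (in_flip hZF); tauto.
Qed.

Section Blocks.
Variables D F : M.
Hypothesis hD : is_doubling D.
Hypothesis rF : ∀ i ∈ omega, rare (app F i).

Let Do n : n ∈ omega -> app D n ∈ omega.
Proof. by case: hD => fD _ _ _ no; rewrite -(ap_app hZF fD) //; apply: (ap_in hZF fD). Qed.

Let D_lt i k : k ∈ omega -> i ∈ k -> app D i ∈ app D k.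
Proof.
case: hD => _ H _ _ ko ik; have io := omega_mem hZF ko ik.
by apply: (mem_trans hZF (Do ko) _ (H _ io _ ko ik)); apply: mem_succ.
Qed.

Let D_le i k : k ∈ omega -> nle i k -> nle (app D i) (app D k).
Proof. by move=> ko [/(D_lt ko)|->]; [left|right]. Qed.

(** The sets of index below n are dealt with one after another by [rare_avoid_tail]. An extension
    made for one set preserves what was gained for the earlier ones, and t stays free below D n. *)
Lemma block_step s n : s ∈ pow omega -> n ∈ omega ->
  ∃ s' ∈ pow omega, ∃ n' ∈ omega, n ∈ n' /\ agree zero (app D n) s s' /\
    ∀ i ∈ n, ∀ t ∈ pow omega, agree (app D n) (app D n') s' t -> ~ chi t ∈ app F i.
Proof.
move=> so no.
suff : ∀ j ∈ omega, nle j n -> ∃ s' ∈ pow omega, ∃ m ∈ omega, nle (app D n) m /\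
    agree zero (app D n) s s' /\
    ∀ i ∈ j, ∀ t ∈ pow omega, agree (app D n) m s' t -> ~ chi t ∈ app F i.
  move=> /(_ n no (or_intror erefl)) [s' [s'o [m [mo [nm [ss' H]]]]]].
  (* The length m reached need not be even. With n' = m + 1 one has n <= D n <= m < n', and D n' >=
     m, so agreement up to D n' covers agreement up to m. *)
  exists s'; split=> //; exists (succ m); split; first exact: succ_omega.
  have nle_nm : nle n m.
    by case: hD => _ _ nD _; apply: (nle_trans hZF mo (nD n no)).
  split; first by rewrite in_succ.
  split=> // i in_ t to_ st; apply: H => //.
  apply: (agree_sub hZF (Do (succ_omega hZF mo)) _ _ (Do no) st); first by right.
  case: hD => _ _ nD _; apply: (nle_trans hZF (Do (succ_omega hZF mo)) (b := succ m)).
    by left; apply: mem_succ.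
  by apply: nD; apply: succ_omega.
apply: (omega_ind hZF); first by definability.
  move=> _; exists s; split=> //; exists (app D n); split; first exact: Do.
  by split; [right|split=> // i /(in_empty hZF)].
move=> j jo IH jn.
have {}jn : j ∈ n by apply: (mem_nle_trans hZF no _ jn); apply: mem_succ.
have [s1 [s1o [m1 [m1o [nm1 [ss1 H1]]]]]] := IH (or_introl jn).
have [s2 [s2o [m2 [m2o [m12 [ss2 H2]]]]]] :=
  rare_avoid_tail (rF jo) (Do no) s1o m1o nm1.
exists s2; split=> //; exists m2; split=> //.
split; first exact: (nle_trans hZF m2o nm1).
have zo := zero_omega hZF.
split.
  apply: agree_trans ss1 _; apply: (agree_sub hZF m1o _ nm1 zo ss2); by right.
move=> i; rewrite in_succ // => -[ij t to_ st|-> t to_]; last exact: H2.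
apply: (H1 i ij t to_); apply: agree_trans; last first.
  by apply: (agree_sub hZF m2o _ m12 (Do no) st); right.
by apply: (agree_sub hZF m1o _ _ (Do no) ss2); [apply: zero_nle (Do no)|right].
Qed.

(** This is one direction of the classical description of meager sets by a point and a partition
    into intervals. Dependent choice enters here: it iterates [block_step] on pairs of an
    approximation to x and a cut. The cuts are values of [D], so that in an interleaved sequence a
    block consists of whole pairs of coordinates. *)
Theorem rare_blocks : exists x c, x ∈ pow omega /\ is_fun c omega omega /\
  (∀ k ∈ omega, app c k ∈ app c (succ k)) /\
  ∀ k ∈ omega, ∀ i ∈ app c k, ∀ t ∈ pow omega,
    agree (app D (app c k)) (app D (app c (succ k))) x t -> ~ chi t ∈ app F i.
Proof.
pose X : M := prod (pow omega) omega.
pose step p q := psnd p ∈ psnd q /\ agree zero (app D (psnd p)) (pfst p) (pfst q) /\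
  ∀ i ∈ psnd p, ∀ t ∈ pow omega,
    agree (app D (psnd p)) (app D (psnd q)) (pfst q) t -> ~ chi t ∈ app F i.
have [R hR] := @separation _ hZF (fun r => step (pfst r) (psnd r)) (prod X X)
  ltac:(by rewrite /step; definability).
have [||p|z [hz zR]] := hDC (X := X) (R := R).
- exists (opair empty zero); rewrite /X opair_in_prod // in_pow //.
  by split=> [x /(in_empty hZF)|]; last exact: zero_omega.
- by move=> r; rewrite hR => -[].
- move=> pX; have /(in_prod hZF) [s [so [n [no E]]]] := pX.
  have [s' [s'o [n' [n'o H]]]] := block_step so no.
  have qX : opair s' n' ∈ X by rewrite /X opair_in_prod.
  exists (opair s' n'); split=> //; rewrite hR opair_in_prod //; split=> //.
  by rewrite /step E !(pfstE hZF, psndE hZF).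
have zX : ∀ k ∈ omega, pfst (app z k) ∈ pow omega /\ psnd (app z k) ∈ omega.
  move=> k ko; have := ap_in hZF hz ko; rewrite (ap_app hZF hz) //.
  by move/(in_prod hZF) => [a [ao [b [bo ->]]]]; rewrite (pfstE hZF) (psndE hZF).
have {}zR : ∀ k ∈ omega, step (app z k) (app z (succ k)).
  move=> k ko; have := zR k ko; rewrite hR !(ap_app hZF hz) //; last exact: succ_omega.
  by rewrite pfstE // psndE // => -[].
pose x_of p := app D (psnd p).
have le_of : ∀ k ∈ omega, ∀ j ∈ omega, nle j k ->
    nle (psnd (app z j)) (psnd (app z k)) /\
    agree zero (x_of (app z j)) (pfst (app z j)) (pfst (app z k)).
  apply: (omega_ind hZF); first by rewrite /x_of; definability.
    by move=> j jo [/(in_empty hZF)|->] //; split=> //; right.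
  move=> k ko IH j jo [|->]; last by split=> //; right.
  move/(in_succ hZF) => jk; have [le ag] := IH j jo jk.
  have [lt [ag' _]] := zR k ko.
  have [_ nko] := zX k ko; have [_ nko'] := zX _ (succ_omega hZF ko).
  split; first by left; apply: (nle_mem_trans hZF nko' le).
  apply: agree_trans ag _; apply: (agree_sub hZF (Do nko) _ _ (zero_omega hZF) ag').
    by right.
  exact: D_le.
(* The limit of the approximations: the pair [app z k] settles all coordinates below [D] of its
   second component. *)
have [x hx] := @separation _ hZF
  (fun i => ∃ k ∈ omega, i ∈ app D (psnd (app z k)) /\ i ∈ pfst (app z k)) omega
  ltac:(by definability).
have xz k : k ∈ omega -> agree zero (x_of (app z k)) x (pfst (app z k)).
  move=> ko i ik _; have [_ nko] := zX k ko; rewrite hx.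
  have io : i ∈ omega by apply: (omega_mem hZF (Do nko)).
  split=> [[_ [j [jo [ij ijs]]]]|is_]; last by split=> //; exists k.
  have [_ njo] := zX j jo.
  have nz : ~ i ∈ zero := in_empty hZF (x:=i).
  case: (omega_lt_or_le hZF jo ko) => [jk|kj].
    by have [_ /(_ i ij nz) <-] := le_of k ko j jo (or_introl jk).
  by have [_ /(_ i ik nz) ->] := le_of j jo k ko kj.
have dc : dterm (fun e => psnd (app z (e 0))) by definability.
have hc : is_fun (lam omega (fun k => psnd (app z k))) omega omega.
  by apply: (lam_fun hZF dc) => k /zX [].
have cE k : k ∈ omega -> app (lam omega (fun k => psnd (app z k))) k = psnd (app z k).
  by move=> ko; rewrite -(ap_app hZF hc) // (ap_lam hZF dc).
exists x, (lam omega (fun k => psnd (app z k))).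
split; first by rewrite in_pow // => i; rewrite hx => -[].
split=> //; split=> [k ko|k ko i].
  by rewrite !cE //; [have [] := zR k ko|apply: succ_omega].
rewrite !cE //; last exact: succ_omega.
move=> ik t to_ xt; have [_ [_ H]] := zR k ko.
apply: (H i ik t to_); apply: agree_trans xt; apply: agree_sym.
have ko' := succ_omega hZF ko; have [_ no'] := zX _ ko'; have [_ no] := zX _ ko.
apply: (agree_sub hZF (Do no') _ _ (Do no) (xz _ ko')); last by right.
exact: zero_nle (Do no).
Qed.

End Blocks.
End Category.

(** * The two halves of an interleaved sequence *)

Section EvenOdd.
Variable M : structure.
Hypothesis hZF : ZF M.
Implicit Types (A B C D F H h X Y Z a b c d i j k m n s t u x y z : M) (P : M -> Prop).

Definition evens D s : M := setof (fun i => i ∈ omega /\ app D i ∈ s).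
Definition odds D s : M := setof (fun i => i ∈ omega /\ succ (app D i) ∈ s).

Lemma in_evens D s i : i ∈ evens D s <-> i ∈ omega /\ app D i ∈ s.
Proof.
apply: (@setofE M (fun i => i ∈ omega /\ app D i ∈ s)).
by apply: (sub_set_ex hZF (A := omega)) => [x []|] //; definability.
Qed.

Lemma in_odds D s i : i ∈ odds D s <-> i ∈ omega /\ succ (app D i) ∈ s.
Proof.
apply: (@setofE M (fun i => i ∈ omega /\ succ (app D i) ∈ s)).
by apply: (sub_set_ex hZF (A := omega)) => [x []|] //; definability.
Qed.

Lemma dterm_evens D (t : (nat -> M) -> M) : dterm t -> dterm (fun e => evens D (t e)).
Proof.
move=> dt; apply: (@dterm_setof _ hZF (fun e i => i ∈ omega /\ app D i ∈ t e)).
  by move=> e; exists (evens D (t e)) => i; apply: in_evens.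
by definability.
Qed.

Lemma dterm_odds D (t : (nat -> M) -> M) : dterm t -> dterm (fun e => odds D (t e)).
Proof.
move=> dt; apply: (@dterm_setof _ hZF (fun e i => i ∈ omega /\ succ (app D i) ∈ t e)).
  by move=> e; exists (odds D (t e)) => i; apply: in_odds.
by definability.
Qed.

End EvenOdd.

Ltac dterm_halves :=
  lazymatch goal with
  | |- dterm (fun e => evens _ (@?a e)) => apply dterm_evens
  | |- dterm (fun e => odds _ (@?a e)) => apply dterm_odds
  end.
Ltac dterm_hook ::= first [ dterm_ops | dterm_set_ops | dterm_codes | dterm_halves ].

(** * From a map sensitive to single coordinates to an injection of the Cantor space *)

Section Inequivalent.
Variable M : structure.
Hypothesis hZF : ZF M.
Hypothesis hDC : DC M.
Hypothesis hBP : all_cantor_subsets_baire M.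
Implicit Types (A B C D F H h X Y Z a b c d i j k m n s t u x y z : M) (P : M -> Prop).

Lemma odds_sub D s : subset (odds D s) omega.
Proof. by move=> i; rewrite (in_odds hZF) => -[]. Qed.

Section Values.
Variables (D H h : M).
Hypothesis hD : is_doubling D.
Hypothesis hh : is_fun h cantor H.
Hypothesis h_flip : ∀ m ∈ omega, ∃ n ∈ omega, nle m n /\
  ∀ s ∈ pow omega, ~ n ∈ s -> ap h (chi s) <> ap h (chi (cup s (upair n n))).

Let Do n : n ∈ omega -> app D n ∈ omega.
Proof. by case: hD => fD _ _ _ no; rewrite -(ap_app hZF fD) //; apply: (ap_in hZF fD). Qed.

Let D_lt i k : k ∈ omega -> i ∈ k -> succ (app D i) ∈ app D k.
Proof. by case: hD => _ lt _ _ ko ik; apply: lt => //; apply: (omega_mem hZF ko ik). Qed.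

Let D_inj i k : i ∈ omega -> k ∈ omega -> app D i = app D k -> i = k.
Proof.
move=> io ko E; case: (omega_lt_or_le hZF io ko) => [ik|[ki|//]].
  have := D_lt ko ik; rewrite E => /(mem_asym hZF (Do ko)); case; exact: mem_succ.
have := D_lt io ki; rewrite E => /(mem_asym hZF (Do ko)); case; exact: mem_succ.
Qed.

Let D_odd i k : i ∈ omega -> k ∈ omega -> app D i <> succ (app D k).
Proof.
move=> io ko E; case: (omega_lt_or_le hZF io ko) => [ik|[ki|ki]].
- have := D_lt ko ik; rewrite E => lt; apply: (mem_irrefl hZF (a := app D k)).
  apply: (mem_trans hZF (Do ko) _ (mem_trans hZF (Do ko) _ lt)); exact: mem_succ.
- by have := D_lt io ki; rewrite E; apply: mem_irrefl.
- by subst k; have := mem_succ hZF (app D i); rewrite -E; apply: mem_irrefl.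
Qed.

(** One of s and [flip n s] arises from the other by adding n, so [h_flip] holds without regard to
    whether n lies in s. *)
Let h_flip' m : m ∈ omega -> ∃ n ∈ omega, nle m n /\
  ∀ s ∈ pow omega, ap h (chi s) <> ap h (chi (flip n s)).
Proof.
move=> mo; have [n [no [mn hn]]] := h_flip mo; exists n; split=> //; split=> // s so.
case: (EM (n ∈ s)) => ns.
  have fo : flip n s ∈ pow omega by move: so; rewrite !in_pow //; apply: flip_sub.
  have := hn _ fo; suff -> : cup (flip n s) (upair n n) = s.
    by move=> H1 H2; apply: H1 => //; rewrite in_flip //; tauto.
  apply: (set_ext hZF) => i; rewrite in_cup // in_upair // in_flip //.
  by case: (EM (i = n)) => [->|?]; tauto.
suff -> : flip n s = cup s (upair n n) by apply: hn.
apply: (set_ext hZF) => i; rewrite in_cup // in_upair // in_flip //.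
by case: (EM (i = n)) => [->|?]; tauto.
Qed.

Let E := setof (fun a : M => a ∈ cantor /\
  ap h (chi (evens D (supp a))) = ap h (chi (odds D (supp a)))).

Let inE a : a ∈ E <-> a ∈ cantor /\
  ap h (chi (evens D (supp a))) = ap h (chi (odds D (supp a))).
Proof.
apply: (@setofE M (fun a : M => a ∈ cantor /\
  ap h (chi (evens D (supp a))) = ap h (chi (odds D (supp a))))).
apply: (sub_set_ex hZF (A := cantor)) => [x []|] //.
apply: (@definable_iff _ (fun e => e 0 ∈ cantor /\
  app h (chi (evens D (supp (e 0)))) = app h (chi (odds D (supp (e 0)))))) => [e|].
  by rewrite !(ap_app hZF hh) //; apply: chi_cantor.
by definability.
Qed.

Let c_ge c : is_fun c omega omega -> (∀ k ∈ omega, app c k ∈ app c (succ k)) ->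
  ∀ k ∈ omega, nle k (app c k).
Proof.
move=> hc cS; have co k : k ∈ omega -> app c k ∈ omega.
  by move=> ko; rewrite -(ap_app hZF hc) //; apply: (ap_in hZF hc).
apply: (omega_ind hZF); first by definability.
  by apply: (zero_nle hZF); apply/co/zero_omega.
move=> k ko kc; apply: (succ_nle hZF); first exact/co/succ_omega.
by apply: (nle_mem_trans hZF (co _ (succ_omega hZF ko)) kc (cS k ko)).
Qed.

(** Here x is taken for the meager difference of E and U. A point of U that agrees with x from some
    coordinate on agrees with it on all late blocks, hence misses every piece of that difference and
    lies in E. This leaves finitely many coordinates free: enough to start inside U and to flip one
    of them. *)
Lemma kernel_meager : exists F, (∀ n ∈ omega, rare (app F n)) /\
  ∀ a ∈ E, ∃ n ∈ omega, a ∈ app F n.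
Proof.
have [U [Uo [F [Z [hF [nF EU]]]]]] : baire_property cantor cantor_open E.
  by apply: hBP => a; rewrite inE => -[].
have rF : ∀ n ∈ omega, rare (app F n).
  by move=> n no; rewrite -(ap_app hZF hF) //; apply: (nowhere_dense_rare hZF (nF n no)).
exists F; split=> // a aE.
suff U0 : forall b : M, ~ b ∈ U.
  have /EU [n [no an]] : a ∈ symdiff E U by rewrite in_symdiff //; left; split; last exact: U0.
  by exists n; split=> //; rewrite -(ap_app hZF hF).
move=> {a aE} a aU.
have [Uc Un] := (cantor_openE hZF U).1 Uo; have [n0 [n0o Hn0]] := Un a aU.
have [x [c [xo [hc [cS Hx]]]]] := rare_blocks hZF hDC hD rF.
have co k : k ∈ omega -> app c k ∈ omega.
  by move=> ko; rewrite -(ap_app hZF hc) //; apply: (ap_in hZF hc).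
have [n [no [nn0 hn]]] := h_flip' n0o.
(* The place of the n-th coordinate of the second half. Since p >= n0, flipping there stays in the
   basic open set around [a] given by n0. *)
pose p := succ (app D n).
have po : p ∈ omega by apply: succ_omega => //; apply: Do.
have n0p : nle n0 p.
  left; rewrite in_succ //; case: hD => _ _ nD _.
  by apply: (nle_trans hZF (Do no) nn0); apply: nD.
(* [y] starts like a point of U and follows the generic [x] afterwards *)
have [y hy] := @separation _ hZF (fun i => (i ∈ n0 /\ i ∈ supp a) \/ (~ i ∈ n0 /\ i ∈ x))
  omega ltac:(by definability).
have yo : y ∈ pow omega by rewrite in_pow // => i; rewrite hy => -[].
have y'o : flip p y ∈ pow omega by move: yo; rewrite !in_pow //; apply: flip_sub.
have good t : t ∈ pow omega -> agree zero n0 (supp a) t ->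
    (∀ i ∈ omega, ~ i ∈ succ p -> (i ∈ t <-> i ∈ x)) -> chi t ∈ E.
  move=> to_ at_ tx; have tU : chi t ∈ U.
    apply: Hn0; first exact: chi_cantor.
    by rewrite supp_chi // -in_pow.
  apply: contrapT => tE.
  have /EU [m [mo tm]] : chi t ∈ symdiff E U by rewrite in_symdiff //; right.
  (* Block k begins beyond p, where t agrees with x, and m < k <= c k, so this block excludes t from
     the m-th nowhere dense set. *)
  have [k [ko [pk mk]]] : ∃ k ∈ omega, nle (succ p) k /\ m ∈ k.
    have spo := succ_omega hZF po; have smo := succ_omega hZF mo.
    case: (omega_lt_or_le hZF spo smo) => [lt|le].
      by exists (succ m); split=> //; split; [left|apply: mem_succ].
    exists (succ p); split=> //; split; first by right.
    by apply: (mem_nle_trans hZF spo _ le); apply: mem_succ.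
  have ck := c_ge hc cS ko.
  apply: (Hx k ko m _ _ to_); first exact: (mem_nle_trans hZF (co k ko) mk ck).
    move=> i ik' ik; apply: iff_sym; apply: tx.
      by apply: (omega_mem hZF _ ik'); apply/Do/co/succ_omega.
    move=> ip; apply: ik; case: hD => _ _ nD _.
    apply: (mem_nle_trans hZF _ ip); first exact/Do/co.
    apply: (nle_trans hZF _ pk); first exact/Do/co.
    apply: (nle_trans hZF _ ck); first exact/Do/co.
    exact/nD/co.
  by rewrite -(ap_app hZF hF).
have n0n i : i ∈ n0 -> i <> p.
  move=> i0 ip; subst i; apply: (mem_irrefl hZF (a := p)).
  exact: (mem_nle_trans hZF po i0 n0p).
have big i : ~ i ∈ succ p -> ~ i ∈ n0 /\ i <> p.
  rewrite in_succ // => ip; split=> [i0|]; last by tauto.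
  by apply: ip; left; apply: (mem_nle_trans hZF po i0 n0p).
have i_om i : i ∈ n0 -> i ∈ omega by apply: omega_mem.
have yE : chi y ∈ E.
  apply: good => //.
    by move=> i i0 _; rewrite hy; split; [move=> ?; split; [exact: i_om|left]|tauto].
  by move=> i io /big [ni _]; rewrite hy; tauto.
have y'E : chi (flip p y) ∈ E.
  apply: good => //.
    move=> i i0 _; rewrite in_flip // hy; have := n0n i i0; have := i_om i i0; tauto.
  by move=> i io /big [ni ip]; rewrite in_flip // hy; tauto.
move: yE y'E; rewrite !inE !supp_chi //; try by rewrite -in_pow.
have -> : evens D (flip p y) = evens D y.
  apply: (set_ext hZF) => i; rewrite !(in_evens hZF) in_flip //.
  by case: (EM (i ∈ omega)) => io; [have := D_odd io no; tauto | tauto].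
have -> : odds D (flip p y) = flip n (odds D y).
  apply: (set_ext hZF) => i; rewrite in_flip // !(in_odds hZF) in_flip //.
  case: (EM (i = n)) => [->|ni]; first by tauto.
  have : i ∈ omega -> succ (app D i) <> p.
    by move=> io /(succ_inj hZF (Do no)) /(D_inj io no).
  by tauto.
by move=> [_ ->] [_]; apply: hn; rewrite in_pow //; apply: odds_sub.
Qed.

(** The common core of both statements: of the group or the loops, only [h] and the effect of adding
    single coordinates are retained. *)
Theorem card_le_of_flips : card_le cantor H.
Proof.
have [F [rF EF]] := kernel_meager.
have [x [c [xo [hc [cS Hx]]]]] := rare_blocks hZF hDC hD rF.
have co k : k ∈ omega -> app c k ∈ omega.
  by move=> ko; rewrite -(ap_app hZF hc) //; apply: (ap_in hZF hc).
have [J [hJ inf_J]] := infinite_to_one_exists hZF.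
(* A block of indices of the halves; interleaving turns it into the interval from D (c k) to D (c (k
   + 1)) on which x is generic. *)
pose block k i := i ∈ app c (succ k) /\ ~ i ∈ app c k.
have c_le k k' : k' ∈ omega -> k ∈ k' -> nle (app c (succ k)) (app c k').
  move=> k'o; move: k' k'o k; apply: (omega_ind hZF); first by definability.
    by move=> k /(in_empty hZF).
  move=> k' k'o IH k; rewrite in_succ // => -[/IH le|->]; last by right.
  by left; apply: (nle_mem_trans hZF (co _ (succ_omega hZF k'o)) le); apply: cS.
have block_inj k k' i : k ∈ omega -> k' ∈ omega -> block k i -> block k' i -> k = k'.
  move=> ko k'o [ik nik] [ik' nik'].
  case: (omega_lt_or_le hZF ko k'o) => [lt|[lt|//]].
    by case: nik'; apply: (mem_nle_trans hZF (co _ k'o) ik); apply: c_le.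
  by case: nik; apply: (mem_nle_trans hZF (co _ ko) ik'); apply: c_le.
(* on its k-th block, [y r] copies the even or the odd part of [x] according to r(J k) *)
pose yP r i := i ∈ omega /\ ∃ k ∈ omega, block k i /\
  ((app J k ∈ r /\ succ (app D i) ∈ x) \/ (~ app J k ∈ r /\ app D i ∈ x)).
pose y r := setof (yP r).
have y_ex r : exists v, forall i, i ∈ v <-> yP r i.
  by apply: (sub_set_ex hZF (A := omega)) => [i []|] //; rewrite /yP /block; definability.
have dy (t : (nat -> M) -> M) : dterm t -> dterm (fun e => y (t e)).
  move=> dt; apply: (@dterm_setof _ hZF (fun e => yP (t e))); first by move=> e; apply: y_ex.
  by rewrite /yP /block; definability.
have yo r : subset (y r) omega by move=> i /(setofE (y_ex r)) [].
have y_block r k i : k ∈ omega -> block k i -> i ∈ omega -> i ∈ y r <->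
    (app J k ∈ r /\ succ (app D i) ∈ x) \/ (~ app J k ∈ r /\ app D i ∈ x).
  move=> ko ki io; rewrite (setofE (y_ex r)); split; last by move=> ?; split=> //; exists k.
  by move=> [_ [k' [k'o [k'i]]]]; rewrite (block_inj _ _ _ k'o ko k'i ki).
have dist r r' i : i ∈ omega -> ~ i ∈ r -> i ∈ r' -> ap h (chi (y r)) <> ap h (chi (y r')).
  move=> io ir ir' eq_h.
  have [w hw] := @separation _ hZF (fun n => ∃ i ∈ omega,
    (n = app D i /\ i ∈ y r) \/ (n = succ (app D i) /\ i ∈ y r')) omega
    ltac:(by definability; apply: dy; definability).
  have wo : w ∈ pow omega by rewrite in_pow // => n; rewrite hw => -[].
  have w_ev i' : i' ∈ omega -> app D i' ∈ w <-> i' ∈ y r.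
    move=> i'o; rewrite hw; split=> [[_ [j [jo [[/(D_inj i'o jo) -> //]|[E']]]]]|iy].
      by case: (D_odd i'o jo E').
    by split; [exact: Do|exists i'; split=> //; left].
  have w_od i' : i' ∈ omega -> succ (app D i') ∈ w <-> i' ∈ y r'.
    move=> i'o; rewrite hw; split=> [[_ [j [jo [[E']|[E']]]]]|iy].
    - by case: (D_odd jo i'o (esym E')).
    - by have := succ_inj hZF (Do jo) E' => /(D_inj i'o jo) ->.
    - by split; [exact/succ_omega/Do|exists i'; split=> //; right].
  have : chi w ∈ E.
    rewrite inE; split; first exact: chi_cantor.
    rewrite supp_chi //; last by rewrite -in_pow.
    suff -> : evens D w = y r.
      suff -> : odds D w = y r' by [].
      apply: (set_ext hZF) => j; rewrite (in_odds hZF); split=> [[jo /w_od]|jy]; first exact.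
      by have jo := yo _ _ jy; rewrite w_od.
    apply: (set_ext hZF) => j; rewrite (in_evens hZF); split=> [[jo /w_ev]|jy]; first exact.
    by have jo := yo _ _ jy; rewrite w_ev.
  move/EF => [m [mo wm]].
  (* A block owned by the coordinate i and late enough to exclude the m-th nowhere dense set, which
     is why [J] takes each value infinitely often. *)
  have [k [ko [mk Jk]]] := inf_J i io (succ m) (succ_omega hZF mo).
  have ko' := succ_omega hZF ko.
  have mc : m ∈ app c k.
    apply: (mem_nle_trans hZF (co k ko) (mem_succ hZF m)).
    by apply: (nle_trans hZF (co k ko) mk); apply: c_ge.
  apply: (Hx k ko m mc w wo _ wm) => n nk' nk.
  have Dlt j k' : j ∈ omega -> k' ∈ omega -> app D j ∈ app D k' -> j ∈ k'.
    move=> jo k'o lt; case: (omega_lt_or_le hZF jo k'o) => // -[k'j|E'].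
      have lt' := D_lt jo k'j; case: (mem_asym hZF (Do k'o) lt).
      by apply: (mem_trans hZF (Do jo) _ lt'); apply: mem_succ.
    by rewrite E' in lt; case: (mem_irrefl hZF lt).
  have no : n ∈ omega by apply: (omega_mem hZF _ nk'); apply/Do/co.
  (* As J k = i lies in r' but not in r, on this block [y r] is the even half of x and [y r'] the
     odd half, so that their interleaving [w] coincides with x. *)
  case: hD => _ _ _ /(_ n no) [j [jo [E'|E']]]; subst n.
    have bj : block k j.
      split; first by apply: Dlt => //; apply: co.
      move=> jk; apply: nk; apply: (mem_trans hZF (Do (co k ko)) _ (D_lt (co k ko) jk)).
      exact: mem_succ.
    by rewrite w_ev // (y_block r k) // Jk; tauto.
  have bj : block k j.
    split.
      apply: Dlt => //; first exact: co.
      by apply: (mem_trans hZF (Do (co _ ko')) _ nk'); apply: mem_succ.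
    by move=> jk; apply: nk; apply: D_lt => //; apply: co.
  by rewrite w_od // (y_block r' k) // Jk; tauto.
have df : dterm (fun e => app h (chi (y (supp (e 0))))).
  by definability; apply: dy; definability.
have hy a : ap h (chi (y (supp a))) = app h (chi (y (supp a))).
  by apply: (ap_app hZF hh); apply: chi_cantor.
exists (lam cantor (fun a => app h (chi (y (supp a))))); split.
  apply: (lam_fun hZF df) => a ac; rewrite -hy.
  by apply: (ap_in hZF hh); apply: chi_cantor.
move=> a ac b bc; rewrite !(ap_lam hZF df) // -!hy => eq_ab.
rewrite -(chi_supp hZF ac) -(chi_supp hZF bc); congr chi.
apply: (set_ext hZF) => i; apply: contrapT => ni.
have [io|nio] := EM (i ∈ omega); last first.
  by apply: ni; split=> /(in_supp hZF) [].
case: (EM (i ∈ supp a)) (EM (i ∈ supp b)) => ia [] ib; [tauto| | |tauto].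
  by apply: (dist (supp b) (supp a) i) => //; rewrite eq_ab.
by apply: (dist (supp a) (supp b) i).
Qed.

End Values.
End Inequivalent.

(** * Groups and topological groups *)

Section Groups.
Variable M : structure.
Hypothesis hZF : ZF M.
Implicit Types (A B C D F G H K T U V W X Y Z : M).
Implicit Types (a b c d g i j k m n p s t u v x y z phi : M).

(** Uniqueness of the value takes the place of choice. The relation has to be first order, which is
    the reason for the twins [product_limit'] and [relD] below. *)
Lemma fun_of_relation A B (P : M -> M -> Prop) :
  definable (fun e => P (e 0) (e 1)) -> (∀ a ∈ A, exists! b, b ∈ B /\ P a b) ->
  exists h, is_fun h A B /\ ∀ a ∈ A, P a (ap h a).
Proof.
move=> dP exP.
have dP' : definable (fun e => P (pfst (e 0)) (psnd (e 0))).
  apply: (definable_iff (P := fun e => exists a b,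
    a = pfst (e 0) /\ b = psnd (e 0) /\ P a b)) => [e|].
    by split=> [[_ [_ [-> [-> ]]]] //|Pab]; exists (pfst (e 0)), (psnd (e 0)).
  definability.
  exact: (definable_rename (fun q => match q with 0 => 1 | _ => 0 end) dP).
have [h hh] := separation hZF (P := fun p => P (pfst p) (psnd p)) (prod A B) dP'.
have inh a b : opair a b ∈ h <-> a ∈ A /\ b ∈ B /\ P a b.
  by rewrite hh opair_in_prod // pfstE // psndE //; tauto.
have hf : is_fun h A B.
  split=> [p|a aA]; first by rewrite hh => -[].
  have [b [[bB Pab] ub]] := exP a aA; exists b; split=> [|b']; first exact/inh.
  by rewrite inh => -[_ ?]; apply: ub.
exists h; split=> // a aA; have [ab _ _] := is_fun_ap hZF hf aA.
by have [_ []] := (inh _ _).1 ab.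
Qed.

Section GroupLaws.
Variables (C : M) (m : M -> M -> M).
Hypothesis gl : group_laws C m.
Let e : M := unit_of C m.

Lemma unit_ofP : e ∈ C /\ ∀ x ∈ C, m e x = x /\ m x e = x.
Proof.
case: gl => [_ [_ [u [uC [u1 _]]]]].
by apply: (@the_spec M (fun e => e ∈ C /\ ∀ x ∈ C, m e x = x /\ m x e = x)); exists u.
Qed.

Lemma group_inv x : x ∈ C -> ∃ y ∈ C, m x y = e /\ m y x = e.
Proof.
case: gl => [_ [_ [u [uC [u1 ui]]]]] xC; have [eC e1] := unit_ofP.
have -> : e = u by rewrite -(u1 e eC).1 (e1 u uC).2.
exact: ui.
Qed.

Lemma group_cancel_l x y z : x ∈ C -> y ∈ C -> z ∈ C -> m x y = m x z -> y = z.
Proof.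
move=> xC yC zC E; have [x' [x'C [_ xx]]] := group_inv xC; have [eC e1] := unit_ofP.
by case: gl => _ [mA _]; rewrite -(e1 y yC).1 -(e1 z zC).1 -xx -!mA // E.
Qed.

Lemma group_cancel_r x y z : x ∈ C -> y ∈ C -> z ∈ C -> m y x = m z x -> y = z.
Proof.
move=> xC yC zC E; have [x' [x'C [xx _]]] := group_inv xC; have [eC e1] := unit_ofP.
by case: gl => _ [mA _]; rewrite -(e1 y yC).2 -(e1 z zC).2 -xx !mA // E.
Qed.

End GroupLaws.

Lemma zero_neq_one : zero <> one :> M.
Proof. by move/esym; apply: one_neq_zero. Qed.

Lemma pow01_zero (e : M) g : pow01 e g zero = e.
Proof. by apply: theE => [|z [[] //|[/zero_neq_one]]]; auto. Qed.

Lemma pow01_one (e : M) g : pow01 e g one = g.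
Proof. by apply: theE => [|z [[/esym/zero_neq_one]|[]]]; auto. Qed.

Lemma eventually_and (P Q : M -> Prop) :
  eventually P -> eventually Q -> eventually (fun n => P n /\ Q n).
Proof.
move=> [N [No HP]] [N' [N'o HQ]].
case: (omega_lt_or_le hZF No N'o) => [lt|le].
  exists N'; split=> // n no le; split; last exact: HQ.
  by apply: HP => //; apply: (nle_trans hZF no _ le); left.
exists N; split=> // n no le'; split; first exact: HP.
by apply: HQ => //; apply: (nle_trans hZF no le le').
Qed.

Lemma eventually_ex (P : M -> Prop) : eventually P -> ∃ n ∈ omega, P n.
Proof. by move=> [N [No HP]]; exists N; split=> //; apply: HP => //; right. Qed.

Lemma not_eventually (P : M -> Prop) m : ~ eventually (fun n => P n) -> m ∈ omega ->
  ∃ n ∈ omega, nle m n /\ ~ P n.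
Proof.
move=> nE mo; apply: contrapT => H; apply: nE; exists m; split=> // n no mn.
by apply: contrapT => nP; apply: H; exists n.
Qed.

Lemma preimage_ex f X Y V : is_fun f X Y ->
  exists s, forall x, x ∈ s <-> x ∈ X /\ ap f x ∈ V.
Proof.
move=> hf; have [s hs] := @separation _ hZF (fun x => app f x ∈ V) X ltac:(by definability).
exists s => x; rewrite hs; split=> -[xX]; rewrite (ap_app hZF hf) //.
Qed.

Lemma cantor_cases a n : a ∈ cantor -> n ∈ omega -> ap a n = zero \/ ap a n = one.
Proof.
by rewrite in_cantor // => ha no; have := ap_in hZF ha no; rewrite in_two.
Qed.

Lemma chi_cup_neq s n k : k ∈ omega -> k <> n ->
  ap (chi (cup s (upair n n))) k = ap (chi s) k.
Proof.
move=> ko kn; have E : k ∈ cup s (upair n n) <-> k ∈ s.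
  by rewrite in_cup // in_upair //; tauto.
case: (EM (k ∈ s)) => ks; first by rewrite !ap_chi_in //; tauto.
by rewrite !ap_chi_notin //; tauto.
Qed.

(** * Infinite products in a Hausdorff topological group *)

Section TopologicalGroup.
Variables G mG T g : M.
Hypothesis hG : hausdorff_topological_group G mG T.
Hypothesis hg : is_fun g omega G.
Hypothesis gd : descends_to_unit G mG T g.
Let m := ap2 mG.
Let e := unit_of G m.

Let gl : group_laws G m. Proof. exact: (htg_group hG).2. Qed.
Let mf : is_fun mG (prod G G) G. Proof. exact: (htg_group hG).1. Qed.
Let mC x y : x ∈ G -> y ∈ G -> m x y ∈ G. Proof. by move=> xG yG; case: gl => H _; apply: H. Qed.
Let mA x y z : x ∈ G -> y ∈ G -> z ∈ G -> m x (m y z) = m (m x y) z.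
Proof. by move=> xG yG zG; case: gl => _ [H _]; apply: H. Qed.
Let eG : e ∈ G. Proof. exact: (unit_ofP gl).1. Qed.
Let me x : x ∈ G -> m x e = x. Proof. by move=> xG; have [] := (unit_ofP gl).2 x xG. Qed.

Definition product_limit a y : Prop :=
  exists s, partial_products G mG g a s /\ y ∈ G /\ converges (open_in T) s y.

Let m_app x y : x ∈ G -> y ∈ G -> m x y = app mG (opair x y).
Proof. by move=> xG yG; apply: (ap_app hZF mf); rewrite opair_in_prod. Qed.

Let factor_in a n : a ∈ cantor -> n ∈ omega -> pow01 e (ap g n) (ap a n) ∈ G.
Proof.
move=> ac no; case: (cantor_cases ac no) => ->; rewrite ?pow01_zero ?pow01_one //.
exact: (ap_in hZF hg).
Qed.

(** A first-order twin of [product_limit]: [ap] becomes [app], [pow01] becomes [ite]. *)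
Let product_limit' a y : Prop :=
  exists s, (is_fun s omega G /\ app s zero = e /\ ∀ n ∈ omega, app s (succ n) =
      app mG (opair (app s n) (ite (app a n = zero) e (app g n)))) /\
    y ∈ G /\ ∀ U ∈ T, y ∈ U -> ∃ N ∈ omega, ∀ n ∈ omega, nle N n -> app s n ∈ U.

Let product_limitE a y : a ∈ cantor -> product_limit a y <-> product_limit' a y.
Proof.
move=> ac; have ha := (in_cantor hZF a).1 ac.
have fE n : n ∈ omega -> pow01 e (ap g n) (ap a n) = ite (app a n = zero) e (app g n).
  move=> no; rewrite -(ap_app hZF ha) // -(ap_app hZF hg) //.
  case: (cantor_cases ac no) => ->; first by rewrite pow01_zero ite_true.
  by rewrite pow01_one ite_false //; apply: one_neq_zero.
have so s n : is_fun s omega G -> n ∈ omega -> app s n ∈ G.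
  by move=> sf no; rewrite -(ap_app hZF sf) //; apply: (ap_in hZF sf).
split=> -[s [[sf [s0 sS]] [yG sy]]]; exists s; split.
- split=> //; split=> [|n no]; first by rewrite -(ap_app hZF sf) //; apply: zero_omega.
  rewrite -(ap_app hZF sf) ?sS //; last exact: succ_omega.
  rewrite -fE // (ap_app hZF sf no) -m_app //; [exact: so|exact: factor_in].
- split=> // U UT yU; have [N [No HN]] := sy U UT yU; exists N; split=> // n no le.
  by rewrite -(ap_app hZF sf) //; apply: HN.
- split=> //; split=> [|n no]; first by rewrite (ap_app hZF sf) //; apply: zero_omega.
  rewrite (ap_app hZF sf) ?sS //; last exact: succ_omega.
  rewrite -[ap2 mG]/m -[unit_of _ _]/e fE // (ap_app hZF sf no) m_app //; first exact: so.
  by rewrite -fE //; apply: factor_in.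
- split=> // U UT yU; have [N [No HN]] := sy U UT yU; exists N; split=> // n no le.
  by rewrite (ap_app hZF sf) //; apply: HN.
Qed.

Lemma limit_unique s y y' : y ∈ G -> y' ∈ G -> converges (open_in T) s y ->
  converges (open_in T) s y' -> y = y'.
Proof.
move=> yG y'G sy sy'; apply: contrapT => yy'.
have [U [V [UT [VT [yU [y'V UV]]]]]] := htg_hausdorff hG yG y'G yy'.
have [n [no [nU nV]]] := eventually_ex (eventually_and (sy U UT yU) (sy' V VT y'V)).
by apply: (@in_empty _ hZF (ap s n)); rewrite -UV in_inter.
Qed.

Lemma partial_products_unique a s s' :
  partial_products G mG g a s -> partial_products G mG g a s' -> s = s'.
Proof.
move=> [sf [s0 sS]] [s'f [s'0 s'S]]; apply: (fun_ext hZF sf s'f).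
suff H : ∀ n ∈ omega, app s n = app s' n.
  by move=> n no; rewrite (ap_app hZF sf) // (ap_app hZF s'f) // H.
apply: (omega_ind hZF); first by definability.
  by rewrite -(ap_app hZF sf) -?(ap_app hZF s'f) ?s0 ?s'0 //; apply: zero_omega.
move=> n no E; have no' := succ_omega hZF no.
rewrite -(ap_app hZF sf) -?(ap_app hZF s'f) ?sS ?s'S //.
by rewrite (ap_app hZF sf) // (ap_app hZF s'f) // E.
Qed.

Lemma mul_converges c s s' y : c ∈ G -> y ∈ G -> is_fun s omega G ->
  converges (open_in T) s y -> eventually (fun n => ap s' n = m c (ap s n)) ->
  converges (open_in T) s' (m c y).
Proof.
move=> cG yG sf sy ss' V VT cyV.
have inV := setofE (preimage_ex V mf).
have [_ /(_ (opair c y))] := htg_mul hG VT.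
case; first by apply/inV; rewrite opair_in_prod.
move=> U1 [U2 [U1T [U2T [/(opair_in_prod hZF) [cU1 yU2] sub]]]].
have [N [No HN]] := eventually_and ss' (sy U2 U2T yU2).
exists N; split=> // n no le; have [-> snU] := HN n no le.
by have /inV [] : opair c (ap s n) ∈ setof (fun x => x ∈ prod G G /\ ap mG x ∈ V);
  [apply: sub; rewrite opair_in_prod|].
Qed.

(** With a the product of the factors before the n-th, c is the conjugate of g_n by a. It is
    characterized by c a = a g_n, a form that a homomorphism preserves without reference to
    inverses. *)
Lemma partial_products_flip s n S S' : s ∈ pow omega -> n ∈ omega -> ~ n ∈ s ->
  partial_products G mG g (chi s) S ->
  partial_products G mG g (chi (cup s (upair n n))) S' ->
  exists a c, [/\ a ∈ G, c ∈ G, m c a = m a (ap g n)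
    & eventually (fun k => ap S' k = m c (ap S k))].
Proof.
move=> so no ns [Sf [S0 SS]] [S'f [S'0 S'S]].
have Sin k : k ∈ omega -> app S k ∈ G.
  by move=> ko; rewrite -(ap_app hZF Sf) //; apply: (ap_in hZF Sf).
have S'in k : k ∈ omega -> app S' k ∈ G.
  by move=> ko; rewrite -(ap_app hZF S'f) //; apply: (ap_in hZF S'f).
have {}S0 : app S zero = e by rewrite -(ap_app hZF Sf) //; apply: zero_omega.
have {}S'0 : app S' zero = e by rewrite -(ap_app hZF S'f) //; apply: zero_omega.
have {}SS k : k ∈ omega ->
    app S (succ k) = m (app S k) (pow01 e (ap g k) (ap (chi s) k)).
  by move=> ko; rewrite -!(ap_app hZF Sf) //; [exact: SS|exact: succ_omega].
have {}S'S k : k ∈ omega ->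
    app S' (succ k) = m (app S' k) (pow01 e (ap g k) (ap (chi (cup s (upair n n))) k)).
  by move=> ko; rewrite -!(ap_app hZF S'f) //; [exact: S'S|exact: succ_omega].
have gG k : k ∈ omega -> ap g k ∈ G by apply: (ap_in hZF hg).
have below : ∀ k ∈ omega, nle k n -> app S' k = app S k.
  apply: (omega_ind hZF); first by definability.
    by rewrite S0.
  move=> k ko IH kn.
  have {}kn : k ∈ n by apply: (mem_nle_trans hZF no _ kn); apply: mem_succ.
  rewrite SS // S'S // IH; last by left.
  by rewrite chi_cup_neq // => E; subst k; apply: (mem_irrefl hZF kn).
have aG := Sin n no; set a := app S n in aG.
have [a' [a'G [_ a'a]]] := group_inv gl aG.
pose c := m (m a (ap g n)) a'.
have cG : c ∈ G by apply: mC => //; apply: mC => //; apply: gG.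
have ca : m c a = m a (ap g n).
  rewrite /c -mA //; last by apply: mC => //; apply: gG.
  by rewrite a'a me //; apply: mC => //; apply: gG.
have factG k : k ∈ omega -> pow01 e (ap g k) (ap (chi s) k) ∈ G.
  by move=> ko; apply: factor_in => //; apply: chi_cantor.
have above : ∀ k ∈ omega, n ∈ k -> app S' k = app mG (opair c (app S k)).
  apply: (omega_ind hZF); first by definability.
    by move/(in_empty hZF).
  move=> k ko IH; rewrite in_succ // => nk.
  have ko' := succ_omega hZF ko; rewrite -m_app //; last exact: Sin.
  rewrite SS // S'S //; case: nk => [nk|E].
    rewrite IH // -m_app //; last exact: Sin.
    rewrite chi_cup_neq //; last by move=> E; subst k; apply: (mem_irrefl hZF nk).
    by rewrite mA //; [exact: Sin|exact: factG].
  subst k; rewrite ap_chi_in //; last by rewrite in_cup // in_upair //; tauto.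
  rewrite ap_chi_notin // pow01_zero pow01_one below; last by right.
  by rewrite -/a me // ca.
  by [].
exists a, c; split=> //; exists (succ n); split; first exact: succ_omega.
move=> k ko nk; have {}nk : n ∈ k by apply: (mem_nle_trans hZF ko _ nk); apply: mem_succ.
by rewrite (ap_app hZF Sf) // (ap_app hZF S'f) // above // m_app //; apply: Sin.
Qed.

Theorem htg_card_le H mH phi : DC M -> all_cantor_subsets_baire M ->
  is_group H mH -> is_hom phi G (ap2 mG) H (ap2 mH) ->
  ~ eventually (fun n => in_ker phi G H (ap2 mH) (ap g n)) -> card_le cantor H.
Proof.
move=> hDC hBP [_ hH] [phif phiM] nker.
have hp y : y ∈ G -> ap phi y ∈ H by apply: (ap_in hZF phif).
have limex a : a ∈ cantor -> exists y, product_limit a y.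
  by move=> ac; have [s [ps [y [yG sy]]]] := gd ac; exists y, s.
have limuniq a y y' : product_limit a y -> product_limit a y' -> y = y'.
  move=> [s [ps [yG sy]]] [s' [ps' [y'G sy']]].
  have E := partial_products_unique ps ps'; subst s'.
  exact: (limit_unique yG y'G sy sy').
have [h [hh hP]] : exists h, is_fun h cantor H /\
    ∀ a ∈ cantor, exists y, product_limit' a y /\ ap h a = app phi y.
  apply: (@fun_of_relation cantor H
    (fun a v => exists y, product_limit' a y /\ v = app phi y)).
    by rewrite /product_limit' /is_fun; definability.
  move=> a ac; have [y Ly] := limex a ac; have [_ [_ [yG _]]] := Ly.
  exists (ap phi y); split.
    split; first exact: hp.
    by exists y; rewrite -product_limitE // (ap_app hZF phif).
  move=> v [_ [y' [/(product_limitE _ ac) Ly' ->]]].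
  by rewrite (limuniq _ _ _ Ly' Ly) (ap_app hZF phif).
have hE a y : a ∈ cantor -> product_limit a y -> ap h a = ap phi y.
  move=> ac Ly; have [y' [/(product_limitE _ ac) Ly' ->]] := hP a ac.
  by have [_ [_ [yG _]]] := Ly; rewrite (limuniq _ _ _ Ly' Ly) (ap_app hZF phif).
have [D hD] := doubling_exists hZF.
apply: (card_le_of_flips hZF hDC hBP hD hh) => k ko.
have [n [no [kn ngn]]] := not_eventually nker ko.
exists n; split=> //; split=> // s so ns eq_h; apply: ngn.
have gG := ap_in hZF hg no; split=> //.
have c0 := chi_cantor hZF s; have c1 := chi_cantor hZF (cup s (upair n n)).
have [y [S [pS [yG Sy]]]] := limex _ c0; have [y' [S' [pS' [y'G Sy']]]] := limex _ c1.
have [a [c [aG cG ca ev]]] := partial_products_flip so no ns pS pS'.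
have cy : y' = m c y.
  by apply: (limit_unique y'G _ Sy'); [exact: mC|exact: (mul_converges cG yG pS.1 Sy)].
move: eq_h; rewrite (hE _ y) //; last by exists S.
rewrite (hE _ y') //; last by exists S'.
have [uH u1] := unit_ofP hH; set u := unit_of H _ in uH u1 *.
rewrite cy phiM // => E.
(* Cancelling phi(y) in phi(y) = phi(c) phi(y) makes phi(c) trivial; the relation c a = a g_n then
   does the same for phi(g_n). *)
have cu : ap phi c = u.
  apply: (group_cancel_r hH (hp _ yG)) => //; first exact: hp.
  by rewrite -E (u1 _ (hp _ yG)).1.
apply: (group_cancel_l hH (hp _ aG)) => //; first exact: hp.
by rewrite -phiM // -[ap2 mG a _]ca phiM // cu (u1 _ (hp _ aG)).1 (u1 _ (hp _ aG)).2.
Qed.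

End TopologicalGroup.
End Groups.

Import Order.TTheory GRing.Theory Num.Theory.
Local Open Scope ring_scope.

(** * The reals of a model as a real field *)

Section ModelReals.
Variables (M : structure) (hZF : ZF M) (R : real_data M) (hR : is_reals R).

(* The two proofs are arguments so that the field structure can be inferred. *)
Definition model_real (_ : ZF M) (_ : is_reals R) : Type := {x : M | x ∈ rset R}.
Local Notation F := (model_real hZF hR).
Definition rval (x : F) : M := proj1_sig x.
Definition mkreal (x : M) (xR : x ∈ rset R) : F := exist _ x xR.

Lemma rval_in (x : F) : rval x ∈ rset R. Proof. exact: proj2_sig x. Qed.

Lemma rval_inj : injective rval.
Proof. by move=> [x xR] [y yR] /= E; apply: eq_exist. Qed.

Lemma radd_in x y : x ∈ rset R -> y ∈ rset R -> radd R x y ∈ rset R.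
Proof.
by move=> xR yR; apply: (ap_in hZF (re_add hR).1); rewrite opair_in_prod.
Qed.

Lemma rmul_in x y : x ∈ rset R -> y ∈ rset R -> rmul R x y ∈ rset R.
Proof.
by move=> xR yR; apply: (ap_in hZF (re_mul hR)); rewrite opair_in_prod.
Qed.

Lemma r0P : r0 R ∈ rset R /\ ∀ x ∈ rset R, radd R (r0 R) x = x /\ radd R x (r0 R) = x.
Proof. exact: (unit_ofP (re_add hR).2). Qed.

Lemma ropp_ex (x : F) : exists y : F, radd R (rval x) (rval y) = r0 R.
Proof.
have [y [yR [E _]]] := group_inv (re_add hR).2 (rval_in x).
by exists (mkreal yR).
Qed.

(** Put as a conditional so that a witness can be chosen for every x, zero included. *)
Lemma rinv_ex (x : F) : exists y : F, rval x <> r0 R -> rmul R (rval x) (rval y) = r1 R.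
Proof.
case: (EM (rval x = r0 R)) => [E|nE]; first by exists x.
by have [y [yR E]] := re_inv hR (rval_in x) nE; exists (mkreal yR).
Qed.

Definition Fadd (x y : F) : F := mkreal (radd_in (rval_in x) (rval_in y)).
Definition Fmul (x y : F) : F := mkreal (rmul_in (rval_in x) (rval_in y)).
Definition F0 : F := mkreal r0P.1.
Definition F1 : F := mkreal (re_1 hR).1.
Definition Fopp (x : F) : F := sval (cid (ropp_ex x)).
Definition Finv (x : F) : F := if `[< x = F0 >] then F0 else sval (cid (rinv_ex x)).
Definition Flt (x y : F) : bool := `[< rlt R (rval x) (rval y) >].
Definition Fle (x y : F) : bool := `[< x = y >] || Flt x y.
Definition Fnorm (x : F) : F := if Flt x F0 then Fopp x else x.

Lemma FaddC : commutative Fadd.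
Proof. by move=> x y; apply: rval_inj; apply: (re_addC hR); apply: rval_in. Qed.

Lemma FaddA : associative Fadd.
Proof.
by move=> x y z; apply: rval_inj; apply: (re_add hR).2.2.1; apply: rval_in.
Qed.

Lemma Fadd0 : left_id F0 Fadd.
Proof. by move=> x; apply: rval_inj; apply: (r0P.2 _ (rval_in x)).1. Qed.

Lemma FaddN : left_inverse F0 Fopp Fadd.
Proof.
by move=> x; rewrite FaddC; apply: rval_inj; rewrite /Fopp; case: cid.
Qed.

HB.instance Definition _ := gen_eqMixin F.
HB.instance Definition _ := gen_choiceMixin F.
HB.instance Definition _ := GRing.isZmodule.Build F FaddA FaddC Fadd0 FaddN.

Lemma FmulA : associative Fmul.
Proof. by move=> x y z; apply: rval_inj; apply: (re_mulA hR); apply: rval_in. Qed.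

Lemma FmulC : commutative Fmul.
Proof. by move=> x y; apply: rval_inj; apply: (re_mulC hR); apply: rval_in. Qed.

Lemma Fmul1 : left_id F1 Fmul.
Proof. by move=> x; apply: rval_inj; apply: (re_1 hR).2; apply: rval_in. Qed.

Lemma FmulDl : left_distributive Fmul Fadd.
Proof.
move=> x y z; rewrite !(FmulC _ z).
by apply: rval_inj; apply: (re_mulD hR); apply: rval_in.
Qed.

Lemma F1_neq0 : F1 != F0 :> F.
Proof. by apply/eqP => /(congr1 rval); apply: (re_10 hR). Qed.

HB.instance Definition _ :=
  GRing.Zmodule_isComNzRing.Build F FmulA FmulC Fmul1 FmulDl F1_neq0.

Lemma FmulV (x : F) : x != 0 -> Finv x * x = 1.
Proof.
move=> /eqP x0; rewrite mulrC; apply: rval_inj; rewrite /Finv asboolF //.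
by case: cid => y /= -> // E; apply: x0; apply: rval_inj.
Qed.

Lemma Finv0 : Finv 0 = 0.
Proof. by rewrite /Finv asboolT. Qed.

HB.instance Definition _ := GRing.ComNzRing_isField.Build F FmulV Finv0.

Lemma Flt_trans (x y z : F) : Flt x y -> Flt y z -> Flt x z.
Proof.
by move=> /asboolP xy /asboolP yz; apply/asboolP; apply: (re_lt_trans hR) xy yz;
  apply: rval_in.
Qed.

Lemma Flt_add (x y z : F) : Flt x y -> Flt (x + z) (y + z).
Proof.
by move=> /asboolP xy; apply/asboolP; apply: (re_lt_add hR) xy; apply: rval_in.
Qed.

Lemma Flt0_add (x y : F) : Flt 0 x -> Flt 0 y -> Flt 0 (x + y).
Proof.
by move=> x0 y0; apply: Flt_trans y0 _; have := Flt_add y x0; rewrite add0r.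
Qed.

Lemma Flt0_mul (x y : F) : Flt 0 x -> Flt 0 y -> Flt 0 (x * y).
Proof.
move=> /asboolP x0 /asboolP y0; apply/asboolP.
by apply: (re_lt_mul hR) x0 y0; apply: rval_in.
Qed.

Lemma Flt0_ngt0 (x : F) : Flt 0 x -> ~~ Flt x 0.
Proof.
move=> x0; apply/negP => /(Flt_trans x0)/asboolP.
exact: (re_lt_irrefl hR (rval_in _)).
Qed.

Lemma Fsub_gt0 (x y : F) : Flt 0 (y - x) = Flt x y.
Proof.
apply/idP/idP => [/(Flt_add x)|/(Flt_add (- x))]; first by rewrite add0r subrK.
by rewrite subrr.
Qed.

Lemma Flt0_total (x : F) : x != 0 -> Flt 0 x || Flt x 0.
Proof.
move=> /eqP x0; have := re_lt_total hR r0P.1 (rval_in x).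
case=> [H|[H|H]]; apply/orP; [by left; apply/asboolP| |by right; apply/asboolP].
by case: x0; apply: rval_inj.
Qed.

Lemma FnormN (x : F) : Fnorm (- x) = Fnorm x.
Proof.
have E : Flt (- x) 0 = Flt 0 x by rewrite -Fsub_gt0 sub0r opprK.
rewrite /Fnorm -[F0]/(0 : F) E -[Fopp x]/(- x) -[Fopp (- x)]/(- - x) opprK.
case: (eqVneq x 0) => [->|/Flt0_total]; first by rewrite oppr0; case: ifP.
case/orP => H; first by rewrite H (negbTE (Flt0_ngt0 H)).
have /negbTE -> : ~~ Flt 0 x by apply/negP => /Flt0_ngt0; rewrite H.
by rewrite H.
Qed.

Lemma Fge0_norm (x : F) : Fle 0 x -> Fnorm x = x.
Proof.
case/orP => [/asboolP <-|/Flt0_ngt0 /negbTE H]; last by rewrite /Fnorm H.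
by rewrite /Fnorm; case: ifP => // _; apply: (oppr0 F).
Qed.

Lemma Fle_def (x y : F) : Fle x y = (x == y) || Flt x y.
Proof. by congr orb; apply/asboolP/eqP. Qed.

HB.instance Definition _ := Num.IntegralDomain_isLtReal.Build F
  Flt0_add Flt0_mul Flt0_ngt0 Fsub_gt0 Flt0_total FnormN Fge0_norm Fle_def.

Lemma rvalD (x y : F) : rval (x + y) = radd R (rval x) (rval y). Proof. by []. Qed.
Lemma rvalM (x y : F) : rval (x * y) = rmul R (rval x) (rval y). Proof. by []. Qed.
Lemma rltE (x y : F) : rlt R (rval x) (rval y) <-> x < y.
Proof. by split=> [H|/asboolP]; first exact/asboolP. Qed.

Lemma rleE (x y : F) : rle R (rval x) (rval y) <-> x <= y.
Proof.
rewrite le_eqVlt; split=> [[/rltE ->|/rval_inj ->]|/orP [/eqP ->|/rltE]].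
- by rewrite orbT.
- by rewrite eqxx.
- by right.
- by left.
Qed.

Lemma rvalN (x : F) : inv_of (rset R) (radd R) (rval x) = rval (- x).
Proof.
apply: theE; first by rewrite -!rvalD subrr addNr; split; [exact: rval_in|].
move=> z [zR [E _]]; rewrite -[z]/(rval (mkreal zR)); congr rval.
apply: (addrI x); rewrite subrr; apply: rval_inj; exact: E.
Qed.

Lemma rvalB (x y : F) : rsub R (rval x) (rval y) = rval (x - y).
Proof. by rewrite /rsub rvalN. Qed.

Lemma rvalV (x : F) : x != 0 -> inv_of (rset R) (rmul R) (rval x) = rval x^-1.
Proof.
move=> x0; apply: theE.
  by rewrite -!rvalM divff // mulVf //; split; [exact: rval_in|].
move=> z [zR [E _]]; rewrite -[z]/(rval (mkreal zR)); congr rval.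
apply: (mulfI x0); rewrite divff //; apply: rval_inj; exact: E.
Qed.

Lemma rvalF (x y : F) : y != 0 -> rdiv R (rval x) (rval y) = rval (x / y).
Proof. by move=> y0; rewrite /rdiv rvalV. Qed.

Lemma rvalP (x : M) : x ∈ rset R <-> exists y : F, x = rval y.
Proof. by split=> [xR|[y ->]]; [exists (mkreal xR) | exact: rval_in]. Qed.

End ModelReals.


(** All later contact with the reals goes through this interface: inequalities are solved in [F],
    and [v] carries the results to elements of the model, where sets are formed. *)
Record real_coding (M : structure) (R : real_data M) (F : realFieldType) (v : F -> M) := {
  rc_inj : injective v;
  rc_surj : forall x, x ∈ rset R <-> exists y, x = v y;
  rc_add : forall x y, radd R (v x) (v y) = v (x + y);
  rc_sub : forall x y, rsub R (v x) (v y) = v (x - y);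
  rc_mul : forall x y, rmul R (v x) (v y) = v (x * y);
  rc_div : forall x y, y != 0 -> rdiv R (v x) (v y) = v (x / y);
  rc_0 : r0 R = v 0;
  rc_1 : r1 R = v 1;
  rc_2 : r2 R = v 2;
  rc_lt : forall x y, rlt R (v x) (v y) <-> x < y;
  rc_le : forall x y, rle R (v x) (v y) <-> x <= y
}.

Lemma real_coding_exists (M : structure) (R : real_data M) : ZF M -> is_reals R ->
  exists (F : realFieldType) (v : F -> M), real_coding R v.
Proof.
move=> hZF hR; exists (model_real hZF hR), (@rval M hZF R hR); split.
- exact: rval_inj.
- exact: rvalP.
- by [].
- exact: rvalB.
- by [].
- exact: rvalF.
- by [].
- by [].
- by [].
- exact: rltE.
- exact: rleE.
Qed.

(** * Continuity on the unit square *)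

Section UnitSquare.
Variable F : realFieldType.
Implicit Types (a b c d e t s : F) (p q u : F -> F -> F).

Definition inI t : Prop := 0 <= t /\ t <= 1.
Definition close d a b : Prop := a - d < b /\ b < a + d.

Definition square_cont p : Prop := forall a b, inI a -> inI b -> forall e, 0 < e ->
  exists2 d : F, 0 < d & forall a' b', inI a' -> inI b' -> close d a a' -> close d b b' ->
    close e (p a b) (p a' b').

Lemma close_le d d' a b : d <= d' -> close d a b -> close d' a b.
Proof. by rewrite /close => dd [? ?]; split; lra. Qed.

Lemma min_gt0 d d' : 0 < d -> 0 < d' -> exists2 e : F, 0 < e & e <= d /\ e <= d'.
Proof.
move=> d0 d'0; exists (Num.min d d'); first by rewrite lt_min d0.
by split; rewrite ge_min lexx ?orbT.
Qed.

Lemma square_cont_fst : square_cont (fun a _ => a).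
Proof. by move=> a b _ _ e e0; exists e. Qed.

Lemma square_cont_snd : square_cont (fun _ b => b).
Proof. by move=> a b _ _ e e0; exists e. Qed.

Lemma square_cont_affine p c d : 0 < c -> square_cont p ->
  square_cont (fun a b => c * p a b + d).
Proof.
move=> c0 cp a b aI bI e e0; have [|r r0 H] := cp a b aI bI (e / c); first exact: divr_gt0.
exists r => // a' b' a'I b'I aa bb; have [H1 H2] := H a' b' a'I b'I aa bb.
have E : c * (e / c) = e by rewrite mulrC divfK // gt_eqF.
split.
  by have : c * (p a b - e / c) < c * p a' b'; [rewrite ltr_pM2l|rewrite mulrBr E; lra].
by have : c * p a' b' < c * (p a b + e / c); [rewrite ltr_pM2l|rewrite mulrDr E; lra].
Qed.

Lemma square_cont_opp p d : square_cont p -> square_cont (fun a b => d - p a b).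
Proof.
move=> cp a b aI bI e e0; have [r r0 H] := cp a b aI bI e e0.
exists r => // a' b' a'I b'I aa bb; have [H1 H2] := H a' b' a'I b'I aa bb.
by split; lra.
Qed.

Lemma square_cont_min p c : square_cont p -> square_cont (fun a b => Num.min (p a b) c).
Proof.
move=> cp a b aI bI e e0; have [r r0 H] := cp a b aI bI e e0.
exists r => // a' b' a'I b'I aa bb; have [H1 H2] := H a' b' a'I b'I aa bb.
by rewrite /close; case: (leP (p a b) c) => ?; case: (leP (p a' b') c) => ?; split; lra.
Qed.

Lemma square_cont_max p c : square_cont p -> square_cont (fun a b => Num.max (p a b) c).
Proof.
move=> cp a b aI bI e e0; have [r r0 H] := cp a b aI bI e e0.
exists r => // a' b' a'I b'I aa bb; have [H1 H2] := H a' b' a'I b'I aa bb.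
by rewrite /close; case: (leP (p a b) c) => ?; case: (leP (p a' b') c) => ?; split; lra.
Qed.

(** Pasting: off the set u = c the test is locally constant, and on it both branches have the same
    value, so the smaller of the two radii works. *)
Lemma square_cont_if u p q c : square_cont u -> square_cont p -> square_cont q ->
  (forall a b, inI a -> inI b -> u a b = c -> p a b = q a b) ->
  square_cont (fun a b => if u a b <= c then p a b else q a b).
Proof.
move=> cu cp cq pq a b aI bI e e0.
have [r r0 Hp] := cp a b aI bI e e0; have [r' r'0 Hq] := cq a b aI bI e e0.
case: (ltgtP (u a b) c) => uc.
- have [|s s0 Hu] := cu a b aI bI (c - u a b); first by lra.
  have [d d0 [dr ds]] := min_gt0 r0 s0.
  exists d => // a' b' a'I b'I aa bb.
  have [_ Hu'] := Hu a' b' a'I b'I (close_le ds aa) (close_le ds bb).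
  have -> : u a' b' <= c by lra.
  by apply: Hp => //; apply: close_le dr _.
- have [|s s0 Hu] := cu a b aI bI (u a b - c); first by lra.
  have [d d0 [dr ds]] := min_gt0 r'0 s0.
  exists d => // a' b' a'I b'I aa bb.
  have [Hu' _] := Hu a' b' a'I b'I (close_le ds aa) (close_le ds bb).
  have /negbTE -> : ~~ (u a' b' <= c) by rewrite -ltNge; lra.
  by apply: Hq => //; apply: close_le dr _.
- have [d d0 [dr dr']] := min_gt0 r0 r'0.
  exists d => // a' b' a'I b'I aa bb; case: ifP => _.
    by apply: Hp => //; apply: close_le dr _.
  by rewrite (pq a b) //; apply: Hq => //; apply: close_le dr' _.
Qed.

Lemma square_cont_convex (th : F -> F) : (forall a, inI a -> inI (th a)) ->
  square_cont (fun a _ => th a) -> square_cont (fun a b => (1 - b) * th a + b * a).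
Proof.
move=> thI cth a b aI bI e e0.
have [|r r0 H] := cth a b aI bI (e / 4); first by lra.
have e4 : 0 < e / 4 by lra.
have [d d0 [dr de]] := min_gt0 r0 e4.
exists d => // a' b' a'I b'I aa bb.
have [H1 H2] := H a' b' a'I b'I (close_le dr aa) (close_le dr bb).
have [A1 A2] := close_le de aa; have [B1 B2] := close_le de bb.
have [t0 t1] := thI a aI; have [t0' t1'] := thI a' a'I.
case: aI bI a'I b'I => a0 a1 [b0 b1] [a0' a1'] [b0' b1'].
(* In each of the three products one factor is smaller than e / 4 in absolute value and the other
   lies between -1 and 1, so the sum stays within 3 e / 4. *)
have E : (1 - b') * th a' + b' * a' - ((1 - b) * th a + b * a) =
  (1 - b') * (th a' - th a) + b' * (a' - a) + (b' - b) * (a - th a) by ring.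
suff [S1 S2] : - e < (1 - b') * (th a' - th a) + b' * (a' - a) + (b' - b) * (a - th a) /\
    (1 - b') * (th a' - th a) + b' * (a' - a) + (b' - b) * (a - th a) < e.
  by rewrite /close; split; lra.
have bound (x y f : F) : - f < x -> x < f -> -1 <= y -> y <= 1 -> - f <= y * x /\ y * x <= f.
  by move=> *; split; nra.
have [] := bound (th a' - th a) (1 - b') (e / 4); [lra|lra|lra|lra|].
have [] := bound (a' - a) b' (e / 4); [lra|lra|lra|lra|].
have [] := bound (b' - b) (a - th a) (e / 4); [lra|lra|lra|lra|].
by rewrite [(a - th a) * _]mulrC => *; split; lra.
Qed.

Section Valued.
Variables (M : structure) (T : M).
Implicit Types (f g : F -> F -> M).

(* A map of one variable is regarded as a map on the square. *)
Definition top_cont f : Prop := forall V, V ∈ T -> forall a b, inI a -> inI b ->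
  f a b ∈ V -> exists2 d : F, 0 < d & forall a' b', inI a' -> inI b' ->
    close d a a' -> close d b b' -> f a' b' ∈ V.

Lemma top_cont_ext f g : (forall a b, inI a -> inI b -> f a b = g a b) ->
  top_cont f -> top_cont g.
Proof.
move=> fg cf V VT a b aI bI; rewrite -fg // => /(cf V VT a b aI bI) [d d0 H].
by exists d => // a' b' a'I b'I aa bb; rewrite -fg //; apply: H.
Qed.

Lemma top_cont_comp f p q : top_cont f -> square_cont p -> square_cont q ->
  (forall a b, inI a -> inI b -> inI (p a b)) ->
  (forall a b, inI a -> inI b -> inI (q a b)) ->
  top_cont (fun a b => f (p a b) (q a b)).
Proof.
move=> cf cp cq pI qI V VT a b aI bI fV.
have [e e0 H] := cf V VT _ _ (pI a b aI bI) (qI a b aI bI) fV.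
have [r r0 Hp] := cp a b aI bI e e0; have [r' r'0 Hq] := cq a b aI bI e e0.
have [d d0 [dr dr']] := min_gt0 r0 r'0.
exists d => // a' b' a'I b'I aa bb; apply: H; [exact: pI|exact: qI| |].
  by apply: Hp => //; apply: close_le dr _.
by apply: Hq => //; apply: close_le dr' _.
Qed.

Lemma top_cont_if u f g c : square_cont u -> top_cont f -> top_cont g ->
  (forall a b, inI a -> inI b -> u a b = c -> f a b = g a b) ->
  top_cont (fun a b => if u a b <= c then f a b else g a b).
Proof.
move=> cu cf cg fg V VT a b aI bI.
case: (ltgtP (u a b) c) => uc fV.
- have [r r0 Hf] := cf V VT a b aI bI fV.
  have [|s s0 Hu] := cu a b aI bI (c - u a b); first by lra.
  have [d d0 [dr ds]] := min_gt0 r0 s0.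
  exists d => // a' b' a'I b'I aa bb.
  have [_ Hu'] := Hu a' b' a'I b'I (close_le ds aa) (close_le ds bb).
  have -> : u a' b' <= c by lra.
  by apply: Hf => //; apply: close_le dr _.
- have [r r0 Hg] := cg V VT a b aI bI fV.
  have [|s s0 Hu] := cu a b aI bI (u a b - c); first by lra.
  have [d d0 [dr ds]] := min_gt0 r0 s0.
  exists d => // a' b' a'I b'I aa bb.
  have [Hu' _] := Hu a' b' a'I b'I (close_le ds aa) (close_le ds bb).
  have /negbTE -> : ~~ (u a' b' <= c) by rewrite -ltNge; lra.
  by apply: Hg => //; apply: close_le dr _.
- have [r r0 Hf] := cf V VT a b aI bI fV.
  have [|r' r'0 Hg] := cg V VT a b aI bI; first by rewrite -fg.
  have [d d0 [dr dr']] := min_gt0 r0 r'0.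
  exists d => // a' b' a'I b'I aa bb; case: ifP => _.
    by apply: Hf => //; apply: close_le dr _.
  by apply: Hg => //; apply: close_le dr' _.
Qed.

End Valued.
End UnitSquare.

(** * Loops and homotopies *)

(** [concat] and [loop_power] apply [lam] to a description whose definability is not evident. A
    function of the model with the same values shows that the class in question is a set. *)
Lemma lam_of_fun (M : structure) (hZF : ZF M) (f A B : M) (t : M -> M) :
  is_fun f A B -> (∀ x ∈ A, ap f x = t x) -> lam A t = f.
Proof.
move=> hf ft.
have H : forall p, p ∈ f <-> ∃ x ∈ A, p = opair x (t x).
  move=> p; split=> [pf|[x [xA ->]]]; last by rewrite (in_fun hZF _ _ hf) ft.
  have /(in_prod hZF) [x [xA [y [_ E]]]] := hf.1 _ pf; subst p.
  by exists x; split=> //; have [_ ->] := (in_fun hZF _ _ hf).1 pf; rewrite ft.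
apply: (set_ext hZF) => p; rewrite H.
exact: (@setofE M (fun p => ∃ x ∈ A, p = opair x (t x)) (ex_intro _ f H)).
Qed.

Section Loops.
Variables (M : structure) (hZF : ZF M) (R : real_data M) (hR : is_reals R).
Variables (F : realFieldType) (v : F -> M) (rc : real_coding R v).
Variables X T x : M.
Local Notation I := (unitI R).
Local Notation tadd s t := (app (radd_set R) (opair s t)).
Local Notation tmul s t := (app (rmul_set R) (opair s t)).
Implicit Types (a b : F) (s t l h U V W : M).

Lemma v_in a : v a ∈ rset R. Proof. by apply/(rc_surj rc); exists a. Qed.

Lemma tadd_v a b : tadd (v a) (v b) = v (a + b).
Proof.
rewrite -(rc_add rc) /radd /ap2 (ap_app hZF (re_add hR).1) // opair_in_prod //.
by split; apply: v_in.
Qed.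

Lemma tmul_v a b : tmul (v a) (v b) = v (a * b).
Proof.
rewrite -(rc_mul rc) /rmul /ap2 (ap_app hZF (re_mul hR)) // opair_in_prod //.
by split; apply: v_in.
Qed.

Lemma in_unitI t : t ∈ I <-> exists a, inI a /\ t = v a.
Proof.
have -> : t ∈ I <-> t ∈ rset R /\ rle R (r0 R) t /\ rle R t (r1 R).
  apply: (@setofE M (fun t => t ∈ rset R /\ rle R (r0 R) t /\ rle R t (r1 R))).
  apply: (sub_set_ex hZF (A := rset R)) => [s []|] //; rewrite /rle /rlt.
  by definability.
rewrite (rc_0 rc) (rc_1 rc); split=> [[/(rc_surj rc) [a ->]]|[a [[a0 a1] ->]]].
  by rewrite !(rc_le rc) => aI; exists a.
by split; [exact: v_in|rewrite !(rc_le rc)].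
Qed.

Lemma v_inI a : v a ∈ I <-> inI a.
Proof.
by rewrite in_unitI; split=> [[b [bI /(rc_inj rc) ->]]|aI] //; exists a.
Qed.

Lemma inI0 : inI (0 : F). Proof. by split; lra. Qed.
Lemma inI1 : inI (1 : F). Proof. by split; lra. Qed.

Lemma real_openE U : real_open R U <-> subset U (rset R) /\
  forall a, v a ∈ U -> exists2 d : F, 0 < d & forall b, close d a b -> v b ∈ U.
Proof.
split=> [[Us H]|[Us H]]; split=> //.
  move=> a /H [_ [/(rc_surj rc) [c ->] [_ [/(rc_surj rc) [d ->]]]]].
  rewrite !(rc_lt rc) => -[ca [ad K]].
  have ac0 : 0 < a - c by lra.
  have da0 : 0 < d - a by lra.
  have [e e0 [e1 e2]] := min_gt0 ac0 da0.
  by exists e => // b [b1 b2]; apply: K; [exact: v_in| |]; rewrite !(rc_lt rc); lra.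
move=> t tU; have /(rc_surj rc) [a E] := Us _ tU; subst t; have [d d0 K] := H a tU.
exists (v (a - d)); split; first exact: v_in.
exists (v (a + d)); split; first exact: v_in.
rewrite !(rc_lt rc); split; first by lra.
split; first by lra.
by move=> _ /(rc_surj rc) [b ->]; rewrite !(rc_lt rc) => *; apply: K.
Qed.

Lemma interval_open (c d : F) : exists U, real_open R U /\ forall a, v a ∈ U <-> c < a /\ a < d.
Proof.
have [U hU] := @separation _ hZF (fun t => rlt R (v c) t /\ rlt R t (v d)) (rset R)
  ltac:(by rewrite /rlt; definability).
have vU a : v a ∈ U <-> c < a /\ a < d.
  by rewrite hU !(rc_lt rc); split=> [[]|] //; split=> //; apply: v_in.
exists U; split=> //; apply/real_openE; split=> [t|a /vU [ca ad]]; first by rewrite hU => -[].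
have ac0 : 0 < a - c by lra.
have da0 : 0 < d - a by lra.
have [e e0 [e1 e2]] := min_gt0 ac0 da0.
by exists e => // b [b1 b2]; apply/vU; split; lra.
Qed.

(** Continuity of a path written out with [app] and bounded quantifiers, so that it can occur in a
    separation formula; [square_open] does the same for homotopies. *)
Let path_open l := ∀ V ∈ T, ∃ U ∈ pow (rset R),
  (∀ s ∈ U, ∃ a ∈ rset R, ∃ b ∈ rset R, rlt R a s /\ rlt R s b /\
    ∀ y ∈ rset R, rlt R a y -> rlt R y b -> y ∈ U) /\
  ∀ t ∈ I, (t ∈ U <-> app l t ∈ V).

Let path_openE l : is_fun l I X ->
  continuous I (unitI_open R) (open_in T) (ap l) <-> path_open l.
Proof.
move=> hl; split=> H V VT; have inW := setofE (preimage_ex hZF V hl).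
  have [U [[Us Uo] E]] := H V VT; exists U; rewrite in_pow //; split=> //; split=> // t tI.
  by have := inW t; rewrite E in_inter // (ap_app hZF hl) //; tauto.
have [U [Us [Uo E]]] := H V VT; exists U; split; first by rewrite in_pow // in Us; split.
apply: (set_ext hZF) => t; rewrite inW in_inter //.
split=> [[tI]|[tU tI]]; rewrite (ap_app hZF hl) //; last by split=> //; apply/E.
by move/E => tU; split=> //; apply: tU.
Qed.

Lemma path_continuous l : is_fun l I X ->
  continuous I (unitI_open R) (open_in T) (ap l) <-> top_cont T (fun a _ : F => ap l (v a)).
Proof.
move=> hl; rewrite path_openE //; split=> H V VT.
  move=> a b aI bI laV; have [U [Us [Uo E]]] := H V VT.
  have /real_openE [_ Ud] : real_open R U by rewrite in_pow // in Us; split.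
  have vaI := (v_inI a).2 aI.
  have /Ud [d d0 K] : v a ∈ U by apply/E; rewrite -?(ap_app hZF hl).
  exists d => // a' b' a'I b'I aa bb; have va'I := (v_inI a').2 a'I.
  by rewrite (ap_app hZF hl) //; apply/E => //; apply: K.
(* The open set is the union of all open intervals whose part in the unit interval is mapped into V;
   no interval has to be chosen. *)
pose good (a b : M) := ∀ t ∈ I, rlt R a t -> rlt R t b -> app l t ∈ V.
have [U hU] := @separation _ hZF (fun y => ∃ a ∈ rset R, ∃ b ∈ rset R,
  rlt R a y /\ rlt R y b /\ good a b) (rset R) ltac:(by rewrite /good /rlt; definability).
exists U; split; first by rewrite in_pow // => t; rewrite hU => -[].
split=> [s|t tI].
  rewrite hU => -[sR [a [aR [b [bR [as_ [sb g]]]]]]]; exists a; split=> //; exists b.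
  split=> //; split=> //; split=> // y yR ay yb; rewrite hU; split=> //.
  by exists a; split=> //; exists b.
rewrite hU; split=> [[_ [a [aR [b [bR [at_ [tb g]]]]]]]|ltV]; first exact: g.
have /in_unitI [a [aI E]] := tI; subst t; split; first exact: v_in.
have [|d d0 K] := H V VT a a aI aI; first by rewrite (ap_app hZF hl).
exists (v (a - d)); split; first exact: v_in.
exists (v (a + d)); split; first exact: v_in.
rewrite !(rc_lt rc); split; first by lra.
split; first by lra.
move=> _ /in_unitI [a' [a'I ->]]; rewrite !(rc_lt rc) => *.
have va'I := (v_inI a').2 a'I.
by rewrite -(ap_app hZF hl) //; apply: (K a' a') => //; split; lra.
Qed.

Let square_open h := ∀ V ∈ T, ∀ s ∈ I, ∀ t ∈ I, app h (opair s t) ∈ V ->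
  ∃ a ∈ rset R, ∃ b ∈ rset R, ∃ c ∈ rset R, ∃ d ∈ rset R,
  (rlt R a s /\ rlt R s b) /\ (rlt R c t /\ rlt R t d) /\
  ∀ s' ∈ I, ∀ t' ∈ I, rlt R a s' -> rlt R s' b -> rlt R c t' -> rlt R t' d ->
    app h (opair s' t') ∈ V.

Lemma ap2_app h s t : is_fun h (prod I I) X -> s ∈ I -> t ∈ I ->
  ap2 h s t = app h (opair s t).
Proof. by move=> hh sI tI; apply: (ap_app hZF hh); rewrite opair_in_prod. Qed.

Let square_openE h : is_fun h (prod I I) X ->
  top_cont T (fun a b : F => ap2 h (v a) (v b)) <-> square_open h.
Proof.
move=> hh; split=> H V VT.
  move=> _ /in_unitI [a [aI ->]] _ /in_unitI [b [bI ->]].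
  have vaI := (v_inI a).2 aI; have vbI := (v_inI b).2 bI.
  rewrite -ap2_app // => /(H V VT a b aI bI) [d d0 K].
  exists (v (a - d)); split; first exact: v_in.
  exists (v (a + d)); split; first exact: v_in.
  exists (v (b - d)); split; first exact: v_in.
  exists (v (b + d)); split; first exact: v_in.
  rewrite !(rc_lt rc); split; first by split; lra.
  split; first by split; lra.
  move=> _ /in_unitI [a' [a'I ->]] _ /in_unitI [b' [b'I ->]]; rewrite !(rc_lt rc) => *.
  by rewrite -ap2_app ?v_inI //; apply: (K a' b') => //; split; lra.
move=> a b aI bI; rewrite ap2_app ?v_inI // => hV.
have [_ [/(rc_surj rc) [c1 ->] [_ [/(rc_surj rc) [c2 ->] [_ [/(rc_surj rc) [d1 ->]
  [_ [/(rc_surj rc) [d2 ->]]]]]]]]] := H V VT _ ((v_inI a).2 aI) _ ((v_inI b).2 bI) hV.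
rewrite !(rc_lt rc) => -[[ac1 ac2] [[bd1 bd2] K]].
have [e1 e10 [? ?]] : exists2 e : F, 0 < e & e <= a - c1 /\ e <= c2 - a.
  by apply: min_gt0; lra.
have [e2 e20 [? ?]] : exists2 e : F, 0 < e & e <= b - d1 /\ e <= d2 - b.
  by apply: min_gt0; lra.
have [e e0 [? ?]] := min_gt0 e10 e20.
exists e => // a' b' a'I b'I [? ?] [? ?]; rewrite ap2_app ?v_inI //.
by apply: K; rewrite ?v_inI ?(rc_lt rc) //; lra.
Qed.

Lemma square_continuous h : is_fun h (prod I I) X ->
  continuous (prod I I) (prod_open I (unitI_open R) I (unitI_open R)) (open_in T) (ap h) <->
  top_cont T (fun a b : F => ap2 h (v a) (v b)).
Proof.
move=> hh; split=> H V VT; have inW := setofE (preimage_ex hZF V hh).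
  move=> a b aI bI hV; have [_ /(_ (opair (v a) (v b)))] := H V VT.
  case; first by apply/inW; rewrite opair_in_prod // !v_inI.
  move=> _ [_ [[U1 [U1o ->]] [[U2 [U2o ->]] [/(opair_in_prod hZF) [aU bU] K]]]].
  move: aU bU; rewrite !in_inter // => -[aU _] [bU _].
  have [d1 d10 H1] := ((real_openE _).1 U1o).2 a aU.
  have [d2 d20 H2] := ((real_openE _).1 U2o).2 b bU.
  have [d d0 [dd1 dd2]] := min_gt0 d10 d20.
  exists d => // a' b' a'I b'I aa bb.
  have /K /inW [] // : opair (v a') (v b') ∈ prod (inter U1 I) (inter U2 I).
  rewrite opair_in_prod // !in_inter // !v_inI; split; split=> //.
    by apply: H1; apply: close_le aa.
  by apply: H2; apply: close_le bb.
split=> [p /inW [] //|_ /inW [/(in_prod hZF) [s [sI [t [tI ->]]]] hV]].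
have /in_unitI [a [aI E]] := sI; subst s; have /in_unitI [b [bI E]] := tI; subst t.
have [d d0 K] := H V VT a b aI bI hV.
have [U1 [U1o inU1]] := interval_open (a - d) (a + d).
have [U2 [U2o inU2]] := interval_open (b - d) (b + d).
exists (inter U1 I), (inter U2 I); split; first by exists U1.
split; first by exists U2.
split.
  by rewrite opair_in_prod // !in_inter // inU1 inU2; split; split=> //; split; lra.
move=> _ /(in_prod hZF) [s' [s'U [t' [t'U ->]]]]; move: s'U t'U; rewrite !in_inter //.
move=> -[+ /in_unitI [a' [a'I E]]] [+ /in_unitI [b' [b'I E']]]; subst s' t'.
rewrite inU1 inU2 => aa bb; apply/inW; rewrite opair_in_prod // !v_inI.
by split=> //; apply: K.
Qed.

Definition path_hom l l' h : Prop :=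
  [/\ is_fun h (prod I I) X, top_cont T (fun a b : F => ap2 h (v a) (v b))
    & forall a, inI a -> [/\ ap2 h (v a) (v 0) = ap l (v a), ap2 h (v a) (v 1) = ap l' (v a),
        ap2 h (v 0) (v a) = x & ap2 h (v 1) (v a) = x]].

Lemma homotopicE l l' : homotopic R X T x l l' <-> exists h, path_hom l l' h.
Proof.
rewrite /homotopic (rc_0 rc) (rc_1 rc); split=> -[h].
  move=> [hh [ch H]]; exists h; split=> //; first exact/square_continuous.
  by move=> a aI; have [? [? [? ?]]] := H _ ((v_inI a).2 aI).
move=> [hh ch H]; exists h; split=> //; split; first exact/square_continuous.
by move=> _ /in_unitI [a [aI ->]]; have [] := H a aI.
Qed.

Lemma is_loopE l : is_loop R X T x l <-> is_fun l I X /\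
  top_cont T (fun a _ : F => ap l (v a)) /\ ap l (v 0) = x /\ ap l (v 1) = x.
Proof.
rewrite /is_loop (rc_0 rc) (rc_1 rc).
by split=> -[hl [cl H]]; split=> //; split=> //; apply/(path_continuous hl).
Qed.

(** [loopD] and [homD] are the definable twins of loops and homotopies; they make loop classes and
    the fundamental group sets of the model. *)
Let loopD l := is_fun l I X /\ path_open l /\ app l (v 0) = x /\ app l (v 1) = x.

Let loopDE l : is_loop R X T x l <-> loopD l.
Proof.
rewrite /is_loop (rc_0 rc) (rc_1 rc).
have I0 := (v_inI 0).2 inI0; have I1 := (v_inI 1).2 inI1.
by split=> -[hl [cl H]]; split=> //; split; try exact/(path_openE hl);
  move: H; rewrite !(ap_app hZF hl).
Qed.

Let homD l l' := exists h, is_fun h (prod I I) X /\ square_open h /\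
  ∀ t ∈ I, app h (opair t (v 0)) = app l t /\ app h (opair t (v 1)) = app l' t /\
    app h (opair (v 0) t) = x /\ app h (opair (v 1) t) = x.

Let homDE l l' : is_fun l I X -> is_fun l' I X -> homotopic R X T x l l' <-> homD l l'.
Proof.
have I0 := (v_inI 0).2 inI0; have I1 := (v_inI 1).2 inI1.
move=> hl hl'; rewrite homotopicE; split=> -[h].
  move=> [hh ch H]; exists h; split=> //; split; first exact/square_openE.
  move=> _ /in_unitI [a [aI ->]]; have tI := (v_inI a).2 aI.
  by rewrite -!ap2_app // -!(ap_app hZF hl) // -!(ap_app hZF hl') //; have [] := H a aI.
move=> [hh [ch H]]; exists h; split=> //; first exact/square_openE.
move=> a aI; have tI := (v_inI a).2 aI.
rewrite !ap2_app // !(ap_app hZF hl) // !(ap_app hZF hl') //.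
by have [? [? [? ?]]] := H _ tI.
Qed.

Lemma in_loop_class l l' : is_fun l I X -> l' ∈ loop_class R X T x l <->
  is_loop R X T x l' /\ homotopic R X T x l l'.
Proof.
move=> hl; apply: (@setofE M (fun l' => is_loop R X T x l' /\ homotopic R X T x l l')).
apply: (sub_set_ex hZF (A := funs I X)) => [k [[] ? _ _]|]; first by rewrite in_funs.
apply: (definable_iff (P := fun e => loopD (e 0) /\ homD l (e 0))) => [e|].
  by rewrite loopDE; split=> -[lD H]; split=> //; apply/(homDE hl lD.1).
rewrite /loopD /homD /path_open /square_open /is_fun /rlt; definability.
Qed.

Lemma in_pi1 c : c ∈ pi1 R X T x <-> exists l, is_loop R X T x l /\ c = loop_class R X T x l.
Proof.
apply: (@setofE M (fun c => exists l, is_loop R X T x l /\ c = loop_class R X T x l)).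
apply: (sub_set_ex hZF (A := pow (funs I X))) => [_ [l [[hl _] ->]]|].
  rewrite in_pow // => l'; rewrite in_loop_class // in_funs //.
  by move=> [[]].
apply: (definable_iff (P := fun e => exists l, loopD l /\
    forall l', l' ∈ e 0 <-> loopD l' /\ homD l l')) => [e|].
  have K l : is_loop R X T x l -> e 0%N = loop_class R X T x l <->
      forall l', l' ∈ e 0%N <-> loopD l' /\ homD l l'.
    move=> ll; split=> [-> l'|H].
      rewrite in_loop_class; last exact: ll.1.
      by rewrite loopDE; split=> -[lD H]; split=> //; apply/(homDE ll.1 lD.1).
    apply: (set_ext hZF) => l'; rewrite H in_loop_class; last exact: ll.1.
    by rewrite loopDE; split=> -[lD ?]; split=> //; apply/(homDE ll.1 lD.1).
  by split=> -[l [ll H]]; exists l; have := ll; rewrite -loopDE => il;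
    split=> //; apply/(K l il).
rewrite /loopD /homD /path_open /square_open /is_fun /rlt; definability.
Qed.

End Loops.

(** * Homotopy is an equivalence relation compatible with concatenation *)

Section Homotopies.
Variables (M : structure) (hZF : ZF M) (R : real_data M) (hR : is_reals R).
Variables (F : realFieldType) (v : F -> M) (rc : real_coding R v).
Variables X T x : M.
Local Notation I := (unitI R).
Local Notation tadd s t := (app (radd_set R) (opair s t)).
Local Notation tmul s t := (app (rmul_set R) (opair s t)).
Local Notation loop := (is_loop R X T x).
Local Notation hom := (homotopic R X T x).
Local Notation tcont := (@top_cont F M T).
Implicit Types (a b : F) (s l h U V W : M).

Let inIv a : inI a -> v a ∈ I. Proof. by move=> aI; apply/(v_inI hZF rc). Qed.
Let tadd_v := tadd_v hZF hR rc.
Let tmul_v := tmul_v hZF hR rc.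

Lemma is_loop_ap l a : loop l -> inI a -> ap l (v a) ∈ X.
Proof. by move=> [hl _] aI; apply: (ap_in hZF hl); apply: inIv. Qed.

(** A homotopy must be a set, hence come from a definable term on [M], while its continuity is
    checked over [F]. The constructions below therefore give a term of the model and compute its
    values at coded reals. *)
Lemma homotopic_intro l l' (t : M -> M -> M) :
  dterm (fun e => t (pfst (e 0%N)) (psnd (e 0%N))) ->
  tcont (fun a b => t (v a) (v b)) ->
  (forall a b, inI a -> inI b -> t (v a) (v b) ∈ X) ->
  (forall a, inI a -> [/\ t (v a) (v 0) = ap l (v a), t (v a) (v 1) = ap l' (v a),
     t (v 0) (v a) = x & t (v 1) (v a) = x]) ->
  hom l l'.
Proof.
move=> dt ct tX te; apply/(homotopicE hZF rc).
set h := lam (prod I I) (fun p => t (pfst p) (psnd p)).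
have hE a b : inI a -> inI b -> ap2 h (v a) (v b) = t (v a) (v b).
  move=> aI bI; rewrite /ap2 (ap_lam hZF dt) ?pfstE ?psndE //.
  by rewrite opair_in_prod //; split; apply: inIv.
have I0 := @inI0 F; have I1 := @inI1 F.
exists h; split.
- apply: (lam_fun hZF dt) => _ /(in_prod hZF) [s [sI [u [uI ->]]]].
  have /(in_unitI hZF rc) [a [aI ->]] := sI; have /(in_unitI hZF rc) [b [bI ->]] := uI.
  by rewrite pfstE // psndE //; apply: tX.
- by apply: top_cont_ext ct => a b aI bI; rewrite hE.
- by move=> a aI; rewrite !hE //; apply: te.
Qed.

Lemma homotopic_refl l : loop l -> hom l l.
Proof.
move=> ll; have /(is_loopE hZF rc) [hl [cl [l0 l1]]] := ll.
have aE a : inI a -> app l (v a) = ap l (v a).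
  by move=> aI; rewrite (ap_app hZF hl) //; apply: inIv.
apply: (homotopic_intro (t := fun s _ => app l s)); first by definability.
- by apply: top_cont_ext cl => a b aI _; rewrite aE.
- by move=> a b aI _; rewrite aE //; apply: is_loop_ap.
- by move=> a aI; rewrite !aE //; split; lra.
Qed.

Lemma homotopic_sym l l' : hom l l' -> hom l' l.
Proof.
move=> /(homotopicE hZF rc) [h [hh ch he]].
have negI b : inI b -> inI (1 - b) by move=> [? ?]; split; lra.
have aE a b : inI a -> inI b ->
    app h (opair (v a) (tadd (v 1) (tmul (v (-1)) (v b)))) = ap2 h (v a) (v (1 - b)).
  move=> aI bI; rewrite tmul_v tadd_v mulN1r (ap2_app hZF hh) //; apply: inIv => //.
  exact: negI.
apply: (homotopic_intro
  (t := fun s t => app h (opair s (tadd (v 1) (tmul (v (-1)) t))))); first by definability.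
- apply: (@top_cont_ext _ _ _ (fun a b => ap2 h (v a) (v (1 - b)))) => [a b aI bI|].
    by rewrite aE.
  apply: (top_cont_comp ch) => //; first exact: square_cont_fst.
    by apply: square_cont_opp; apply: square_cont_snd.
  by move=> a b _; apply: negI.
- move=> a b aI bI; rewrite aE //; apply: (ap_in hZF hh).
  by rewrite opair_in_prod //; split; apply: inIv => //; apply: negI.
- move=> a aI; have I0 := @inI0 F; have I1 := @inI1 F.
  rewrite !aE // subr0 subrr; have [? ? _ _] := he a aI.
  by have [_ _ ? ?] := he _ (negI a aI).
Qed.

Lemma homotopic_trans l1 l2 l3 : hom l1 l2 -> hom l2 l3 -> hom l1 l3.
Proof.
move=> /(homotopicE hZF rc) [h [hh ch he]] /(homotopicE hZF rc) [k [hk ck ke]].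
have I0 := @inI0 F; have I1 := @inI1 F.
(* Clamping keeps both times in the unit interval on the whole square, so each branch is continuous
   everywhere before the two are pasted. *)
pose p b := Num.min (2 * b + 0) 1; pose q b := Num.max (2 * b + -1) 0.
have pI b : inI b -> inI (p b).
  by move=> [? ?]; rewrite /p; case: (leP (2 * b + 0) 1) => ?; split; lra.
have qI b : inI b -> inI (q b).
  by move=> [? ?]; rewrite /q; case: (leP (2 * b + -1) 0) => ?; split; lra.
pose f a b := if b <= 1 / 2 then ap2 h (v a) (v (p b)) else ap2 k (v a) (v (q b)).
have cf : tcont f.
  apply: (top_cont_if (u := fun _ b => b)); first exact: square_cont_snd.
  - apply: (top_cont_comp ch) => //; first exact: square_cont_fst.
      apply: square_cont_min; apply: square_cont_affine; [lra|exact: square_cont_snd].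
    by move=> a b _; apply: pI.
  - apply: (top_cont_comp ck) => //; first exact: square_cont_fst.
      apply: square_cont_max; apply: square_cont_affine; [lra|exact: square_cont_snd].
    by move=> a b _; apply: qI.
  - move=> a b aI _ ->; have -> : p (1 / 2) = 1 by rewrite /p min_r //; lra.
    have -> : q (1 / 2) = 0 by rewrite /q max_r //; lra.
    by have [_ -> _ _] := he a aI; have [-> _ _ _] := ke a aI.
pose t s u := ite (rle R u (v (1 / 2))) (app h (opair s (tmul (v 2) u)))
                  (app k (opair s (tadd (tmul (v 2) u) (v (-1))))).
have tE a b : inI a -> inI b -> t (v a) (v b) = f a b.
  move=> aI bI; have [b0 b1] := bI; rewrite /t /f !tmul_v tadd_v.
  case: (leP b (1 / 2)) => bh.
    rewrite ite_true //; last exact/(rc_le rc).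
    have -> : p b = 2 * b by rewrite /p addr0 min_l //; lra.
    by rewrite -(ap2_app hZF hh) //; apply: inIv => //; split; lra.
  rewrite ite_false //; last by rewrite (rc_le rc) => ?; lra.
  have -> : q b = 2 * b + -1 by rewrite /q max_l //; lra.
  by rewrite -(ap2_app hZF hk) //; apply: inIv => //; split; lra.
have fX a b : inI a -> inI b -> f a b ∈ X.
  move=> aI bI; rewrite /f; case: ifP => _;
    [apply: (ap_in hZF hh)|apply: (ap_in hZF hk)]; rewrite opair_in_prod //;
    split; apply: inIv => //; [exact: pI|exact: qI].
apply: (homotopic_intro (t := t)); first by rewrite /t /rle /rlt; definability.
- by apply: top_cont_ext cf => a b aI bI; rewrite tE.
- by move=> a b aI bI; rewrite tE //; apply: fX.
- move=> a aI; rewrite !tE // /f.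
  have -> : (0 : F) <= 1 / 2 by lra.
  have /negbTE -> : ~~ ((1 : F) <= 1 / 2) by rewrite -ltNge; lra.
  have -> : p 0 = 0 by rewrite /p min_l; lra.
  have -> : q 1 = 1 by rewrite /q max_l; lra.
  have [-> _ _ _] := he a aI; have [_ -> _ _] := ke a aI.
  have [_ _ H0 H1] := he _ (pI a aI); have [_ _ K0 K1] := ke _ (qI a aI).
  by split=> //; case: ifP.
Qed.

Lemma loop_class_eq l l' : loop l -> loop l' -> hom l l' ->
  loop_class R X T x l = loop_class R X T x l'.
Proof.
move=> ll ll' H; have hl := ll.1; have hl' := ll'.1; apply: (set_ext hZF) => k.
rewrite !(in_loop_class hZF rc) //.
split=> -[lk K]; split=> //; last exact: homotopic_trans K.
exact: homotopic_trans (homotopic_sym H) K.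
Qed.

Lemma concatP l l' : loop l -> loop l' -> is_fun (concat R l l') I X /\
  forall a, inI a -> ap (concat R l l') (v a) =
    if a <= 1 / 2 then ap l (v (2 * a)) else ap l' (v (2 * a + -1)).
Proof.
move=> ll ll'; have /(is_loopE hZF rc) [hl [_ [_ l1]]] := ll.
have /(is_loopE hZF rc) [hl' [_ [l'0 _]]] := ll'.
pose t u := ite (rle R u (v (1 / 2))) (app l (tmul (v 2) u))
                (app l' (tadd (tmul (v 2) u) (v (-1)))).
have dt : dterm (fun e => t (e 0%N)) by rewrite /t /rle /rlt; definability.
have tE a : inI a -> t (v a) = if a <= 1 / 2 then ap l (v (2 * a)) else ap l' (v (2 * a + -1)).
  move=> [a0 a1]; rewrite /t !tmul_v tadd_v; case: (leP a (1 / 2)) => ah.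
    rewrite ite_true //; last exact/(rc_le rc).
    by rewrite (ap_app hZF hl) //; apply: inIv; split; lra.
  rewrite ite_false //; last by rewrite (rc_le rc) leNgt ah.
  by rewrite (ap_app hZF hl') //; apply: inIv; split; lra.
have tf : is_fun (lam I t) I X.
  apply: (lam_fun hZF dt) => _ /(in_unitI hZF rc) [a [aI ->]].
  rewrite tE //; case: aI => ? ?; case: ifPn => [?|]; last rewrite -ltNge => ?;
    apply: is_loop_ap => //; split; lra.
have -> : concat R l l' = lam I t.
  apply: (lam_of_fun hZF tf) => _ /(in_unitI hZF rc) [a [aI ->]].
  rewrite (ap_lam hZF dt) ?tE //; last exact: inIv.
  cbv zeta; rewrite (rc_2 rc) (rc_1 rc) (rc_mul rc) (rc_sub rc); apply: esym; apply: theE.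
    by rewrite !(rc_le rc); case: ifPn => [ah|]; [left|rewrite -ltNge => ah; right];
      split=> //; lra.
  move=> z; rewrite !(rc_le rc) => -[[ah ->]|[ah ->]].
    by have -> : a <= 1 / 2 by lra.
  (* At the midpoint both clauses of [concat] apply; they agree because [l] ends where [l']
     begins. *)
  case: ifPn => // ah'; have -> : a = 1 / 2 by lra.
  have -> : 2 * (1 / 2) = 1 :> F by lra.
  by rewrite subrr l1 l'0.
by split=> // a aI; rewrite (ap_lam hZF dt) ?tE //; apply: inIv.
Qed.

Let dbl_min a : Num.min (2 * a + 0) 1 = if a <= 1 / 2 then 2 * a else 1.
Proof. by rewrite addr0; case: (leP a (1 / 2)) => ah; [rewrite min_l|rewrite min_r]; lra. Qed.

Let dbl_max a : Num.max (2 * a + -1) 0 = if a <= 1 / 2 then 0 else 2 * a + -1.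
Proof. by case: (leP a (1 / 2)) => ah; [rewrite max_r|rewrite max_l]; lra. Qed.

Lemma concat_cont (f g : F -> F -> M) : tcont f -> tcont g ->
  (forall b, inI b -> f 1 b = g 0 b) ->
  tcont (fun a b => if a <= 1 / 2 then f (2 * a) b else g (2 * a + -1) b).
Proof.
move=> cf cg fg.
apply: (@top_cont_ext _ _ _ (fun a b => if a <= 1 / 2 then f (Num.min (2 * a + 0) 1) b
    else g (Num.max (2 * a + -1) 0) b)) => [a b _ _|].
  by rewrite dbl_min dbl_max; case: (a <= 1 / 2).
apply: (top_cont_if (u := fun a _ => a)); first exact: square_cont_fst.
- apply: (top_cont_comp cf) => //.
  + apply: square_cont_min; apply: square_cont_affine; [lra|exact: square_cont_fst].
  + exact: square_cont_snd.
  + move=> a b [? ?] _; rewrite dbl_min; case: (leP a (1 / 2)) => ?; split; lra.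
- apply: (top_cont_comp cg) => //.
  + apply: square_cont_max; apply: square_cont_affine; [lra|exact: square_cont_fst].
  + exact: square_cont_snd.
  + move=> a b [? ?] _; rewrite dbl_max; case: (leP a (1 / 2)) => ?; split; lra.
- move=> a b _ bI ->; rewrite dbl_min dbl_max lexx.
  have -> : 2 * (1 / 2) = 1 :> F by lra.
  exact: fg.
Qed.

Lemma concat_loop l l' : loop l -> loop l' -> loop (concat R l l').
Proof.
move=> ll ll'; have [hc cE] := concatP ll ll'.
have /(is_loopE hZF rc) [hl [cl [l0 l1]]] := ll.
have /(is_loopE hZF rc) [hl' [cl' [l'0 l'1]]] := ll'.
apply/(is_loopE hZF rc); split=> //; split.
  apply: (@top_cont_ext _ _ _ (fun a _ => if a <= 1 / 2 then ap l (v (2 * a))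
    else ap l' (v (2 * a + -1)))) => [a b aI _|]; first by rewrite cE.
  by apply: (concat_cont cl cl') => b _; rewrite l1 l'0.
rewrite !cE; [|exact: inI1|exact: inI0].
have -> : (0 : F) <= 1 / 2 by lra.
have /negbTE -> : ~~ ((1 : F) <= 1 / 2) by rewrite -ltNge; lra.
have -> : 2 * 1 + -1 = 1 :> F by lra.
by rewrite mulr0.
Qed.

Lemma concat_homotopic l1 l2 l1' l2' : loop l1 -> loop l2 -> loop l1' -> loop l2' ->
  hom l1 l2 -> hom l1' l2' -> hom (concat R l1 l1') (concat R l2 l2').
Proof.
move=> ll1 ll2 ll1' ll2' /(homotopicE hZF rc) [h [hh ch he]].
move=> /(homotopicE hZF rc) [k [hk ck ke]].
have [_ c1] := concatP ll1 ll1'; have [_ c2] := concatP ll2 ll2'.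
have I0 := @inI0 F; have I1 := @inI1 F.
pose f a b := if a <= 1 / 2 then ap2 h (v (2 * a)) (v b) else ap2 k (v (2 * a + -1)) (v b).
have cf : tcont f.
  apply: (concat_cont ch ck) => b bI.
  by have [_ _ _ ->] := he b bI; have [_ _ -> _] := ke b bI.
pose t s u := ite (rle R s (v (1 / 2))) (app h (opair (tmul (v 2) s) u))
                  (app k (opair (tadd (tmul (v 2) s) (v (-1))) u)).
have lowI a : inI a -> a <= 1 / 2 -> inI (2 * a) by move=> [? ?] ?; split; lra.
have highI a : inI a -> (a <= 1 / 2) = false -> inI (2 * a + -1).
  by move=> [? ?] /negbT; rewrite -ltNge => ?; split; lra.
have tE a b : inI a -> inI b -> t (v a) (v b) = f a b.
  move=> aI bI; rewrite /t /f !tmul_v tadd_v; case: ifP => ah.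
    rewrite ite_true //; last exact/(rc_le rc).
    by rewrite -(ap2_app hZF hh) //; apply: inIv => //; apply: lowI.
  rewrite ite_false //; last by rewrite (rc_le rc) ah.
  by rewrite -(ap2_app hZF hk) //; apply: inIv => //; apply: highI.
apply: (homotopic_intro (t := t)); first by rewrite /t /rle /rlt; definability.
- by apply: top_cont_ext cf => a b aI bI; rewrite tE.
- move=> a b aI bI; rewrite tE // /f; case: ifP => ah;
    [apply: (ap_in hZF hh)|apply: (ap_in hZF hk)]; rewrite opair_in_prod //;
    split; apply: inIv => //; [exact: lowI|exact: highI].
- move=> a aI; rewrite !tE // c1 // c2 // /f.
  have -> : (0 : F) <= 1 / 2 by lra.
  have /negbTE -> : ~~ ((1 : F) <= 1 / 2) by rewrite -ltNge; lra.
  have -> : 2 * 1 + -1 = 1 :> F by lra.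
  rewrite mulr0; have [_ _ H0 _] := he a aI; have [_ _ _ K1] := ke a aI.
  split=> //; case: ifP => ah.
  + by have [] := he _ (lowI a aI ah).
  + by have [] := ke _ (highI a aI ah).
  + by have [] := he _ (lowI a aI ah).
  + by have [] := ke _ (highI a aI ah).
Qed.

(** The description in [pi1_mul] is unambiguous because concatenation respects homotopy of
    representatives. *)
Lemma pi1_mulE l l' : loop l -> loop l' ->
  pi1_mul R X T x (loop_class R X T x l) (loop_class R X T x l') =
  loop_class R X T x (concat R l l').
Proof.
move=> ll ll'; have incl := in_loop_class hZF rc.
have self k : loop k -> k ∈ loop_class R X T x k.
  by move=> lk; rewrite incl; [split=> //; apply: homotopic_refl|exact: lk.1].
apply: theE; first by exists l; split; [exact: self|exists l'; split=> //; exact: self].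
have hl := ll.1; have hl' := ll'.1; move=> z [k [+ [k' [+ ->]]]]; rewrite !incl //.
move=> [lk H] [lk' H']; apply: esym; apply: loop_class_eq; try exact: concat_loop.
exact: concat_homotopic.
Qed.

(** The segment from th(a) to a stays in the unit interval, and following [l] along it deforms [l']
    into [l]. The endpoints do not move since th fixes 0 and 1. *)
Lemma homotopic_reparam l l' (th : M -> M) (thF : F -> F) :
  loop l -> is_fun l' I X -> dterm (fun e => th (e 0%N)) ->
  (forall a, inI a -> th (v a) = v (thF a)) -> (forall a, inI a -> inI (thF a)) ->
  square_cont (fun a _ => thF a) -> thF 0 = 0 -> thF 1 = 1 ->
  (forall a, inI a -> ap l' (v a) = ap l (v (thF a))) ->
  loop l' /\ hom l' l.
Proof.
move=> ll hl' dth thE thI cth th0 th1 l'E.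
have /(is_loopE hZF rc) [hl [cl [l0 l1]]] := ll.
have I0 := @inI0 F; have I1 := @inI1 F.
pose g a b := (1 - b) * thF a + b * a.
have gI a b : inI a -> inI b -> inI (g a b).
  move=> aI [b0 b1]; have [t0 t1] := thI a aI; case: aI => a0 a1; rewrite /g; split; nra.
split.
  apply/(is_loopE hZF rc); split=> //; split; last by rewrite !l'E // th0 th1.
  apply: (@top_cont_ext _ _ _ (fun a b => ap l (v (thF a)))) => [a b aI _|].
    by rewrite l'E.
  apply: (top_cont_comp (f := fun a _ => ap l (v a)) (q := fun _ b => b) cl) => //.
    exact: square_cont_snd.
  by move=> a b aI _; apply: thI.
pose t s u := app l (tadd (tmul (tadd (v 1) (tmul (v (-1)) u)) (th s)) (tmul u s)).
have tE a b : inI a -> inI b -> t (v a) (v b) = ap l (v (g a b)).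
  move=> aI bI; rewrite /t thE // !(tmul_v, tadd_v) mulN1r -(ap_app hZF hl) //.
  exact/inIv/gI.
apply: (homotopic_intro (t := t)).
- have d1 : dterm (fun e => th (pfst (e 0%N))).
    by apply: (dterm_comp dth); definability.
  by rewrite /t; definability.
- apply: (@top_cont_ext _ _ _ (fun a b => ap l (v (g a b)))) => [a b aI bI|].
    by rewrite tE.
  apply: (top_cont_comp (f := fun a _ => ap l (v a)) (q := fun _ b => b) cl) => //.
    exact: square_cont_convex.
  exact: square_cont_snd.
- by move=> a b aI bI; rewrite tE //; apply: is_loop_ap => //; apply: gI.
- move=> a aI; rewrite !tE // /g th0 th1 l'E //.
  have -> : (1 - 0) * thF a + 0 * a = thF a by ring.
  have -> : (1 - 1) * thF a + 1 * a = a by ring.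
  have -> : (1 - a) * 0 + a * 0 = 0 by ring.
  by have -> : (1 - a) * 1 + a * 1 = 1 by ring.
Qed.

End Homotopies.

(** * Infinite concatenations *)

Section LoopPower.
Variables (M : structure) (hZF : ZF M) (R : real_data M) (hR : is_reals R).
Variables (F : realFieldType) (v : F -> M) (rc : real_coding R v).
Local Notation I := (unitI R).
Local Notation tadd s t := (app (radd_set R) (opair s t)).
Local Notation tmul s t := (app (rmul_set R) (opair s t)).
Implicit Types (a b : F) (k m n s t h U V W : M).

Let inIv a : inI a -> v a ∈ I. Proof. by move=> aI; apply/(v_inI hZF rc). Qed.
Let tadd_v := tadd_v hZF hR rc.
Let tmul_v := tmul_v hZF hR rc.

(** One sequence in two guises: [p] is a set of the model and may occur in formulas, [P] has values
    in [F] and serves for computation. *)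
Definition powers_of_two (p : M) (P : M -> F) : Prop :=
  [/\ forall n, n ∈ omega -> app p n = v (P n), forall n, n ∈ omega -> pow2 R n = v (P n),
      P zero = 1 & forall n, n ∈ omega -> P (succ n) = 2 * P n].

Lemma powers_of_two_exist : exists p P, powers_of_two p P.
Proof.
have ds : dterm (fun e => tmul (v 2) (e 0%N)) by definability.
have hs : is_fun (lam (rset R) (fun y => tmul (v 2) y)) (rset R) (rset R).
  by apply: (lam_fun hZF ds) => _ /(rc_surj rc) [a ->]; rewrite tmul_v; apply: v_in.
have [p [hp [p0 pS]]] := recursion hZF (v_in rc 1) hs.
have {}pS n : n ∈ omega -> ap p (succ n) = tmul (v 2) (ap p n).
  by move=> no; rewrite pS // (ap_lam hZF ds) //; apply: (ap_in hZF hp).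
have exP n : exists a, n ∈ omega -> ap p n = v a.
  case: (EM (n ∈ omega)) => [no|]; last by exists 0.
  by have /(rc_surj rc) [a E] := ap_in hZF hp no; exists a.
pose P n := sval (cid (exP n)).
have hP n : n ∈ omega -> ap p n = v (P n) := svalP (cid (exP n)).
have pn n : n ∈ omega -> pow2 R n = ap p n.
  move=> no; apply: theE.
    exists p; rewrite (rc_1 rc); split=> //; split=> //; split=> // k ko.
    by rewrite pS // hP // tmul_v (rc_2 rc) (rc_mul rc).
  move=> y [p' [hp' [p'0 [p'S ->]]]].
  suff H : ∀ k ∈ omega, app p' k = app p k.
    by rewrite (ap_app hZF hp') // (ap_app hZF hp) // H.
  apply: (omega_ind hZF); first by definability.
    have zo := zero_omega hZF.
    by rewrite -(ap_app hZF hp') // -(ap_app hZF hp) // p0 p'0 (rc_1 rc).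
  move=> k ko E; have ko' := succ_omega hZF ko.
  rewrite -(ap_app hZF hp') // -(ap_app hZF hp) // p'S // pS //.
  by rewrite (ap_app hZF hp') // E -(ap_app hZF hp) // hP // tmul_v (rc_2 rc) (rc_mul rc).
exists p, P; split=> [n no|n no||n no].
- by rewrite -(ap_app hZF hp) // hP.
- by rewrite pn // hP.
- by apply: (rc_inj rc); rewrite -hP //; apply: zero_omega.
- apply: (rc_inj rc); rewrite -hP; last exact: succ_omega.
  by rewrite pS // hP // tmul_v.
Qed.

Variables (p : M) (P : M -> F).
Hypothesis hP : powers_of_two p P.

Let pE n : n ∈ omega -> app p n = v (P n). Proof. by case: hP => H _ _ _; apply: H. Qed.
Let PS n : n ∈ omega -> P (succ n) = 2 * P n. Proof. by case: hP => _ _ _; apply. Qed.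

Lemma pow_gt0 n : n ∈ omega -> 0 < P n.
Proof.
(* Induction along the omega of the model needs a definable statement, so [P] is traded for [p]
   first. *)
move=> no; apply/(rc_lt rc); rewrite -pE //; move: n no.
apply: (omega_ind hZF); first by rewrite /rlt; definability.
  by rewrite pE ?(rc_lt rc) //; [case: hP => _ _ -> _; lra|apply: zero_omega].
move=> n no; have no' := succ_omega hZF no.
by rewrite !pE // !(rc_lt rc) PS // => ?; lra.
Qed.

Lemma pow_le n m : n ∈ omega -> m ∈ omega -> nle n m -> P n <= P m.
Proof.
move=> no mo nm; apply/(rc_le rc); rewrite -!pE //; move: m mo nm.
apply: (omega_ind hZF); first by rewrite /rle /rlt; definability.
  by case=> [/(in_empty hZF)|->] //; right.
move=> m mo IH; have mo' := succ_omega hZF mo.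
case=> [|->]; last by right.
move/(in_succ hZF)/IH; rewrite !pE // !(rc_le rc) PS // => ?.
by have := pow_gt0 mo; lra.
Qed.

(** If b were the least upper bound of the powers, then 2 P n <= b for all n would make b / 2 an
    upper bound as well. *)
Lemma pow_unbounded a : ∃ n ∈ omega, a < P n.
Proof.
apply: contrapT => H.
have le_a n : n ∈ omega -> P n <= a.
  by move=> no; rewrite leNgt; apply/negP => lt; apply: H; exists n.
have [S hS] := @separation _ hZF (fun y => ∃ n ∈ omega, y = app p n) (rset R)
  ltac:(by definability).
have inS n : n ∈ omega -> v (P n) ∈ S.
  by move=> no; rewrite hS; split; [apply: v_in|exists n; rewrite pE].
have zo := zero_omega hZF.
have [| | |_ [/(rc_surj rc) [b ->] [ub lub]]] := re_complete hR (S := S).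
- by move=> y; rewrite hS => -[].
- by exists (v (P zero)); apply: inS.
- exists (v a); split; first exact: v_in.
  by move=> _ /hS [_ [n [no ->]]]; rewrite pE // (rc_le rc); apply: le_a.
have {}ub n : n ∈ omega -> P n <= b by move=> no; apply/(rc_le rc)/ub/inS.
have /(rc_le rc) : rle R (v b) (v (b / 2)).
  apply: lub; first exact: v_in.
  move=> _ /hS [_ [n [no ->]]]; rewrite pE // (rc_le rc).
  by have := ub _ (succ_omega hZF no); rewrite PS // => ?; lra.
by have := ub _ zo; case: hP => _ _ -> _ *; lra.
Qed.

(* 1 - 2^-n <= a <= 1 - 2^-(n+1), freed of divisions *)
Definition level n a : Prop := P n * (1 - a) <= 1 /\ 1 <= P (succ n) * (1 - a).

Lemma level_exists a : 0 <= a -> a < 1 -> ∃ n ∈ omega, level n a.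
Proof.
move=> a0 a1; have u0 : 0 < 1 - a by lra.
have small n : n ∈ omega -> 1 < P n * (1 - a) <->
    rlt R (v 1) (tmul (app p n) (v (1 - a))).
  by move=> no; rewrite pE // tmul_v (rc_lt rc).
have [||n [no [/(small _ no) nP least]]] :=
  @omega_least _ hZF (fun n => rlt R (v 1) (tmul (app p n) (v (1 - a)))).
- by rewrite /rlt; definability.
- have [n [no lt]] := pow_unbounded (1 / (1 - a)); exists n; split=> //.
  by apply/small => //; rewrite -ltr_pdivrMr.
(* The least n with 2^n (1 - a) > 1 is positive because 1 - a <= 1, and its predecessor is a level
   of a. *)
have [E|[k [ko E]]] := omega_cases hZF no; subst n.
  by move: nP; case: hP => _ _ -> _ *; lra.
exists k; split=> //; split; last exact: ltW.
rewrite leNgt; apply/negP => /small => /(_ ko); apply: least; exact: mem_succ.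
Qed.

Variables (X T x : M) (hx : x ∈ X).
Variable l : M.
Hypothesis hl : loop_sequence R X T x l.
Local Notation lp sigma := (loop_power R x l sigma).
Local Notation loop := (is_loop R X T x).
Local Notation class := (loop_class R X T x).

Definition slot_value sigma n b : M :=
  ap (pow01 (const_loop R x) (ap l n) (ap sigma n)) (v b).

Let ln_loop n : n ∈ omega -> loop (ap l n).
Proof. by case: hl => _; apply. Qed.

Let x_const b : inI b -> ap (const_loop R x) (v b) = x.
Proof. by move=> bI; apply: (ap_lam hZF (dterm_const x)); apply: inIv. Qed.

Lemma slot_value_zero sigma n b : inI b -> ap sigma n = zero -> slot_value sigma n b = x.
Proof. by move=> bI E; rewrite /slot_value E pow01_zero // x_const. Qed.

Lemma slot_value_one sigma n b : ap sigma n = one -> slot_value sigma n b = ap (ap l n) (v b).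
Proof. by move=> E; rewrite /slot_value E pow01_one. Qed.

Lemma slot_value_end sigma n b : sigma ∈ cantor -> n ∈ omega -> b = 0 \/ b = 1 ->
  slot_value sigma n b = x.
Proof.
move=> sc no b01; have bI : inI b by case: b01 => ->; split; lra.
case: (cantor_cases hZF sc no) => E; first exact: slot_value_zero.
have /(is_loopE hZF rc) [_ [_ [l0 l1]]] := ln_loop no.
by rewrite slot_value_one //; case: b01 => ->.
Qed.

Lemma slot_value_in sigma n b : sigma ∈ cantor -> n ∈ omega -> inI b ->
  slot_value sigma n b ∈ X.
Proof.
move=> sc no bI; case: (cantor_cases hZF sc no) => E; first by rewrite slot_value_zero.
by rewrite slot_value_one //; apply: (is_loop_ap hZF rc (ln_loop no)).
Qed.

Definition arg n a : F := P (succ n) * (a - 1) + 2.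

Lemma argE n a : n ∈ omega -> arg n a = 2 - P (succ n) * (1 - a).
Proof. by move=> no; rewrite /arg; ring. Qed.

Lemma level_arg n a : n ∈ omega -> level n a -> inI (arg n a).
Proof.
move=> no; rewrite argE // /level PS // -mulrA => -[H1 H2]; split; lra.
Qed.

Definition power_rel sigma a y : Prop :=
  (a = 1 /\ y = x) \/ ∃ n ∈ omega, level n a /\ y = slot_value sigma n (arg n a).

Lemma level_lt1 n a : level n a -> inI a -> a < 1.
Proof.
move=> [_ H] [_ a1]; rewrite lt_neqAle a1 andbT; apply/eqP => E.
by move: H; rewrite E subrr mulr0; lra.
Qed.

(** Slots n < m can share only the point that ends the first and starts the second, and both loops
    are at x there. *)
Lemma slot_value_overlap sigma n m a : sigma ∈ cantor -> inI a -> n ∈ omega -> m ∈ omega ->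
  level n a -> level m a -> n ∈ m ->
  slot_value sigma n (arg n a) = x /\ slot_value sigma m (arg m a) = x.
Proof.
move=> sc aI no mo ln lm nm; have a1 := level_lt1 ln aI.
have le : P (succ n) <= P m by apply: pow_le => //; [apply: succ_omega|apply: succ_nle].
have le' : P (succ n) * (1 - a) <= P m * (1 - a) by apply: ler_wpM2r => //; lra.
case: ln lm => _ H1 [H2 _].
split; apply: slot_value_end => //; rewrite argE //; first by right; lra.
by left; rewrite PS // -mulrA; lra.
Qed.

Lemma power_rel_unique sigma a y z : sigma ∈ cantor -> inI a ->
  power_rel sigma a y -> power_rel sigma a z -> y = z.
Proof.
have no1 n : inI a -> level n a -> a <> 1.
  by move=> aI /level_lt1 /(_ aI) H E; move: H; rewrite E ltxx.
move=> sc aI [[a1 ->]|[n [no [ln ->]]]] [[a1' ->]|[m [mo [lm ->]]]] //.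
- by case: (no1 m aI lm).
- by case: (no1 n aI ln).
case: (omega_lt_or_le hZF no mo) => [nm|[mn|-> //]].
  by have [-> ->] := slot_value_overlap sc aI no mo ln lm nm.
by have [-> ->] := slot_value_overlap sc aI mo no lm ln mn.
Qed.

Lemma power_rel_exists sigma a : sigma ∈ cantor -> inI a ->
  exists y, y ∈ X /\ power_rel sigma a y.
Proof.
move=> sc [a0 a1]; case: (eqVneq a 1) => [E|ne]; first by exists x; split=> //; left.
have [|n [no ln]] := level_exists a0; first by rewrite lt_neqAle ne.
exists (slot_value sigma n (arg n a)); split; last by right; exists n.
by apply: slot_value_in => //; apply: level_arg.
Qed.

(** The definable twin of [power_rel]; multiplying by the powers of two avoids division. *)
Let relD sigma s y := (s = v 1 /\ y = x) \/ ∃ n ∈ omega,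
  rle R (tmul (app p n) (tadd (v 1) (tmul (v (-1)) s))) (v 1) /\
  rle R (v 1) (tmul (app p (succ n)) (tadd (v 1) (tmul (v (-1)) s))) /\
  y = ite (app sigma n = zero) x
        (app (app l n) (tadd (tmul (app p (succ n)) (tadd s (v (-1)))) (v 2))).

Let relDE sigma a y : sigma ∈ cantor -> inI a -> relD sigma (v a) y <-> power_rel sigma a y.
Proof.
move=> sc aI; have hs := (in_cantor hZF sigma).1 sc.
have lE n : n ∈ omega -> level n a <->
    rle R (tmul (app p n) (tadd (v 1) (tmul (v (-1)) (v a)))) (v 1) /\
    rle R (v 1) (tmul (app p (succ n)) (tadd (v 1) (tmul (v (-1)) (v a)))).
  move=> no; rewrite !pE //; last exact: succ_omega.
  by rewrite !(tmul_v, tadd_v) !(rc_le rc) mulN1r.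
have vE n : n ∈ omega -> level n a -> slot_value sigma n (arg n a) =
    ite (app sigma n = zero) x
      (app (app l n) (tadd (tmul (app p (succ n)) (tadd (v a) (v (-1)))) (v 2))).
  move=> no /(level_arg no) bI; rewrite pE //; last exact: succ_omega.
  rewrite !(tmul_v, tadd_v) -/(arg n a) -(ap_app hZF hs) //.
  case: (cantor_cases hZF sc no) => E; first by rewrite ite_true // slot_value_zero.
  rewrite E ite_false //; last exact: one_neq_zero.
  rewrite slot_value_one // -(ap_app hZF hl.1) //.
  by apply: (ap_app hZF (ln_loop no).1); apply: inIv.
rewrite /relD /power_rel; split=> -[[E ->]|[n [no H]]].
- by left; split=> //; apply: (rc_inj rc).
- right; exists n; split=> //; case: H => [H1 [H2 ->]].
  have ln : level n a by apply/lE.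
  by split=> //; rewrite vE.
- by left; rewrite E.
- right; exists n; split=> //; case: H => [ln ->].
  by have [H1 H2] := (lE n no).1 ln; rewrite vE.
Qed.

(** The relation [relD] yields a function of the model because neighbouring slots match, and
    [lam_of_fun] identifies that function with [lp sigma]. *)
Lemma loop_powerP sigma : sigma ∈ cantor -> is_fun (lp sigma) I X /\
  forall a, inI a -> power_rel sigma a (ap (lp sigma) (v a)).
Proof.
move=> sc; have hs := (in_cantor hZF sigma).1 sc.
have [f [hf fP]] : exists f, is_fun f I X /\ ∀ s ∈ I, relD sigma s (ap f s).
  apply: (@fun_of_relation _ hZF I X (fun s y => relD sigma s y)).
    by rewrite /relD /rle /rlt; definability.
  move=> _ /(in_unitI hZF rc) [a [aI ->]].
  have [y [yX Py]] := power_rel_exists sc aI; exists y; split.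
    by split=> //; apply/relDE.
  by move=> z [_ /(relDE _ sc aI) Pz]; apply: power_rel_unique Py Pz.
have {}fP a : inI a -> power_rel sigma a (ap f (v a)).
  by move=> aI; apply/relDE => //; apply: fP; apply: inIv.
suff -> : lp sigma = f by [].
apply: (lam_of_fun hZF hf) => _ /(in_unitI hZF rc) [a [aI ->]].
have orig y : ((v a = r1 R /\ y = x) \/ ∃ n ∈ omega,
      rle R (rsub R (r1 R) (rdiv R (r1 R) (pow2 R n))) (v a) /\
      rle R (v a) (rsub R (r1 R) (rdiv R (r1 R) (pow2 R (succ n)))) /\
      y = ap (pow01 (const_loop R x) (ap l n) (ap sigma n))
             (radd R (rmul R (pow2 R (succ n)) (rsub R (v a) (r1 R))) (r2 R))) <->
    power_rel sigma a y.
  have pow2E n : n ∈ omega -> pow2 R n = v (P n) by case: hP => _ H _ _; apply: H.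
  have qE n : n ∈ omega -> rsub R (r1 R) (rdiv R (r1 R) (pow2 R n)) = v (1 - 1 / P n).
    move=> no; rewrite pow2E // (rc_1 rc) (rc_div rc) ?(rc_sub rc) //.
    by rewrite gt_eqF // pow_gt0.
  have lE n : n ∈ omega -> level n a <-> 1 - 1 / P n <= a /\ a <= 1 - 1 / P (succ n).
    move=> no; have Pn := pow_gt0 no; have PSn := pow_gt0 (succ_omega hZF no).
    have E1 : (P n * (1 - a) <= 1) = (1 - a <= 1 / P n) by rewrite ler_pdivlMr // mulrC.
    have E2 : (1 <= P (succ n) * (1 - a)) = (1 / P (succ n) <= 1 - a).
      by rewrite ler_pdivrMr // mulrC.
    by rewrite /level E1 E2; split=> -[? ?]; split; lra.
  split=> -[[E ->]|[n [no H]]].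
  - by left; split=> //; apply: (rc_inj rc); rewrite E (rc_1 rc).
  - right; exists n; split=> //; have no' := succ_omega hZF no.
    move: H; rewrite !qE // !(rc_le rc) => -[H1 [H2 ->]].
    split; first by apply/lE.
    by rewrite pow2E // (rc_1 rc) (rc_2 rc) (rc_sub rc) (rc_mul rc) (rc_add rc).
  - by left; rewrite E (rc_1 rc).
  - right; exists n; split=> //; have no' := succ_omega hZF no.
    case: H => /(lE n no) [H1 H2] ->; rewrite !qE // !(rc_le rc); split=> //; split=> //.
    by rewrite pow2E // (rc_1 rc) (rc_2 rc) (rc_sub rc) (rc_mul rc) (rc_add rc).
apply: esym; apply: theE; first by apply/orig; apply: fP.
by move=> z /orig Pz; apply: (power_rel_unique sc aI Pz); apply: fP.
Qed.

Lemma loop_power_at sigma a y : sigma ∈ cantor -> inI a -> power_rel sigma a y ->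
  ap (lp sigma) (v a) = y.
Proof.
by move=> sc aI; apply: (power_rel_unique sc aI); have [_] := loop_powerP sc; apply.
Qed.

Lemma loop_power_1 sigma : sigma ∈ cantor -> ap (lp sigma) (v 1) = x.
Proof. by move=> sc; apply: loop_power_at => //; left. Qed.

(* Membership of its class in the fundamental group already makes [lp sigma] a loop:
   it is the restriction of a homotopy to one side of the square. *)
Lemma loop_power_loop sigma : sigma ∈ cantor -> class (lp sigma) ∈ pi1 R X T x ->
  loop (lp sigma).
Proof.
move=> sc; have [hf _] := loop_powerP sc; rewrite (in_pi1 hZF rc) => -[l0 [ll0 E]].
have : l0 ∈ class (lp sigma).
  rewrite E (in_loop_class hZF rc); last exact: ll0.1.
  by split=> //; apply: (homotopic_refl hZF rc).
rewrite (in_loop_class hZF rc) // => -[_ /(homotopicE hZF rc) [h [hh ch he]]].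
have I0 := @inI0 F.
apply/(is_loopE hZF rc); split=> //; split; last first.
  split; last exact: loop_power_1.
  by have [<- _ + _] := he 0 I0.
apply: (@top_cont_ext _ _ _ (fun a _ => ap2 h (v a) (v 0))) => [a b aI _|].
  by have [] := he a aI.
by apply: (top_cont_comp (q := fun _ _ => 0) ch) => //;
  [exact: square_cont_fst|move=> a b _ _ e e0; exists e => // *; split; lra].
Qed.

(** * Cutting an infinite concatenation into two factors *)

Section Split.
Variables (n s1 s2 s : M).
Hypothesis no : n ∈ omega.
Hypothesis below : forall k, k ∈ omega -> k ∈ n -> (k ∈ s1 <-> k ∈ s) /\ ~ k ∈ s2.
Hypothesis above : forall k, k ∈ omega -> ~ k ∈ n -> ~ k ∈ s1 /\ (k ∈ s2 <-> k ∈ s).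

Let slot_eq t t' k b : k ∈ omega -> (k ∈ t <-> k ∈ t') ->
  slot_value (chi t) k b = slot_value (chi t') k b.
Proof.
move=> ko tt; rewrite /slot_value; congr (ap (pow01 _ _ _) _).
case: (EM (k ∈ t)) => kt; first by rewrite !ap_chi_in //; apply/tt.
by rewrite !ap_chi_notin // => /tt.
Qed.

Let c t := chi_cantor hZF t.

Let at_level t k a : inI a -> k ∈ omega -> level k a ->
  ap (lp (chi t)) (v a) = slot_value (chi t) k (arg k a).
Proof. by move=> aI ko lk; apply: loop_power_at => //; right; exists k. Qed.

Lemma split_below a : inI a -> 1 <= P n * (1 - a) ->
  ap (lp (chi s1)) (v a) = ap (lp (chi s)) (v a) /\ ap (lp (chi s2)) (v a) = x.
Proof.
move=> aI le; have a1 : a < 1.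
  rewrite lt_neqAle (proj2 aI) andbT; apply/eqP => E; move: le.
  by rewrite E subrr mulr0; lra.
have [k [ko lk]] := level_exists (proj1 aI) a1; rewrite !(at_level _ aI ko lk).
have [H1 H2] := lk; have bI := level_arg ko lk.
case: (omega_lt_or_le hZF ko no) => [kn|nk].
  have [e1 n2] := below ko kn; split; first exact: slot_eq.
  by rewrite slot_value_zero // ap_chi_notin.
(* A level k >= n is possible here only at the start of slot k, where all the loops are at x. *)
have Pk : P n * (1 - a) <= P k * (1 - a).
  by apply: ler_wpM2r; [lra|apply: pow_le].
by rewrite !slot_value_end //; left; rewrite argE // PS // -mulrA; lra.
Qed.

Lemma split_above a : inI a -> P n * (1 - a) <= 1 ->
  ap (lp (chi s1)) (v a) = x /\ ap (lp (chi s2)) (v a) = ap (lp (chi s)) (v a).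
Proof.
move=> aI le; case: (eqVneq a 1) => [->|ne]; first by rewrite !loop_power_1.
have a1 : a < 1 by rewrite lt_neqAle ne (proj2 aI).
have [k [ko lk]] := level_exists (proj1 aI) a1; rewrite !(at_level _ aI ko lk).
have [H1 H2] := lk; have bI := level_arg ko lk.
case: (EM (k ∈ n)) => kn; last first.
  have [n1 e2] := above ko kn; split; last exact: slot_eq.
  by rewrite slot_value_zero // ap_chi_notin.
have Pk : P (succ k) * (1 - a) <= P n * (1 - a).
  by apply: ler_wpM2r; [lra|apply: pow_le => //; [apply: succ_omega|apply: succ_nle]].
by rewrite !slot_value_end //; right; rewrite argE //; lra.
Qed.

(** Let q = 1 - 2^-n. The loop of s1 follows that of s up to q and then rests at x; the loop of s2
    rests until q and then follows it. Their concatenation is therefore the loop of s run with time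
    min(2a, q) on the first half and max(2a - 1, q) on the second. *)
Lemma loop_class_split : loop (lp (chi s1)) -> loop (lp (chi s2)) -> loop (lp (chi s)) ->
  class (lp (chi s)) = pi1_mul R X T x (class (lp (chi s1))) (class (lp (chi s2))).
Proof.
move=> L1 L2 L; rewrite (pi1_mulE hZF hR rc) //.
have [hcat catE] := concatP hZF hR rc L1 L2.
have Pn := pow_gt0 no.
have P1 : 1 <= P n.
  have := pow_le (zero_omega hZF) no (zero_nle hZF no).
  by case: hP => _ _ -> _.
pose q : F := 1 - 1 / P n.
have invP : 0 < 1 / P n <= 1.
  by rewrite divr_gt0 //= ler_pdivrMr // mul1r.
have [q0 q1] : 0 <= q /\ q < 1 by rewrite /q; split; lra.
have qI : inI q by split; lra.
have leq_q a : (a <= q) = (1 <= P n * (1 - a)).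
  rewrite [P n * _]mulrC -ler_pdivrMr // /q; apply/idP/idP => ?; lra.
have geq_q a : (q <= a) = (P n * (1 - a) <= 1).
  rewrite [P n * _]mulrC -ler_pdivlMr // /q; apply/idP/idP => ?; lra.
have [E1 _] := split_below qI (etrans (esym (leq_q q)) (lexx q)).
have [E2 _] := split_above qI (etrans (esym (geq_q q)) (lexx q)).
have sq : ap (lp (chi s)) (v q) = x by rewrite -E1.
pose thF a := if a <= 1 / 2 then Num.min (2 * a + 0) q else Num.max (2 * a + -1) q.
pose th u := ite (rle R u (v (1 / 2)))
  (ite (rle R (tmul (v 2) u) (v q)) (tmul (v 2) u) (v q))
  (ite (rle R (tadd (tmul (v 2) u) (v (-1))) (v q)) (v q) (tadd (tmul (v 2) u) (v (-1)))).
have thE a : inI a -> th (v a) = v (thF a).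
  move=> aI; rewrite /th /thF !(tmul_v, tadd_v) !(ite_bool hZF _ _ (rc_le rc _ _)) addr0.
  by rewrite minEle maxEle; case: (a <= 1 / 2); case: ifP.
have thI a : inI a -> inI (thF a).
  move=> [a0 a1]; rewrite /thF; case: (leP a (1 / 2)) => ah.
    by case: (leP (2 * a + 0) q) => ?; split; lra.
  by case: (leP (2 * a + -1) q) => ?; split; lra.
have [] // := homotopic_reparam hZF hR rc (th := th) (thF := thF) L hcat.
- by rewrite /th /rle /rlt; definability.
- apply: (square_cont_if (u := fun a _ => a)); first exact: square_cont_fst.
  + apply: square_cont_min; apply: square_cont_affine; [lra|exact: square_cont_fst].
  + apply: square_cont_max; apply: square_cont_affine; [lra|exact: square_cont_fst].
  + by move=> a b _ _ ->; rewrite min_r ?max_r //; lra.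
- rewrite /thF; have -> : (0 : F) <= 1 / 2 by lra.
  by rewrite min_l; lra.
- rewrite /thF; have /negbTE -> : ~~ ((1 : F) <= 1 / 2) by rewrite -ltNge; lra.
  by rewrite max_l; lra.
- move=> a [a0 a1]; rewrite catE; last by [].
  rewrite /thF; case: (leP a (1 / 2)) => ah.
    have aI : inI (2 * a) by split; lra.
    rewrite addr0; case: (leP (2 * a) q) => aq.
      by have [-> _] := split_below aI (etrans (esym (leq_q _)) aq).
    by have [-> _] := split_above aI (etrans (esym (geq_q _)) (ltW aq)).
  have aI : inI (2 * a + -1) by split; lra.
  case: (leP (2 * a + -1) q) => aq.
    by have [_ ->] := split_below aI (etrans (esym (leq_q _)) aq).
  by have [_ ->] := split_above aI (etrans (esym (geq_q _)) (ltW aq)).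
move=> Lc H; apply: (loop_class_eq hZF hR rc) => //.
exact: (homotopic_sym hZF hR rc).
Qed.

End Split.

(** The infinite concatenation runs through the n-th loop on slot n and rests elsewhere. It is that
    loop reparametrized by the local parameter Q a + (2 - Q) of the slot, clamped to the unit
    interval. *)
Lemma loop_class_single n : n ∈ omega ->
  class (lp (chi (upair n n))) = class (ap l n).
Proof.
move=> no; have sc := chi_cantor hZF (upair n n); have [hf fP] := loop_powerP sc.
have Ln := ln_loop no; have /(is_loopE hZF rc) [_ [_ [l0 l1]]] := Ln.
have no' := succ_omega hZF no; have Pn := pow_gt0 no; have PSn := PS no.
have P1 : 1 <= P n.
  have := pow_le (zero_omega hZF) no (zero_nle hZF no).
  by case: hP => _ _ -> _.
set Q := P (succ n) in PSn.
pose thF a := Num.min (Num.max (Q * a + (2 - Q)) 0) 1.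
pose th u := ite (rle R (tadd (tmul (v Q) u) (v (2 - Q))) (v 0)) (v 0)
  (ite (rle R (tadd (tmul (v Q) u) (v (2 - Q))) (v 1)) (tadd (tmul (v Q) u) (v (2 - Q))) (v 1)).
have thE a : inI a -> th (v a) = v (thF a).
  move=> aI; rewrite /th /thF !(tmul_v, tadd_v) !(ite_bool hZF _ _ (rc_le rc _ _)).
  case: (leP (Q * a + (2 - Q)) 0) => ?; first by rewrite min_l //; lra.
  by rewrite minEle; case: ifP.
have thI a : inI (thF a).
  rewrite /thF; case: (leP (Q * a + (2 - Q)) 0) => ?; first by rewrite min_l ?ler01 //; split; lra.
  by case: (leP (Q * a + (2 - Q)) 1) => ?; split; lra.
have [] // := homotopic_reparam hZF hR rc (th := th) (thF := thF) Ln hf.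
- by rewrite /th /rle /rlt; definability.
- apply: square_cont_min; apply: square_cont_max; apply: square_cont_affine.
    by rewrite PSn; lra.
  exact: square_cont_fst.
- by rewrite /thF mulr0 add0r max_r ?min_l //; lra.
- rewrite /thF mulr1 max_l; last by lra.
  by rewrite min_r //; lra.
- move=> a aI; case: (fP a aI) => [[-> ->]|[k [ko [lk ->]]]].
    by rewrite /thF mulr1 max_l ?min_r //; lra.
  have a1 := level_lt1 lk aI; have [H1 H2] := lk; have [b0 b1] := level_arg ko lk.
  have u0 : 0 <= 1 - a by lra.
  case: (omega_lt_or_le hZF ko no) => [kn|[nk|E]].
  + rewrite slot_value_zero //; last first.
      by rewrite ap_chi_notin // in_upair // => -[] E; subst k; apply: (mem_irrefl hZF kn).
    have le : P (succ k) * (1 - a) <= P n * (1 - a).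
      by apply: ler_wpM2r => //; apply: pow_le => //; [apply: succ_omega|apply: succ_nle].
    have th0 : Q * a + (2 - Q) <= 0.
      have : 2 * (P n * (1 - a)) = Q - Q * a by rewrite PSn; ring.
      by lra.
    by rewrite /thF max_r ?min_l //; lra.
  + rewrite slot_value_zero //; last first.
      by rewrite ap_chi_notin // in_upair // => -[] E; subst k; apply: (mem_irrefl hZF nk).
    have le : Q * (1 - a) <= P k * (1 - a).
      by apply: ler_wpM2r => //; apply: pow_le => //; apply: succ_nle.
    have th1 : 1 <= Q * a + (2 - Q).
      have : Q * (1 - a) = Q - Q * a by ring.
      by lra.
    by rewrite /thF max_l ?min_r //; lra.
  + subst k; rewrite slot_value_one; last by rewrite ap_chi_in // in_upair //; left.
    have E : arg n a = Q * a + (2 - Q) by rewrite /arg -/Q; ring.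
    by rewrite /thF -E max_l // min_l.
move=> Lf H; exact: (loop_class_eq hZF hR rc).
Qed.

Theorem loops_card_le K H mH phi : DC M -> all_cantor_subsets_baire M ->
  is_subgroup K (pi1 R X T x) (pi1_mul R X T x) -> deeply_concatenable R X T x l K ->
  is_group H mH -> is_hom phi K (pi1_mul R X T x) H (ap2 mH) ->
  ~ eventually (fun n => in_ker phi K H (ap2 mH) (class (ap l n))) ->
  card_le cantor H.
Proof.
move=> hDC hBP [Kpi1 _] [_ dc] [_ hH] [phif phiM] nker.
have hp y : y ∈ K -> ap phi y ∈ H by apply: (ap_in hZF phif).
have Lp sigma : sigma ∈ cantor -> loop (lp sigma).
  by move=> sc; apply: loop_power_loop => //; apply/Kpi1/dc.
have incl := in_loop_class hZF rc.
have self k : loop k -> k ∈ class k.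
  by move=> lk; rewrite incl; [split=> //; apply: (homotopic_refl hZF rc)|exact: lk.1].
have class_of d w : d ∈ K -> w ∈ d -> loop w -> d = class w.
  move=> /Kpi1 /(in_pi1 hZF rc) [k [lk ->]]; rewrite incl; last exact: lk.1.
  by move=> [lw kw] _; apply: (loop_class_eq hZF hR rc).
have lpE sigma w : sigma ∈ cantor ->
    w = lp sigma <-> is_fun w I X /\ ∀ s ∈ I, relD sigma s (app w s).
  move=> sc; have [hf fP] := loop_powerP sc; split=> [->|[hw wP]].
    split=> // _ /(in_unitI hZF rc) [a [aI ->]].
    by rewrite -(ap_app hZF hf) ?relDE //; [apply: fP|apply: inIv].
  apply: (fun_ext hZF hw hf) => _ /(in_unitI hZF rc) [a [aI ->]].
  apply: esym; apply: loop_power_at => //; apply/relDE => //.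
  by rewrite (ap_app hZF hw); [apply: wP|]; apply: inIv.
(* The class of the infinite concatenation is described as the member d of K that contains it, which
   by [lpE] is a first-order condition; [class_of] shows that d is determined. *)
have [h [hh hP']] : exists h, is_fun h cantor H /\ ∀ sigma ∈ cantor,
    ∃ d ∈ K, ap h sigma = app phi d /\ ∃ w ∈ d,
      is_fun w I X /\ ∀ s ∈ I, relD sigma s (app w s).
  apply: (@fun_of_relation _ hZF cantor H (fun sigma y =>
    ∃ d ∈ K, y = app phi d /\ ∃ w ∈ d, is_fun w I X /\ ∀ s ∈ I, relD sigma s (app w s))).
    by rewrite /relD /is_fun /rle /rlt; definability.
  move=> sigma sc; have cK := dc sigma sc; exists (ap phi (class (lp sigma))); split.
    split; first exact: hp.
    exists (class (lp sigma)); split=> //; split; first exact: (ap_app hZF phif).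
    by exists (lp sigma); split; [apply/self/Lp|apply/lpE].
  move=> y [_ [d [dK [-> [w [wd /(lpE _ _ sc) E]]]]]]; subst w.
  by rewrite (class_of _ _ dK wd (Lp _ sc)) (ap_app hZF phif).
have hE sigma : sigma ∈ cantor -> ap h sigma = ap phi (class (lp sigma)).
  move=> sc; have [d [dK [-> [w [wd /(lpE _ _ sc) E]]]]] := hP' sigma sc; subst w.
  by rewrite -(class_of _ _ dK wd (Lp _ sc)) (ap_app hZF phif).
have [D hD] := doubling_exists hZF.
apply: (card_le_of_flips hZF hDC hBP hD hh) => m mo.
have [n [no [mn ngn]]] := not_eventually nker mo.
exists n; split=> //; split=> // s so ns eq_h; apply: ngn.
rewrite in_pow // in so.
have c t : chi t ∈ cantor := chi_cantor hZF t.
(* Cutting s at n writes its class as a product of two factors; adding n to s inserts the class of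
   the n-th loop between them, so both factors can be cancelled in H. *)
have [s1 hs1] := @separation _ hZF (fun k => k ∈ n) s ltac:(by definability).
have [s2 hs2] := @separation _ hZF (fun k => ~ k ∈ n) s ltac:(by definability).
have in_s k : k ∈ cup s (upair n n) <-> k ∈ s \/ k = n.
  by rewrite in_cup // in_upair //; tauto.
have in_s2 k : k ∈ cup s2 (upair n n) <-> (k ∈ s /\ ~ k ∈ n) \/ k = n.
  by rewrite in_cup // hs2 in_upair //; tauto.
have nn := mem_irrefl hZF (a := n).
have neq k : k ∈ n -> k <> n by move=> kn E; subst k.
have S1 : class (lp (chi s)) =
    pi1_mul R X T x (class (lp (chi s1))) (class (lp (chi s2))).
  by apply: (loop_class_split (n := n)) => //; try exact: Lp;
    move=> k ko kn; rewrite hs1 hs2; tauto.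
have S2 : class (lp (chi (cup s (upair n n)))) =
    pi1_mul R X T x (class (lp (chi s1))) (class (lp (chi (cup s2 (upair n n))))).
  apply: (loop_class_split (n := n)) => //; try exact: Lp;
    move=> k ko kn; rewrite hs1 in_s in_s2; first by have := neq k kn; tauto.
  by tauto.
have S3 : class (lp (chi (cup s2 (upair n n)))) =
    pi1_mul R X T x (class (lp (chi (upair n n)))) (class (lp (chi s2))).
  (* The cut is at n + 1, so that n falls into the first factor; the part [s2] lies above n because
     n is not in s. *)
  apply: (loop_class_split (n := succ n)); rewrite ?in_succ //; try exact: Lp.
  - exact: succ_omega.
  - move=> k ko; rewrite in_succ // hs2 in_s2 in_upair // => -[kn|->]; last by tauto.
    by have := neq k kn; tauto.
  - by move=> k ko; rewrite in_succ // hs2 in_s2 in_upair //; tauto.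
have E0 := loop_class_single no.
have k1 := dc _ (c s1); have k2 := dc _ (c s2); have k3 := dc _ (c (upair n n)).
have k4 := dc _ (c (cup s2 (upair n n))).
rewrite -E0; split=> //.
move: eq_h; rewrite (hE _ (c s)) (hE _ (c _)) S1 S2.
rewrite (phiM _ k1 _ k2) (phiM _ k1 _ k4) S3 (phiM _ k3 _ k2) => E.
have [uH u1] := unit_ofP hH.
have mHC y z : y ∈ H -> z ∈ H -> ap2 mH y z ∈ H by move=> yH zH; apply hH.
have {}E := group_cancel_l hH (hp _ k1) (hp _ k2) (mHC _ _ (hp _ k3) (hp _ k2)) E.
apply: (group_cancel_r hH (hp _ k2)) => //; first exact: hp.
by rewrite -E (u1 _ (hp _ k2)).1.
Qed.

End LoopPower.

Theorem theorem1 (M : structure)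
    (hZF : ZF M) (hDC : DC M) (hBP : all_cantor_subsets_baire M) :
  (forall G mG T g H mH phi : M,
     hausdorff_topological_group G mG T ->
     is_fun g omega G ->
     descends_to_unit G mG T g ->
     is_group H mH ->
     is_hom phi G (ap2 mG) H (ap2 mH) ->
     ~ eventually (fun n => in_ker phi G H (ap2 mH) (ap g n)) ->
     card_le cantor H)
  /\
  (forall (R : real_data M) (X T x l K H mH phi : M),
     is_reals R ->
     is_topology X T ->
     x ∈ X ->
     loop_sequence R X T x l ->
     is_subgroup K (pi1 R X T x) (pi1_mul R X T x) ->
     deeply_concatenable R X T x l K ->
     is_group H mH ->
     is_hom phi K (pi1_mul R X T x) H (ap2 mH) ->
     ~ eventually (fun n => in_ker phi K H (ap2 mH) (loop_class R X T x (ap l n))) ->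
     card_le cantor H).
Proof.
split=> [G mG T g H mH phi hG hg gd hH hphi nker|].
  exact: (htg_card_le hZF hG hg gd hDC hBP hH hphi nker).
move=> R X T x l K H mH phi hR _ hx hl hK dc hH hphi nker.
have [F [v rc]] := real_coding_exists hZF hR.
have [p [P hP]] := powers_of_two_exist hZF hR rc.
exact: (loops_card_le hZF hR rc hP hx hl hDC hBP hK dc hH hphi nker).
Qed.
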